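(* Let $p$ be an odd prime, $q=p^m$ with $m\ge 1$, $\alpha\in\mathbb F_q^\times\setminus\mathbb F_q^{\times 2}$ and $u\in\mathbb F_q$. Let $\pi=\pi_r$ be an irreducible representation of ${\rm PGL}_2(\mathbb F_q)$ over $\overline{\mathbb Q}_p$ admitting nonzero fixed vectors for both $H$ and $K_{\alpha}$ (equivalently, for both $H$ and its companion torus $K_{\alpha,u}$), where the integer $0\le r\le (q-1)/2$ is attached to $\pi$ as in the context. Then $c(\pi_r;H,K_{\alpha,u})\in\mathcal O_m$ and $$c(\pi_r;H,K_{\alpha,u})\equiv [P_r(u/\sqrt{\alpha})]^2 \mod p,$$ where $P_r(X)\in\mathbb Z[\tfrac12][X]$ is the $r$-th Legendre polynomial.
   Context: Tori: $H$ is the image in ${\rm PGL}_2(\mathbb F_q)$ of the diagonal matrices, $H=\left\{\begin{pmatrix} a&0\\0&1\end{pmatrix} : a\in\mathbb F_q^\times\right\}$. For $\alpha\in\mathbb F_q^\times\setminus\mathbb F_q^{\times2}$ the non-split torus in ${\rm PGL}_2(\mathbb F_q)$ is $K_\alpha=\left\{\begin{pmatrix}1&\alpha z\\ z&1\end{pmatrix} : z\in\mathbb F_q\right\}\cup\left\{\begin{pmatrix}0&\alpha\\1&0\end{pmatrix}\right\}$, and for $u\in\mathbb F_q$, $K_{\alpha,u}=\begin{pmatrix}1&u\\0&1\end{pmatrix}K_\alpha\begin{pmatrix}1&-u\\0&1\end{pmatrix}$. Correlation coefficient: for an irreducible complex representation $\pi$ of a finite group $G$ with one-dimensional spaces of $H$-invariant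 and of $K$-invariant vectors, choose a $G$-invariant Hermitian inner product $\langle\ ,\ \rangle_\pi$ and unit vectors $v_H$ ($H$-invariant) and $v_K$ ($K$-invariant); then $c(\pi;H,K)=|\langle v_H,v_K\rangle_\pi|^2$, which is independent of choices. Identification: an isomorphism $\mathbb C\cong\overline{\mathbb Q}_p$ is fixed, and representations over $\overline{\mathbb Q}_p$ are viewed as complex representations, and $c(\pi;H,K)$ as an element of $\overline{\mathbb Q}_p$, through it. $\mathcal O_m\subset\overline{\mathbb Z}_p$ denotes the ring of integers of the unramified extension of $\mathbb Q_p$ of degree $m$. The residue field of $\overline{\mathbb Z}_p$ is identified with an algebraic closure $\overline{\mathbb F}_p$ containing $\mathbb F_{q^2}$, so $\mathcal O_m/p\mathcal O_m=\mathbb F_q$. The congruence means equality in $\mathbb F_q$, where $P_r$ is reduced mod $p$ (its coefficients lie in $\mathbb Z[\frac12]$ and $p$ is odd) and $\sqrt\alpha\in\mathbb F_{q^2}$ is a square root of $\alpha$; the square $[P_r(u/\sqrt\alpha)]^2$ lies in $\mathbb F_q$ and does not depend on the choice of $\sqrt{\alpha}$ because $P_r$ is even or odd. Parametrization of representations: let $\chi:\mathbb F_q^\times\to\overline{\mathbb Z}_p^\times$ (resp. $\psi:\mathbb F_{q^2}^\times\to\overline{\mathbb Z}_p^\times$) be the character whose reduction mod $p$ is the identity character of $\mathbb F_q^\times$ (resp. $\mathbb F_{q^2}^\times$), i.e. the Teichmüller character, and let $\eta=\chi^{(q-1)/2}\circ\det$ be the quadratic character of ${\rm PGL}_2(\mathbb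 F_q)$. The irreducible representations of ${\rm PGL}_2(\mathbb F_q)$ admitting nonzero vectors fixed by $H$ and nonzero vectors fixed by $K_\alpha$ are, up to isomorphism: the principal series $\pi_r={\rm Ps}(\chi^r,\chi^{-r})$, $1\le r\le\frac{q-3}{2}$ (induced from the character $\chi^r\otimes\chi^{-r}$ of the Borel subgroup); the cuspidal representations $\pi_r=\pi(\psi^{(q-1)(r+1)})$ attached to the character $\psi^{(q-1)(r+1)}$ of $\mathbb F_{q^2}^\times$, $0\le r\le\frac{q-3}{2}$; the twisted Steinberg representation ${\rm St}\otimes\eta$, for which $r=\frac{q-1}{2}$; and the trivial representation, for which $r=0$. For all of these the spaces of $H$-fixed and $K_{\alpha,u}$-fixed vectors are one-dimensional. Legendre polynomials: $P_0(x)=1$, $P_1(x)=x$, $(r+1)P_{r+1}(x)=(2r+1)xP_r(x)-rP_{r-1}(x)$. *)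

(* Defs.v *)
From HB Require Import structures.
From mathcomp Require Import all_boot all_order all_algebra all_fingroup.
From mathcomp Require Import all_solvable all_field all_character.
From mathcomp Require Import complex.
From mathcomp Require Import boolp classical_sets reals.

Set Implicit Arguments.
Unset Strict Implicit.
Unset Printing Implicit Defensive.

Import Order.TTheory GRing.Theory Num.Theory.
Local Open Scope ring_scope.

(* Z_p is the inverse limit of the rings Z/p^n.  The n-th component of x is   *)
(* the representative in [0, p^n[ of the class of x modulo p^n; the single    *)
(* condition below says both that it is reduced and that the sequence is      *)
(* coherent.  Primality is carried by the type because the integral domain    *)
(* instance depends on it.                                                    *)
Record padic_int (p : nat) (p_pr : prime p) := PadicInt {
  padic_res : nat -> int;
  _ : `[< forall n, padic_res n = modz (padic_res n.+1) (p ^ n)%:Z >] }.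

HB.instance Definition _ p p_pr := [isSub for @padic_res p p_pr].
HB.instance Definition _ p (p_pr : prime p) := gen_eqMixin (padic_int p_pr).
HB.instance Definition _ p (p_pr : prime p) :=
  gen_choiceMixin (padic_int p_pr).

Section PadicIntegers.
Variables (p : nat) (p_pr : prime p).
Local Notation Zp := (padic_int p_pr).
Implicit Types x y z : Zp.

Local Notation P n := ((p ^ n)%:Z).
Local Notation cong n a b := (modz a (P n) = modz b (P n)).

Fact padic_resE x n : padic_res x n = modz (padic_res x n.+1) (P n).
Proof. by case: x => f /= /asboolP. Qed.

Fact padic_res_mod x n : modz (padic_res x n) (P n) = padic_res x n.
Proof. by rewrite {1}padic_resE modz_mod -padic_resE. Qed.

Fact padic_eq x y :
  (forall n, cong n (padic_res x n) (padic_res y n)) -> x = y.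
Proof.
move=> exy; apply: val_inj; apply/funext => n /=.
by rewrite -padic_res_mod exy padic_res_mod.
Qed.

Fact modz_modS (a : int) n : cong n (modz a (P n.+1)) a.
Proof.
apply/eqP; rewrite eqz_mod_dvd; apply: (@dvdz_trans (P n.+1)).
  by rewrite expnS PoszM dvdz_mull.
by rewrite -eqz_mod_dvd modz_mod.
Qed.

Fact padic_of_subproof (a : nat -> int) :
    (forall n, cong n (a n) (a n.+1)) ->
  `[< forall n, modz (a n) (P n) = modz (modz (a n.+1) (P n.+1)) (P n) >].
Proof. by move=> ca; apply/asboolP => n; rewrite modz_modS ca. Qed.

Definition padic_of a ca : Zp := PadicInt p_pr (@padic_of_subproof a ca).

Fact padic_congS x n : cong n (padic_res x n) (padic_res x n.+1).
Proof. by rewrite padic_res_mod -padic_resE. Qed.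

Fact padic_opp_subproof x n :
  cong n (- padic_res x n) (- padic_res x n.+1).
Proof.
apply/eqP; rewrite eqz_mod_dvd opprK addrC -eqz_mod_dvd.
by apply/eqP/esym/padic_congS.
Qed.

Fact padic_add_subproof x y n :
  cong n (padic_res x n + padic_res y n) (padic_res x n.+1 + padic_res y n.+1).
Proof. by rewrite -modzDm !padic_congS modzDm. Qed.

Fact padic_mul_subproof x y n :
  cong n (padic_res x n * padic_res y n) (padic_res x n.+1 * padic_res y n.+1).
Proof. by rewrite -modzMm !padic_congS modzMm. Qed.

Definition padic_const (a : int) : Zp := @padic_of (fun=> a) (fun=> erefl).
Definition padic_opp x := padic_of (padic_opp_subproof x).
Definition padic_add x y := padic_of (padic_add_subproof x y).
Definition padic_mul x y := padic_of (padic_mul_subproof x y).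

Fact padic_addA : associative padic_add.
Proof.
move=> x y z; apply: padic_eq => n /=.
by rewrite !modz_mod modzDml modzDmr addrA.
Qed.

Fact padic_addC : commutative padic_add.
Proof. by move=> x y; apply: padic_eq => n /=; rewrite addrC. Qed.

Fact padic_add0 : left_id (padic_const 0) padic_add.
Proof.
by move=> x; apply: padic_eq => n /=; rewrite modz_mod modzDml add0r.
Qed.

Fact padic_addN : left_inverse (padic_const 0) padic_opp padic_add.
Proof.
by move=> x; apply: padic_eq => n /=; rewrite !modz_mod modzDml addNr.
Qed.

HB.instance Definition _ :=
  GRing.isZmodule.Build Zp padic_addA padic_addC padic_add0 padic_addN.

Fact padic_mulA : associative padic_mul.
Proof.
move=> x y z; apply: padic_eq => n /=.
by rewrite !modz_mod modzMml modzMmr mulrA.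
Qed.

Fact padic_mulC : commutative padic_mul.
Proof. by move=> x y; apply: padic_eq => n /=; rewrite mulrC. Qed.

Fact padic_mul1 : left_id (padic_const 1) padic_mul.
Proof.
by move=> x; apply: padic_eq => n /=; rewrite modz_mod modzMml mul1r.
Qed.

Fact padic_mulD : left_distributive padic_mul padic_add.
Proof.
move=> x y z; apply: padic_eq => n /=.
by rewrite !modz_mod modzMml modzDm mulrDl.
Qed.

Fact padic_res0 n : padic_res (0 : Zp) n = 0.
Proof. exact: mod0z. Qed.

Fact padic_1_neq0 : padic_const 1 != 0.
Proof.
apply/eqP => /(congr1 (fun x : Zp => padic_res x 1)).
rewrite padic_res0 /= expn1 => /dvdz_mod0P; rewrite dvdz1 absz_nat => /eqP p1.
by have := p_pr; rewrite p1.
Qed.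

HB.instance Definition _ := GRing.Zmodule_isComNzRing.Build Zp
  padic_mulA padic_mulC padic_mul1 padic_mulD padic_1_neq0.

Definition padic_unit : pred Zp := [pred x | `[< exists y, y * x = 1 >]].
Definition padic_inv x : Zp :=
  if x \in padic_unit then xget 0 [set y | y * x = 1]%classic else x.

Fact padic_mulV : {in padic_unit, left_inverse 1 padic_inv *%R}.
Proof.
move=> x xU; rewrite /padic_inv xU; have /asboolP := xU => -[y yx].
by case: xgetP => [? _ //| /(_ y)].
Qed.

Fact padic_unitP x y : y * x = 1 -> padic_unit x.
Proof. by move=> yx; apply/asboolP; exists y. Qed.

Fact padic_inv_out : {in [predC padic_unit], padic_inv =1 id}.
Proof. by move=> x /negbTE xU; rewrite /padic_inv xU. Qed.

HB.instance Definition _ := GRing.ComNzRing_hasMulInverse.Build Zp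
  padic_mulV padic_unitP padic_inv_out.

Fact padic_neq0 x : x != 0 ->
  exists i, forall j, ~~ (P i %| padic_res x (i + j)%N)%Z.
Proof.
move=> xn0; have [i xi]: exists i, padic_res x i != 0.
  apply: contrapT => x0; move/eqP: xn0; apply; apply: padic_eq => n.
  rewrite padic_res0; congr (modz _ _).
  by apply: contrapT => xn; apply: x0; exists n; apply/eqP.
exists i => j; apply: contra xi => /dvdz_mod0P xi0; apply/eqP.
rewrite -padic_res_mod -[RHS]xi0.
elim: j {xi0} => [|j IH]; first by rewrite addn0.
rewrite IH addnS [in LHS]padic_resE; apply/eqP.
rewrite eqz_mod_dvd; apply: (@dvdz_trans (P (i + j)%N)).
  by rewrite expnD PoszM dvdz_mulr.
by rewrite -eqz_mod_dvd modz_mod.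
Qed.

Fact padic_idomain x y : x * y = 0 -> (x == 0) || (y == 0).
Proof.
move=> xy0; case: (eqVneq x 0) => //= /padic_neq0[i xi].
apply: contraT => /padic_neq0[j yj].
have /(congr1 (fun z : Zp => padic_res z (i + j)%N)) := xy0.
rewrite padic_res0 /= => /dvdz_mod0P.
have := xi j; have := yj i; rewrite [(j + i)%N]addnC.
move: (padic_res x _) (padic_res y _) => a b.
rewrite !dvdzE abszM !absz_nat.
move: `|a|%N `|b|%N => {}a {}b; case: a => [|a]; first by rewrite dvdn0.
case: b => [|b]; first by rewrite dvdn0.
rewrite !pfactor_dvdn // ?muln_gt0 // lognM // -!ltnNge => bj ai.
by rewrite leqNgt -addnS; rewrite (leq_trans _ (leq_add ai bj)) ?addSn.
Qed.

HB.instance Definition _ :=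
  GRing.ComUnitRing_isIntegral.Build Zp padic_idomain.

End PadicIntegers.

Notation padic_num p_pr := {fraction padic_int p_pr}.

Section Integrality.
Variables (p : nat) (p_pr : prime p).
Local Notation Zp := (padic_int p_pr).
Local Notation Qp := (padic_num p_pr).

(* Elements, integral over Z_p, of a field E given with a map iQ : Q_p -> E.  *)
Definition padic_integral (E : fieldType) (iQ : Qp -> E) (x : E) : Prop :=
  integralOver (fun a : Zp => iQ (tofrac a)) x.

(* An algebraic closure of Q_p. *)
Definition is_padic_closure (L : closedFieldType) (iQ : {rmorphism Qp -> L}) :=
  forall x : L, algebraicOver iQ x.

(* red identifies the residue field of the valuation ring of L with k: it is  *)
(* a surjective ring morphism onto the field k, so its kernel is the maximal  *)
(* ideal.  The values of red on non-integral elements are irrelevant.         *)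
Definition is_residue_map (L : closedFieldType) (iQ : {rmorphism Qp -> L})
    (k : fieldType) (red : L -> k) : Prop :=
  [/\ red 1 = 1,
      forall x y, padic_integral iQ x -> padic_integral iQ y ->
        red (x + y) = red x + red y,
      forall x y, padic_integral iQ x -> padic_integral iQ y ->
        red (x * y) = red x * red y
    & forall t : k, exists2 x, padic_integral iQ x & red x = t].

Definition padic_ext_integral (K : fieldExtType Qp) (x : K) : Prop :=
  padic_integral (fun a : Qp => a%:A) x.

(* The maximal ideal of the ring of integers of K (its elements with          *)
(* non-integral inverse, together with 0) is generated by p.  The residue     *)
(* extension being finite over F_p, it is automatically separable.            *)
Definition unramified (K : fieldExtType Qp) : Prop :=
  forall x : K, padic_ext_integral x -> ~ padic_ext_integral x^-1 ->
    exists2 y : K, padic_ext_integral y & x = p%:R * y.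

(* The multiplicative lift of the inclusion i : E -> k to the valuation ring  *)
(* of L, as a function on E whose value at 0 is irrelevant.                   *)
Definition is_Teichmuller (L : closedFieldType) (iQ : {rmorphism Qp -> L})
    (k : fieldType) (red : L -> k) (E : finFieldType) (i : {rmorphism E -> k})
    (chi : E -> L) : Prop :=
  (forall x y, x != 0 -> y != 0 -> chi (x * y) = chi x * chi y)
  /\ (forall x, x != 0 -> padic_integral iQ (chi x) /\ red (chi x) = i x).

End Integrality.

Definition mat2 (R : Type) (a b c d : R) : 'M[R]_2 :=
  \matrix_(i, j) if i == 0 then (if j == 0 then a else b)
                 else (if j == 0 then c else d).

Section PGL2.
Variable F : finFieldType.

Definition GL2_center : {group {'GL_2[F]}} := 'Z('GL_2[F])%G.
Definition PGL2 : {group coset_of GL2_center} := ('GL_2[F] / GL2_center)%G.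

Definition GL2_of (A : 'M[F]_2) : {'GL_2[F]} := insubd (1%g : {'GL_2[F]}) A.

(* The class of an invertible matrix in PGL_2 (the identity otherwise). *)
Definition pgl (A : 'M[F]_2) : coset_of GL2_center :=
  coset GL2_center (GL2_of A).

Definition split_torus : {set coset_of GL2_center} :=
  [set pgl (mat2 a 0 0 1) | a in [pred a : F | a != 0]].

Definition nonsplit_torus (alpha : F) : {set coset_of GL2_center} :=
  [set pgl (mat2 1 (alpha * z) z 1) | z in [set: F]]
    :|: [set pgl (mat2 0 alpha 1 0)].

Definition unipotent (b : F) : coset_of GL2_center := pgl (mat2 1 b 0 1).

Definition nonsplit_torus_shift (alpha u : F) : {set coset_of GL2_center} :=
  [set (unipotent u * k * unipotent (- u)%R)%g | k in nonsplit_torus alpha].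

Definition unipotents : {set coset_of GL2_center} :=
  [set unipotent b | b in [set: F]].

End PGL2.

(* A matrix representation rG acts on the left on column vectors, that is,    *)
(* g maps v to rG g *m v.                                                     *)
Section FixedVectors.
Variables (K : fieldType) (gT : finGroupType) (G : {group gT}) (n : nat).
Variable rG : mx_representation K G n.

Definition fixed_by (A : {set gT}) (v : 'cV[K]_n) : Prop :=
  forall a, a \in A -> rG a *m v = v.

Definition has_fixed_vector (A : {set gT}) : Prop :=
  exists2 v : 'cV[K]_n, v != 0 & fixed_by A v.

End FixedVectors.

Section Correlation.
Variables (R : realType) (gT : finGroupType) (G : {group gT}) (n : nat).
Variables (rG : mx_representation R[i] G n) (A B : {set gT}).

Definition invariant_dot (f : {dot 'cV[R[i]]_n for Num.conj}) : Prop :=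
  forall g, g \in G -> forall v w, f (rG g *m v) (rG g *m w) = f v w.

(* The correlation coefficient |<v_A, v_B>|^2.  When rG is irreducible and    *)
(* the spaces of vectors fixed by A and by B are one-dimensional, the set     *)
(* below is a singleton.                                                      *)
Definition correlation : R[i] :=
  xget 0 [set c | exists (f : {dot 'cV[R[i]]_n for Num.conj}) vA vB,
            [/\ invariant_dot f,
                fixed_by rG A vA /\ f vA vA = 1,
                fixed_by rG B vB /\ f vB vB = 1
              & c = `|f vA vB| ^+ 2]]%classic.

End Correlation.

Section Parametrization.
Variables (F F2 : finFieldType) (iF : {rmorphism F -> F2}).
Variables (L : fieldType) (n : nat).
Variable rG : mx_representation L (PGL2 F) n.
Variables (chi : F -> L) (psi : F2 -> L).

Local Notation GL := {'GL_2[F]}.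
Local Notation q := #|F|.

(* rG is isomorphic to the representation of GL_2(F) on the space V of        *)
(* functions on GL_2(F), where g maps f to x |-> w g * f (x * g).             *)
Definition isom_functions (V : {ffun GL -> L^o} -> Prop) (w : GL -> L) : Prop :=
  exists T : {linear 'cV[L]_n -> {ffun GL -> L^o}},
    [/\ injective T,
        forall f, V f <-> exists v, T v = f
      & forall g v x, T (rG (coset _ g) *m v) x = w g * T v (x * g)%g].

(* Functions which are left equivariant for the character mu1 (x) mu2 of the  *)
(* subgroup of upper triangular matrices.                                     *)
Definition borel_equivariant (mu1 mu2 : F -> L) (f : {ffun GL -> L^o}) : Prop :=
  forall b x : GL, GLval b ord_max ord0 = 0 ->
    f (b * x)%g =
      mu1 (GLval b ord0 ord0) * mu2 (GLval b ord_max ord_max) * f x.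

Definition is_principal_series (mu1 mu2 : F -> L) : Prop :=
  isom_functions (borel_equivariant mu1 mu2) (fun=> 1).

(* Functions on P^1 with sum 0, on which the translation action is twisted by *)
(* the character w of GL_2(F).                                                *)
Definition is_Steinberg_twist (w : GL -> L) : Prop :=
  isom_functions
    (fun f => borel_equivariant (fun=> 1) (fun=> 1) f /\ \sum_x f x = 0) w.

Definition is_trivial_rep : Prop :=
  n = 1%N /\ forall g, g \in PGL2 F -> rG g = 1%:M.

(* The cuspidal irreducible representations are those without nonzero fixed   *)
(* vectors under the unipotent upper triangular matrices.  The one attached   *)
(* to the character theta of F2^* is identified by its trace on each type of  *)
(* conjugacy class of GL_2(F): central, central times unipotent, split and    *)
(* elliptic; these are the values of Ind_ZU theta.e - Ind_(F2^* ) theta, for  *)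
(* a nontrivial character e of the group U of these unipotent matrices and Z  *)
(* the center.                                                                *)
Definition is_cuspidal (theta : F2 -> L) : Prop :=
  [/\ ~ has_fixed_vector rG (unipotents F),
      forall a : F, a != 0 ->
        \tr (rG (pgl (mat2 a 0 0 a))) = (q - 1)%:R * theta (iF a),
      forall a : F, a != 0 ->
        \tr (rG (pgl (mat2 a 1 0 a))) = - theta (iF a),
      forall a b : F, a != 0 -> b != 0 -> a != b ->
        \tr (rG (pgl (mat2 a 0 0 b))) = 0
    & forall (g : GL) (y : F2), (forall a : F, y != iF a) ->
        root (char_poly (map_mx iF (GLval g))) y ->
        \tr (rG (coset _ g)) = - (theta y + theta (y ^+ q))].

Variant is_pi (r : nat) : Prop :=
| PrincipalSeries of (1 <= r <= (q - 3)./2)%N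
    & is_principal_series (fun a => chi a ^+ r) (fun a => chi a ^- r)
| Cuspidal of (r <= (q - 3)./2)%N
    & is_cuspidal (fun y => psi y ^+ ((q - 1) * (r + 1)))
| TwistedSteinberg of r = ((q - 1)./2)%N
    & is_Steinberg_twist (fun g => chi (\det (GLval g)) ^+ (q - 1)./2)
| Trivial of r = 0%N & is_trivial_rep.

End Parametrization.

Fixpoint legendre (r : nat) : {poly rat} :=
  match r with
  | 0 => 1
  | r'.+1 =>
    match r' with
    | 0 => 'X
    | s.+1 => (r'.+1)%:R^-1 *: ((r'.*2.+1)%:R *: ('X * legendre r')
                                - r'%:R *: legendre s)
    end
  end.

(* The Legendre polynomials have coefficients in Z[1/2]; away from            *)
(* characteristic 2, ratr is the reduction map on Z[1/2].                     *)
Definition legendre_in (E : fieldType) (r : nat) : {poly E} :=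
  map_poly ratr (legendre r).

(* Main.v *)
Require Import Defs.
From HB Require Import structures.
From mathcomp Require Import all_boot all_order all_algebra all_fingroup.
From mathcomp Require Import all_solvable all_field all_character.
From mathcomp Require Import complex.
From mathcomp Require Import boolp classical_sets reals.
From mathcomp Require Import ring zify.

(** Since |H| and |K| are prime to p, the projections e_H and e_K of the space
    of pi onto the H-fixed and the K-fixed vectors are averages over the two
    tori.  Their traces are the averages of the character of pi, and these are
    equal to 1: both fixed spaces are lines.  Hence e_H and e_K are orthogonal
    projections of rank one, and c(pi; H, K) = tr (e_H e_K) is the average of
    the character over the products h k ([correlation_trace]).  What has to be
    known about pi is thus its character, which is computed on each type of
    conjugacy class ([principal_series_traces], [Steinberg_traces],
    [cuspidal_traces]).

    Integrality.  The values of the character are integral combinations of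
    traces z + z^-1 with z ^ (q - 1) = 1 or z ^ (q + 1) = 1.  Such a trace
    lies in O_m ([unity_trace_unramified]): it is a fixed point of the m-th
    iterate of the Dickson polynomial of index p, and this iterate has one
    fixed point in each residue class of the complete ring O_m, because
    modulo p it is the map x ^ q, so that it preserves residue classes and
    contracts p-adic distances inside each of them.  The residue determines
    the trace since roots of unity of order prime to p are determined by
    their residues.

    Congruence.  On eigenvalues (a, b), the reduction of the character of pi_r
    is that of Sym^(2r) (x) det^(-r) plus that of one further twisted symmetric
    power (none for the Steinberg and trivial cases); after multiplication by
    a - b this becomes an identity between powers of a and b
    ([sym_character_ps], [sym_character_cusp], [sym_character_St]).  No weight
    of the second symmetric power on H is divisible by q - 1, so averaging
    over H kills it; on the first one, averaging over H keeps the middle weight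
    r only.  Over F_{q^2} the torus K is diagonalized by the matrix M with rows
    (u + s, u - s) and (1, 1), where s ^ 2 = alpha, and averaging over it keeps
    the middle weight too.  Therefore c is congruent to the product of the
    middle coefficients of Sym^(2r) M and Sym^(2r) M^-1.  The first is
    \sum_i 'C(r, i) ^ 2 (u + s) ^ i (u - s) ^ (r - i)
    = s ^ r * \sum_i 'C(r, i) ^ 2 (x + 1) ^ i (x - 1) ^ (r - i), with
    x = u / s, and the last sum is 2 ^ r P_r(x)
    ([legendre_square_binomial]); the second one has the same form, and the
    powers of 2 s cancel ([torus_sum_legendre]). *)

Set Implicit Arguments.
Unset Strict Implicit.
Unset Printing Implicit Defensive.

Import Order.TTheory GRing.Theory Num.Theory.
Local Open Scope ring_scope.


(** * Divisibility and completeness in the p-adic integers *)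

Section PadicIntegers.
Variables (p : nat) (p_pr : prime p).
Local Notation Zp := (padic_int p_pr).
Local Notation P n := ((p ^ n)%:Z).
Implicit Types x y : Zp.

Lemma padic_resD x y n :
  padic_res (x + y) n = modz (padic_res x n + padic_res y n) (P n).
Proof. by []. Qed.

Lemma padic_resM x y n :
  padic_res (x * y) n = modz (padic_res x n * padic_res y n) (P n).
Proof. by []. Qed.

Lemma padic_resN x n : padic_res (- x) n = modz (- padic_res x n) (P n).
Proof. by []. Qed.

Lemma padic_ext x y : (forall n, padic_res x n = padic_res y n) -> x = y.
Proof. by move=> exy; apply: padic_eq => n; rewrite exy. Qed.

Lemma padic_res_nat k n : padic_res (k%:R : Zp) n = modz k%:Z (P n).
Proof.
elim: k => [|k IH]; first by rewrite padic_res0 mod0z.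
by rewrite mulrS padic_resD IH [padic_res 1 n]/= modzDm -PoszD add1n.
Qed.

Lemma padic_res_of a ca n : padic_res (@padic_of p p_pr a ca) n = modz (a n) (P n).
Proof. by []. Qed.

Lemma padic_res_le x n m :
  (n <= m)%N -> modz (padic_res x m) (P n) = padic_res x n.
Proof.
move=> /subnK <-; elim: (m - n)%N => [|d IH]; first exact: padic_res_mod.
rewrite addSn -IH (padic_resE x (d + n)); apply/esym/eqP.
rewrite eqz_mod_dvd (@dvdz_trans (P (d + n))) //.
  by rewrite dvdzE !absz_nat dvdn_exp2l ?leq_addl.
by rewrite -eqz_mod_dvd modz_mod.
Qed.

(** Dividing the n+1-st residue by p gives the n-th residue of the quotient. *)
Lemma padic_divp x : padic_res x 1 = 0 -> exists y, x = p%:R * y.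
Proof.
move=> x0; have p0 : p%:Z != 0 by rewrite eqz_nat -lt0n prime_gt0.
have dv n : padic_res x n.+1 = (padic_res x n.+1 %/ p%:Z)%Z * p%:Z.
  apply/esym/divzK/dvdz_mod0P; rewrite -[RHS]x0.
  by rewrite -(@padic_res_le x 1 n.+1) // expn1.
have coh n : modz (padic_res x n.+1 %/ p%:Z)%Z (P n)
           = modz (padic_res x n.+2 %/ p%:Z)%Z (P n).
  apply/eqP; rewrite eqz_mod_dvd -(@dvdz_mul2r p%:Z) //.
  rewrite mulrBl -!dv -PoszM mulnC -expnS -eqz_mod_dvd.
  by rewrite padic_res_mod -padic_resE.
exists (padic_of p_pr coh); apply: padic_ext => n.
rewrite padic_resM padic_res_nat padic_res_of modzMm mulrC -dv.
by rewrite padic_resE.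
Qed.

Lemma padic_divpX x n : padic_res x n = 0 -> exists y, x = p%:R ^+ n * y.
Proof.
elim: n x => [|n IH] x xn0; first by exists x; rewrite mul1r.
have [|y xy] := @padic_divp x.
  by rewrite -(@padic_res_le _ 1 n.+1) // xn0 mod0z.
have [|z yz] := IH y; last by exists z; rewrite exprS -mulrA -yz.
move: xn0; rewrite xy padic_resM padic_res_nat modzMml => /dvdz_mod0P.
rewrite expnS PoszM dvdz_mul2l ?eqz_nat -?lt0n ?prime_gt0 // => /dvdz_mod0P.
by rewrite padic_res_le.
Qed.

Lemma padic_res_pX x n : padic_res (p%:R ^+ n * x) n = 0.
Proof.
by rewrite padic_resM -natrX padic_res_nat modzMml mulrC modzMl.
Qed.

Lemma padic_res_sub x y n :
  padic_res x n = padic_res y n -> exists z, x = y + p%:R ^+ n * z.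
Proof.
move=> exy; have [|z xyz] := @padic_divpX (x - y) n.
  by rewrite padic_resD padic_resN modzDmr exy subrr mod0z.
by exists z; rewrite -xyz addrC subrK.
Qed.

(** The inverses modulo all the powers of p, given by Bezout coefficients, form
    a coherent sequence because inverses are unique. *)
Lemma padic_unit_res x : padic_res x 1 != 0 -> x \is a GRing.unit.
Proof.
move=> x1; have cop n : coprimez (padic_res x n) (P n).
  case: n => [|n]; first by rewrite coprimezE coprimen1.
  rewrite coprimezE /= coprimeXr // coprime_sym prime_coprime //.
  apply: contra x1 => px; apply/eqP.
  rewrite -(@padic_res_le _ 1 n.+1) // expn1; apply/dvdz_mod0P.
  by rewrite dvdzE.
pose v n := projT1 (Bezoutz (padic_res x n) (P n)).
have vP n : modz (v n * padic_res x n) (P n) = modz 1 (P n).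
  have [w vw] := projT2 (Bezoutz (padic_res x n) (P n)).
  move/eqP: (cop n) => /= c; rewrite -/(v n) c in vw.
  by rewrite -[in RHS]vw addrC modzMDl.
have coh n : modz (v n) (P n) = modz (v n.+1) (P n).
  have e : modz (v n.+1 * padic_res x n) (P n) = modz 1 (P n).
    have := congr1 (modz^~ (P n)) (vP n.+1); rewrite !modz_modS => <-.
    by rewrite -modzMmr padic_congS modzMmr.
  rewrite -[v n]mulr1 -modzMmr -e modzMmr mulrCA -[RHS]modz_mod.
  by rewrite -modzMmr vP modzMmr mulr1 modz_mod.
apply/unitrPr; exists (padic_of p_pr coh); apply: padic_ext => n.
by rewrite padic_resM padic_res_of modzMmr mulrC vP.
Qed.

Lemma padic_factor x :
  x != 0 -> exists n u, u \is a GRing.unit /\ x = p%:R ^+ n * u.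
Proof.
move=> /padic_neq0[i xi].
have {xi}: ~~ (P i %| padic_res x i)%Z by have := xi 0%N; rewrite addn0.
elim: i x => [|i IH] x xi; first by rewrite dvd1z in xi.
have [x1|x1] := eqVneq (padic_res x 1) 0; last first.
  by exists 0%N, x; rewrite mul1r; split=> //; apply: padic_unit_res.
have [y xy] := padic_divp x1; have [|n [u [uU yu]]] := IH y.
  apply: contra xi => /dvdz_mod0P y0; rewrite padic_res_mod in y0.
  have [z yz] := padic_divpX y0; rewrite xy yz mulrA -exprS.
  by rewrite padic_res_pX dvdz0.
by exists n.+1, u; split=> //; rewrite xy yu mulrA exprS.
Qed.

Lemma padic_nat_unit k : coprime k p -> (k%:R : Zp) \is a GRing.unit.
Proof.
move=> kp; apply: padic_unit_res; rewrite padic_res_nat expn1.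
apply/eqP => /dvdz_mod0P; rewrite dvdzE /= => pk.
have : (p %| 1)%N by rewrite -(eqP kp) dvdn_gcd pk dvdnn.
by rewrite dvdn1 => /eqP p1; have := prime_gt1 p_pr; rewrite p1.
Qed.

(** The partial sums form a coherent sequence of residues, which is an element
    of the inverse limit. *)
Lemma padic_series (b : nat -> Zp) : exists s : Zp,
  forall n, exists t, s = \sum_(j < n) p%:R ^+ j * b j + p%:R ^+ n * t.
Proof.
pose S n := \sum_(j < n) p%:R ^+ j * b j.
have coh n : modz (padic_res (S n) n) (P n) = modz (padic_res (S n.+1) n.+1) (P n).
  have -> : S n.+1 = S n + p%:R ^+ n * b n by rewrite /S big_ord_recr.
  rewrite padic_res_mod padic_res_le // padic_resD.
  by rewrite padic_res_pX addr0 padic_res_mod.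
exists (padic_of p_pr coh) => n; apply: padic_res_sub.
by rewrite padic_res_of padic_res_mod.
Qed.

End PadicIntegers.

(** * Integral elements of an algebraic closure of Q_p *)

Section FractionNumerators.
Variable R : idomainType.

Lemma fraction_numden (c : {fraction R}) :
  exists a b : R, b != 0 /\ c = tofrac a / tofrac b.
Proof.
elim/quotW: c => x; exists (\n_x), (\d_x); split; first exact: denom_ratioP.
apply: (canRL (mulfK _)); first by rewrite tofrac_eq0 denom_ratioP.
unlock FracField.tofrac; rewrite -[LHS]FracField.pi_mul; apply/eqmodP => /=.
rewrite FracField.equivfE /FracField.mulf /=.
by rewrite !numden_Ratio ?mulf_neq0 ?oner_eq0 ?denom_ratioP // !mulr1 mulrC.
Qed.

End FractionNumerators.

Section PadicFractions.
Variables (p : nat) (p_pr : prime p).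
Local Notation Zp := (padic_int p_pr).
Local Notation Qp := (padic_num p_pr).

Lemma padic_p_neq0 : p%:R != 0 :> Zp.
Proof.
apply/eqP => /(congr1 (fun x : Zp => padic_res x 2)).
rewrite padic_res_nat padic_res0 modz_nat => /eqP; rewrite eqz_nat.
by rewrite modn_small ?gtn_eqF ?prime_gt0 // ltn_Pmulr ?prime_gt1 ?prime_gt0.
Qed.

Lemma padic_num_p_neq0 : p%:R != 0 :> Qp.
Proof. by rewrite -(rmorph_nat (tofrac (R := Zp))) tofrac_eq0 padic_p_neq0. Qed.

Lemma padic_num_scale (c : Qp) : exists n (a : Zp), p%:R ^+ n * c = tofrac a.
Proof.
have [a [b [b0 ->]]] := fraction_numden c.
have [n [u [uU bE]]] := padic_factor b0.
exists n, (a * u^-1); rewrite bE tofracM rmorphXn rmorph_nat invfM.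
rewrite [tofrac a * (_^-1 * _)]mulrCA mulVKf ?expf_neq0 ?padic_num_p_neq0 //.
by rewrite tofracM rmorphV.
Qed.

Lemma padic_num_common_scale f (c : 'I_f -> Qp) :
  exists n (a : 'I_f -> Zp), forall i, p%:R ^+ n * c i = tofrac (a i).
Proof.
have /choice[N N_P] := fun i => padic_num_scale (c i).
have /choice[a aP] := N_P.
exists (\sum_i N i)%N, (fun i => p%:R ^+ (\sum_(j | j != i) N j)%N * a i) => i.
by rewrite (bigD1 i) //= addnC exprD -mulrA aP tofracM rmorphXn rmorph_nat.
Qed.

End PadicFractions.

Section IntegralInClosure.
Variables (p : nat) (p_pr : prime p).
Local Notation Zp := (padic_int p_pr).
Local Notation Qp := (padic_num p_pr).
Variables (L : closedFieldType) (iQ : {rmorphism Qp -> L}).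
Hypothesis closL : is_padic_closure iQ.
Variables (k : closedFieldType) (red : L -> k).
Hypothesis redP : is_residue_map iQ red.
Hypothesis char_k : p%:R = 0 :> k.

Local Notation int := (padic_integral iQ).
Let iZ : {rmorphism Zp -> L} := iQ \o tofrac (R := Zp).

Lemma padic_integral_nat n : int n%:R.
Proof. exact: (integral_nat iZ). Qed.

Lemma padic_integral_Zp a : int (iQ (tofrac a)).
Proof. exact: (integral_id iZ). Qed.

Lemma padic_integralD x y : int x -> int y -> int (x + y).
Proof. exact: (@integral_add _ _ iZ). Qed.

Lemma padic_integralN x : int x -> int (- x).
Proof. exact: (@integral_opp _ _ iZ). Qed.

Lemma padic_integralM x y : int x -> int y -> int (x * y).
Proof. exact: (@integral_mul _ _ iZ). Qed.

Lemma padic_integralX x n : int x -> int (x ^+ n).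
Proof.
move=> intx; elim: n => [|n IH]; first exact: padic_integral_nat 1%N.
by rewrite exprS; apply: padic_integralM.
Qed.

Lemma padic_integral_sum (I : Type) (r : seq I) (P : pred I) (f : I -> L) :
  (forall i, P i -> int (f i)) -> int (\sum_(i <- r | P i) f i).
Proof.
move=> intf; elim/big_ind: _ => //; first exact: padic_integral_nat 0%N.
exact: padic_integralD.
Qed.

Lemma padic_integral_unit_inv n : coprime n p -> int n%:R^-1.
Proof.
move=> np; have nU := padic_nat_unit p_pr np.
suff -> : n%:R^-1 = iQ (tofrac (n%:R^-1 : Zp)) by apply: padic_integral_Zp.
by rewrite rmorphV // fmorphV !rmorph_nat.
Qed.

Lemma red1 : red 1 = 1. Proof. by case: redP. Qed.
Lemma redD x y : int x -> int y -> red (x + y) = red x + red y.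
Proof. by case: redP => _ + _ _; apply. Qed.
Lemma redM x y : int x -> int y -> red (x * y) = red x * red y.
Proof. by case: redP => _ _ + _; apply. Qed.

Lemma red0 : red 0 = 0.
Proof.
apply/(@addrI _ (red 0)); rewrite -redD ?addr0 //; exact: padic_integral_nat 0%N.
Qed.

Lemma redN x : int x -> red (- x) = - red x.
Proof.
move=> intx; apply/(@addrI _ (red x)); rewrite -redD ?subrr ?red0 //.
exact: padic_integralN.
Qed.

Lemma red_nat n : red n%:R = n%:R.
Proof.
elim: n => [|n IH]; first exact: red0.
rewrite !mulrS redD ?IH ?red1 //; first exact: padic_integral_nat 1%N.
exact: padic_integral_nat.
Qed.

Lemma redX x n : int x -> red (x ^+ n) = red x ^+ n.
Proof.
move=> intx; elim: n => [|n IH]; first exact: red1.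
by rewrite !exprS redM ?IH //; apply: padic_integralX.
Qed.

Lemma red_sum (I : Type) (r : seq I) (P : pred I) (f : I -> L) :
  (forall i, P i -> int (f i)) ->
  red (\sum_(i <- r | P i) f i) = \sum_(i <- r | P i) red (f i).
Proof.
move=> intf; elim: r => [|i r IH]; first by rewrite !big_nil red0.
rewrite !big_cons; case: ifP => // Pi.
by rewrite redD ?IH //; [apply: intf | apply: padic_integral_sum].
Qed.

Lemma padic_closure_p_neq0 : p%:R != 0 :> L.
Proof. by rewrite -(rmorph_nat iQ) fmorph_eq0 padic_num_p_neq0. Qed.

Lemma red_p_mul x : int x -> red (p%:R * x) = 0.
Proof.
by move=> intx; rewrite redM ?red_nat ?char_k ?mul0r //; apply: padic_integral_nat.
Qed.

(** Otherwise p would be a unit among the integral elements, while it reduces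
    to 0. *)
Lemma padic_integral_pV : ~ int p%:R^-1.
Proof.
move=> intpV; have := red1.
rewrite -(divff padic_closure_p_neq0) red_p_mul // => /eqP.
by rewrite eq_sym oner_eq0.
Qed.

(** If N is a common exponent of the denominators of a monic equation of x,
    then [p ^ N * x] satisfies the equation whose coefficient of degree [d - j]
    is multiplied by [p ^ (N * j)]. *)
Lemma padic_integral_scale x : exists n, int (p%:R ^+ n * x).
Proof.
have [f monf fx] : integralOver iQ x by apply/integral_algebraic/closL.
pose d := (size f).-1; pose c (i : 'I_d) := f`_i.
have [N [a aP]] := padic_num_common_scale c.
have sf : size f = d.+1 by rewrite prednK ?size_poly_gt0 ?monic_neq0.
have fd : f`_d = 1 by move/monicP: monf.
pose g : {poly L} := \poly_(i < d.+1) (p%:R ^+ (N * (d - i)) * iQ f`_i).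
exists N; apply: (@integral_root_monic _ _ iZ _ g).
- by rewrite monicE lead_coef_poly ?subnn ?muln0 ?mul1r ?fd ?rmorph1 ?oner_eq0.
- rewrite rootE horner_poly; move: fx; rewrite rootE horner_coef.
  rewrite size_map_poly sf => /eqP fx; apply/eqP.
  transitivity (p%:R ^+ (N * d) * \sum_(i < d.+1) (map_poly iQ f)`_i * x ^+ i).
    2: by rewrite fx mulr0.
  rewrite mulr_sumr; apply: eq_bigr => i _.
  rewrite coef_map exprMn -exprM mulrACA -exprD -mulnDr subnK //.
  by rewrite -ltnS ltn_ord.
- apply/integral_poly => i; rewrite coef_poly; case: ifP => [|_]; last first.
    exact: padic_integral_nat 0%N.
  rewrite ltnS leq_eqVlt => /orP[/eqP->|lt_id].
    rewrite subnn muln0 mul1r fd rmorph1; exact: padic_integral_nat 1%N.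
  have -> : (N * (d - i) = N * (d - i).-1 + N)%N.
    by rewrite -{1}(ltn_predK (m := 0) (n := d - i)) ?subn_gt0 // mulnS addnC.
  rewrite exprD -mulrA; apply: padic_integralM.
    rewrite -natrX; exact: padic_integral_nat.
  rewrite -(rmorph_nat iQ) -rmorphXn -rmorphM (aP (Ordinal lt_id)).
  exact: padic_integral_Zp.
Qed.

(** No nonzero element of L is divisible by all the powers of p, because its
    inverse becomes integral after multiplication by a power of p. *)
Lemma padic_separated x :
  (forall n, exists2 y, int y & x = p%:R ^+ n * y) -> x = 0.
Proof.
move=> xdiv; apply/eqP; apply: contrapT => /negP x0.
have [n intn] := padic_integral_scale x^-1.
have [y inty xy] := xdiv n.+1; apply: padic_integral_pV.
suff -> : p%:R^-1 = p%:R ^+ n * x^-1 * y by apply: padic_integralM.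
have y0 : y != 0 by apply: contra x0 => /eqP y0; rewrite xy y0 mulr0.
have pn0 : p%:R ^+ n != 0 :> L by rewrite expf_neq0 ?padic_closure_p_neq0.
move: padic_closure_p_neq0 pn0; rewrite xy exprS; set P := p%:R => P0 pn0.
by field; rewrite ?P0 ?pn0 ?y0.
Qed.

Lemma padic_integral_unity N x : (0 < N)%N -> x ^+ N = 1 -> int x.
Proof.
move=> N0 xN; apply: (@integral_root_monic _ _ iZ _ ('X^N - 1)).
- by rewrite monicXnsubC.
- by rewrite rootE !hornerE xN subrr.
- apply/integral_poly => i; rewrite coefB coefXn coef1.
  by apply: padic_integralD; [|apply: padic_integralN]; apply: padic_integral_nat.
Qed.

(** Reduction is injective on roots of unity of order prime to p: if [z != 1]
    has order dividing [N] then its powers sum to 0, whereas they would reduce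
    to [N%:R] if [z] reduced to 1. *)
Lemma red_unity_inj N x y : (0 < N)%N -> coprime N p ->
  x ^+ N = 1 -> y ^+ N = 1 -> red x = red y -> x = y.
Proof.
move=> N0 Np xN yN exy.
have intU z : z ^+ N = 1 -> int z by apply: padic_integral_unity.
have yV : y * y ^+ N.-1 = 1 by rewrite -exprS prednK.
pose z := x * y ^+ N.-1.
have zN : z ^+ N = 1 by rewrite exprMn xN exprAC yN expr1n mulr1.
have intz := intU z zN.
have redz : red z = 1.
  have intY := padic_integralX N.-1 (intU y yN).
  by rewrite redM ?exy -?redM ?yV ?red1 //; apply: intU.
have [z1|z1] := eqVneq z 1.
  have := congr1 ( *%R^~ y) z1.
  by rewrite /z -mulrA [_ * y]mulrC yV mulr1 mul1r.
have /eqP := subrX1 z N; rewrite zN subrr eq_sym mulf_eq0 subr_eq0 (negbTE z1) /=.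
move=> /eqP/(congr1 red); rewrite red0 red_sum => [|i _]; last exact: padic_integralX.
rewrite (eq_bigr (fun=> 1)) => [|i _]; last by rewrite redX // redz expr1n.
rewrite sumr_const card_ord => Nk.
have [[u v] /= e] : exists uv : nat * nat, (uv.1 * N = uv.2 * p + 1)%N.
  case: (egcdnP p N0) => u v e _; exists (u, v) => /=.
  by rewrite e (eqP Np).
have := congr1 (fun n => n%:R : k) e.
rewrite natrD !natrM Nk char_k !mulr0 add0r => /eqP.
by rewrite eq_sym oner_eq0.
Qed.

End IntegralInClosure.

(** * The ring of integers of the unramified extension *)

Section Unramified.
Variables (p : nat) (p_pr : prime p).
Local Notation Zp := (padic_int p_pr).
Local Notation Qp := (padic_num p_pr).
Variables (L : closedFieldType) (iQ : {rmorphism Qp -> L}).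
Hypothesis closL : is_padic_closure iQ.
Variables (k : closedFieldType) (red : L -> k).
Hypothesis redP : is_residue_map iQ red.
Hypothesis char_k : p%:R = 0 :> k.
Variables (m : nat) (Km : fieldExtType Qp).
Hypotheses (dimKm : \dim {:Km} = m) (unramKm : unramified Km).
Variable iK : {rmorphism Km -> L}.
Hypothesis iKQ : forall a : Qp, iK a%:A = iQ a.

Local Notation int := (padic_integral iQ).
Local Notation OK x := (padic_integral iQ (iK x)).
Local Notation "a %:z" := (tofrac a : Qp) (at level 2, format "a %:z").
Implicit Types x y : Km.

Lemma padic_ext_integralE x : padic_ext_integral x <-> OK x.
Proof.
have eq_iK (f : {poly Zp}) : map_poly (fun a => iQ (tofrac a)) f =
    map_poly iK (map_poly (in_alg Km \o tofrac (R := Zp)) f).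
  by rewrite -map_poly_comp; apply: eq_map_poly => a /=; rewrite iKQ.
split=> -[f mon_f fx]; exists f => //.
  by rewrite eq_iK rmorph_root.
by move: fx; rewrite eq_iK fmorph_root.
Qed.

Lemma iK_Zp_scale (a : Zp) x : iK (a%:z *: x) = iQ a%:z * iK x.
Proof. by rewrite -mulr_algl rmorphM iKQ. Qed.

Lemma iK_pX n x : iK (p%:R ^+ n * x) = p%:R ^+ n * iK x.
Proof. by rewrite rmorphM rmorphXn rmorph_nat. Qed.

Lemma Zp_scale_pX j (c : Zp) x : (p%:R ^+ j * c)%:z *: x = p%:R ^+ j * (c%:z *: x).
Proof.
rewrite -!natrX tofracM rmorph_nat -scalerA scaler_nat; exact/esym/mulr_natl.
Qed.

Lemma Zp_scale_p (c : Zp) x : (p%:R * c)%:z *: x = p%:R * (c%:z *: x).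
Proof. exact: (Zp_scale_pX 1). Qed.

Lemma unramified_divp x : OK x -> red (iK x) = 0 -> exists2 y, OK y & x = p%:R * y.
Proof.
move=> intx redx; have [->|x0] := eqVneq x 0.
  by exists 0; rewrite ?mulr0 // rmorph0; apply: padic_integral_nat 0%N.
have [|intV|y /padic_ext_integralE inty xy] := unramKm (x := x).
- exact/padic_ext_integralE.
- have := red1 redP; move/padic_ext_integralE: intV => intV.
  rewrite -(rmorph1 iK) -(divff x0) rmorphM (redM redP) // redx mul0r.
  by move/eqP; rewrite eq_sym oner_eq0.
- by exists y.
Qed.

Lemma unramified_scale x : exists n, OK (p%:R ^+ n * x).
Proof.
by have [n] := padic_integral_scale closL (iK x); exists n; rewrite iK_pX.
Qed.

Lemma unramified_separated x :
  (forall n, exists2 y, OK y & x = p%:R ^+ n * y) -> x = 0.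
Proof.
move=> xdiv; apply/eqP; rewrite -(fmorph_eq0 iK); apply/eqP.
apply: (padic_separated closL redP char_k) => n.
by have [y inty ->] := xdiv n; exists (iK y); rewrite ?iK_pX.
Qed.

Lemma Km_p_neq0 : p%:R != 0 :> Km.
Proof. by rewrite -(fmorph_eq0 iK) rmorph_nat padic_closure_p_neq0. Qed.

Lemma integral_Zp_comb f (e : 'I_f -> Km) (a : 'I_f -> Zp) :
  (forall i, OK (e i)) -> OK (\sum_i (a i)%:z *: e i).
Proof.
move=> inte; rewrite rmorph_sum; apply: padic_integral_sum => i _.
rewrite iK_Zp_scale; apply: padic_integralM => //; exact: padic_integral_Zp.
Qed.

(** The reductions of the [e i] are linearly independent over the prime field,
    stated with coefficients in Z_p. *)
Definition residually_free f (e : 'I_f -> Km) :=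
  (forall i, OK (e i)) /\
  forall a : 'I_f -> Zp, red (iK (\sum_i (a i)%:z *: e i)) = 0 ->
    forall i, padic_res (a i) 1 = 0.

Lemma residually_free_Zp f (e : 'I_f -> Km) (a : 'I_f -> Zp) :
  residually_free e -> \sum_i (a i)%:z *: e i = 0 -> forall i, a i = 0.
Proof.
move=> [inte freee]; suff H n : forall b : 'I_f -> Zp,
    \sum_i (b i)%:z *: e i = 0 -> forall i, padic_res (b i) n = 0.
  by move=> a0 i; apply: padic_ext => n; rewrite padic_res0 H.
elim: n => [|n IH] b b0 i.
  by rewrite -padic_res_mod expn0 modz1.
have [|c cP] := choice (fun i => padic_divp (x := b i) _).
  by apply: freee; rewrite b0 rmorph0 (red0 redP).
have c0 : \sum_i (c i)%:z *: e i = 0.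
  apply: (mulfI Km_p_neq0); rewrite mulr0; apply: etrans b0; rewrite mulr_sumr.
  apply: eq_bigr => j _; by rewrite cP Zp_scale_p.
have [y yE] := padic_divpX (IH c c0 i).
by rewrite cP yE mulrA -exprS padic_res_pX.
Qed.

(** Residual freeness lifts to Q_p: the coefficients of a relation over Z_p are
    divisible by p, hence by every power of p. *)
Lemma residually_free_le f (e : 'I_f -> Km) : residually_free e -> (f <= m)%N.
Proof.
move=> freee; pose X := [tuple e i | i < f].
suff freeX : free X.
  have : \dim <<X>> = f by move/eqP: freeX; rewrite size_tuple.
  by move=> <-; rewrite -dimKm dimvS ?subvf.
apply/freeP => c c0 i.
have [N [a aP]] := padic_num_common_scale c.
have a0 : forall i, a i = 0.
  apply: (residually_free_Zp freee).
  apply: etrans (_ : (p%:R ^+ N : Qp) *: \sum_(i < f) c i *: X`_i = 0); last first.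
    by rewrite c0 scaler0.
  rewrite scaler_sumr; by apply: eq_bigr => j _; rewrite -tnth_nth tnth_mktuple -aP scalerA.
have := aP i; rewrite a0 tofrac0 => /eqP.
by rewrite mulf_eq0 expf_eq0 (negbTE (padic_num_p_neq0 p_pr)) andbF => /eqP.
Qed.

(** A residually free family of maximal length spans the residue field: in a
    relation involving one more element, the coefficient of that element must
    be a unit of Z_p. *)
Lemma max_residually_free : exists f (e : 'I_f -> Km), residually_free e /\
  forall x, OK x -> exists a : 'I_f -> Zp,
    red (iK (x - \sum_i (a i)%:z *: e i)) = 0.
Proof.
pose P f := `[< exists e : 'I_f -> Km, residually_free e >].
have P0 : exists f, P f.
  exists 0%N; apply/asboolP; exists (fun=> 0); split; by [case|move=> ? _; case].
have Pm f : P f -> (f <= m)%N by move=> /asboolP[e]; apply: residually_free_le.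
case: (ex_maxnP P0 Pm) => f /asboolP[e freee] maxf; exists f, e; split=> // x intx.
have inte := freee.1.
pose e' (i : 'I_f.+1) := oapp e x (unlift ord_max i).
have e'w i : e' (widen_ord (leqnSn f) i) = e i.
  by rewrite /e' (_ : widen_ord _ i = lift ord_max i) ?liftK //; apply/val_inj;
     rewrite /= /bump leqNgt ltn_ord.
have e'm : e' ord_max = x by rewrite /e' unlift_none.
have int' i : OK (e' i) by rewrite /e'; case: unliftP => [j _|_] /=.
have /existsNP[a na] : ~ forall a : 'I_f.+1 -> Zp,
    red (iK (\sum_i (a i)%:z *: e' i)) = 0 -> forall i, padic_res (a i) 1 = 0.
  move=> H; have /maxf : P f.+1 by apply/asboolP; exists e'.
  by rewrite ltnn.
have /not_implyP[a0 /existsNP[i ai]] := na.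
pose w i := a (widen_ord (leqnSn f) i); pose b := a ord_max.
have sumE : \sum_i (a i)%:z *: e' i = \sum_i (w i)%:z *: e i + b%:z *: x.
  by rewrite big_ord_recr e'm; congr (_ + _); apply: eq_bigr => j _; rewrite e'w.
have bU : b \is a GRing.unit.
  apply: padic_unit_res; apply/eqP => /padic_divp[c bE]; apply: ai.
  have w0 : forall j, padic_res (w j) 1 = 0.
    apply: freee.2; rewrite -a0 sumE rmorphD (redD redP); last 2 first.
    - exact: integral_Zp_comb.
    - rewrite iK_Zp_scale; apply: padic_integralM => //; exact: padic_integral_Zp.
    rewrite iK_Zp_scale bE tofracM rmorph_nat rmorphM rmorph_nat -mulrA.
    rewrite (red_p_mul redP) ?addr0 //.
    by apply: padic_integralM => //; apply: padic_integral_Zp.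
  case: (unliftP ord_max i) => [j|] ->; last first.
    by rewrite -/b bE -[p%:R]expr1 padic_res_pX.
  rewrite -(w0 j); congr (padic_res (a _) 1); apply/val_inj.
  by rewrite /= /bump leqNgt ltn_ord.
exists (fun i => - (b^-1 * w i)).
have -> : x - \sum_i (- (b^-1 * w i))%:z *: e i =
          (b^-1)%:z *: \sum_i (a i)%:z *: e' i.
  rewrite sumE scalerDr scalerA -tofracM mulVr // scale1r addrC; congr (_ + _).
  rewrite -sumrN scaler_sumr; apply: eq_bigr => j _.
  by rewrite tofracN scaleNr opprK tofracM scalerA.
rewrite iK_Zp_scale (redM redP) ?a0 ?mulr0 //; first exact: padic_integral_Zp.
exact: integral_Zp_comb.
Qed.

(** Subtracting from an integral element a lift of its residue leaves a
    multiple of p, so iterating writes it as a p-adic expansion whose digits are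
    combinations of the [e i].  The family is then a basis of Km, since every
    element becomes integral after multiplication by a power of p. *)
Lemma unramified_basis : exists e : 'I_m -> Km, residually_free e /\
  forall x, OK x -> exists a : 'I_m -> Zp, x = \sum_i (a i)%:z *: e i.
Proof.
have [f [e [freee gen]]] := max_residually_free; have inte := freee.1.
have step x : exists ay : ('I_f -> Zp) * Km, OK x ->
    OK ay.2 /\ x = \sum_i (ay.1 i)%:z *: e i + p%:R * ay.2.
  have [intx|nx] := pselect (OK x); last by exists (fun=> 0, 0).
  have [a ared] := gen x intx.
  have [|y inty xy] := unramified_divp _ ared.
    rewrite rmorphB; apply: padic_integralD => //; apply: padic_integralN.
    exact: integral_Zp_comb.
  by exists (a, y) => _; split=> //=; rewrite -xy addrC subrK.
have [next nextP] := choice step.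
have genZ x : OK x -> exists a : 'I_f -> Zp, x = \sum_i (a i)%:z *: e i.
  move=> intx; pose X n := iter n (fun y => (next y).2) x.
  have intX n : OK (X n) by elim: n => //= n IH; case: (nextP _ IH).
  pose b i n := (next (X n)).1 i.
  have partial n : x =
      \sum_i (\sum_(j < n) p%:R ^+ j * b i j : Zp)%:z *: e i + p%:R ^+ n * X n.
    elim: n => [|n IH].
      rewrite mul1r big1 ?add0r // => i _.
      by rewrite big_ord0 tofrac0 scale0r.
    rewrite {1}IH {1}(nextP _ (intX n)).2 mulrDr mulrA -exprSr addrA.
    congr (_ + _); rewrite mulr_sumr -big_split /=; apply: eq_bigr => i _.
    rewrite big_ord_recr tofracD scalerDl; congr (_ + _).
    by rewrite Zp_scale_pX.
  have [s sP] := choice (fun i => padic_series (b i)).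
  exists s; apply/eqP; rewrite -subr_eq0; apply/eqP.
  apply: unramified_separated => n.
  have [t tP] := choice (fun i => sP i n).
  exists (X n - \sum_i (t i)%:z *: e i).
    rewrite rmorphB; apply: padic_integralD => //; apply: padic_integralN.
    exact: integral_Zp_comb.
  rewrite {1}(partial n) mulrBr addrAC addrC; congr (_ + _).
  rewrite -opprB -sumrB mulr_sumr; congr (- _); apply: eq_bigr => i _.
  rewrite tP -scalerBl -tofracB addrC addKr.
  exact: Zp_scale_pX.
suff fm : f = m by rewrite -fm; exists e.
apply/eqP; rewrite eqn_leq (residually_free_le freee) /=.
pose X := [tuple e i | i < f].
rewrite -dimKm -[X in (_ <= X)%N](size_tuple X) (leq_trans _ (dim_span X)) //.
apply/dimvS/subvP => x _; have [n intn] := unramified_scale x.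
have [a aE] := genZ _ intn.
have -> : x = (p%:R ^+ n)^-1 *: (p%:R ^+ n * x).
  have -> : p%:R ^+ n * x = (p%:R ^+ n : Qp) *: x.
    by rewrite -!natrX mulr_natl scaler_nat.
  by rewrite scalerA mulVf ?scale1r // expf_neq0 // padic_num_p_neq0.
rewrite aE; apply/memvZ/memv_suml => i _; apply/memvZ/memv_span.
by rewrite -(tnth_mktuple e i) mem_tnth.
Qed.

(** On the coordinates in an integral basis this is the convergence of power
    series over Z_p. *)
Lemma unramified_complete (y : nat -> Km) : (forall n, OK (y n)) ->
  exists2 x, OK x & forall n, exists2 z, OK z &
    x = \sum_(j < n) p%:R ^+ j * y j + p%:R ^+ n * z.
Proof.
move=> inty; have [e [freee gen]] := unramified_basis; have inte := freee.1.
have [b bP] := choice (fun n => gen _ (inty n)).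
have [s sP] := choice (fun i => padic_series (b^~ i)).
exists (\sum_i (s i)%:z *: e i) => [|n]; first exact: integral_Zp_comb.
have [t tP] := choice (fun i => sP i n).
exists (\sum_i (t i)%:z *: e i); first exact: integral_Zp_comb.
under eq_bigr => i _ do rewrite tP tofracD scalerDl Zp_scale_pX.
rewrite big_split /= -mulr_sumr; congr (_ + _).
under eq_bigr => i _ do rewrite rmorph_sum scaler_suml.
rewrite exchange_big /=; apply: eq_bigr => j _; rewrite bP mulr_sumr.
by apply: eq_bigr => i _; rewrite Zp_scale_pX.
Qed.

End Unramified.

(** The polynomial ['X^#|E| - 'X] splits into the ['X - t] for t in E. *)
Lemma frobenius_fixed_image (E : finFieldType) (k : fieldType)
    (i : {rmorphism E -> k}) (x : k) : x ^+ #|E| = x -> exists t, i t = x.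
Proof.
move=> xq; have := congr1 (fun f => (map_poly i f).[x]) (finField_genPoly E).
rewrite rmorphB /= map_polyXn map_polyX !hornerE xq subrr.
rewrite rmorph_prod horner_prod => /esym/eqP/prodf_eq0[t _].
by rewrite rmorphB /= map_polyX map_polyC !hornerE subr_eq0 => /eqP ->; exists t.
Qed.

(** * Dickson polynomials *)

(** Dickson polynomials of the first kind with parameter 1, which give the power
    sums of two inverse elements in terms of their sum. *)
Fixpoint dickson n : {poly int} :=
  match n with
  | 0 => 2%:P
  | n'.+1 => match n' with
             | 0 => 'X
             | n''.+1 => 'X * dickson n' - dickson n''
             end
  end.

Definition int_horner (R : comNzRingType) (f : {poly int}) (x : R) :=
  (map_poly intr f).[x].

Section IntHorner.
Variable R : comNzRingType.
Implicit Types x y z w : R.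

Lemma int_hornerE f x :
  int_horner f x = \sum_(i < size f) (f`_i)%:~R * x ^+ i.
Proof.
rewrite /int_horner (@horner_coef_wide _ (size f)) ?size_poly //.
by apply: eq_bigr => i _; rewrite coef_map_id0.
Qed.

Lemma dickson_horner n z w :
  z * w = 1 -> int_horner (dickson n) (z + w) = z ^+ n + w ^+ n.
Proof.
move=> zw; rewrite /int_horner.
suff: (map_poly intr (dickson n)).[z + w] = z ^+ n + w ^+ n /\
      (map_poly intr (dickson n.+1)).[z + w] = z ^+ n.+1 + w ^+ n.+1 by case.
elim: n => [|n [IH0 IH1]].
  by split; rewrite /= ?map_polyC ?map_polyX !hornerE //= ?expr0 ?expr1.
split=> //; rewrite -[dickson n.+2]/('X * dickson n.+1 - dickson n).
rewrite rmorphB rmorphM /= map_polyX hornerD hornerN hornerM hornerX IH0.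
rewrite [X in _ * X]IH1 !exprS.
have -> : (z + w) * (z * z ^+ n + w * w ^+ n) - (z ^+ n + w ^+ n) =
  z * (z * z ^+ n) + w * (w * w ^+ n) + (z * w - 1) * (z ^+ n + w ^+ n) by ring.
by rewrite zw subrr mul0r addr0.
Qed.

End IntHorner.

Lemma int_horner_rmorph (R S : comNzRingType) (h : {rmorphism R -> S}) f x :
  h (int_horner f x) = int_horner f (h x).
Proof.
rewrite !int_hornerE rmorph_sum; apply: eq_bigr => i _.
by rewrite rmorphM rmorph_int rmorphXn.
Qed.

Lemma closed_sum_inverse (k : closedFieldType) (x : k) :
  exists2 z, z != 0 & x = z + z^-1.
Proof.
have [z] : exists z, root ('X^2 - x *: 'X + 1) z.
  apply/closed_rootP; rewrite -addrA size_polyDl size_polyXn //.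
  rewrite (leq_ltn_trans (size_polyD _ _)) // gtn_max size_poly1 andbT.
  by rewrite size_polyN (leq_ltn_trans (size_scale_leq _ _)) ?size_polyX.
rewrite rootE !hornerE => /eqP zx.
have z0 : z != 0.
  by apply: contra_eq_neq zx => ->; rewrite expr0n mulr0 subr0 add0r oner_eq0.
exists z => //; apply: (mulIf z0); rewrite mulrDl mulVf // -expr2.
by apply/esym/eqP; rewrite -subr_eq0 addrAC zx.
Qed.

(** Over a field of characteristic p both sides agree at every [z + z^-1]. *)
Lemma dickson_prime p (k : closedFieldType) : prime p -> p%:R = 0 :> k ->
  exists g : {poly int}, dickson p = 'X^p + p%:R *: g.
Proof.
move=> p_pr pk; have charp : p \in [pchar k] by rewrite inE p_pr pk eqxx.
have eqk : map_poly intr (dickson p) = 'X^p :> {poly k}.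
  apply/eqP; rewrite -subr_eq0; apply: contraT => /closed_nonrootP[x].
  rewrite rootE !hornerE => /negP[].
  have [z z0 ->] := closed_sum_inverse x.
  rewrite -[_.[_]]/(int_horner _ _) dickson_horner ?divff //.
  have := pFrobenius_autD_comm charp (mulrC z z^-1).
  by rewrite !pFrobenius_autE => ->; rewrite subrr.
exists (\poly_(i < size (dickson p - 'X^p)) ((dickson p - 'X^p)`_i %/ p%:Z)%Z).
apply/eqP; rewrite addrC -subr_eq; apply/eqP/polyP => i.
rewrite coefZ coef_poly; case: ltnP => [_|/(nth_default 0)->]; last by rewrite mulr0.
rewrite mulrC -natz; apply/esym/divzK; rewrite natz (dvdz_pcharf charp).
have := congr1 (fun f : {poly k} => f`_i) eqk.
rewrite coef_map /= => e; rewrite coefB rmorphB /= e !coefXn.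
by rewrite rmorph_nat subrr.
Qed.

Lemma dickson_prime_horner p (k : closedFieldType) : prime p -> p%:R = 0 :> k ->
  exists g : {poly int}, forall (R : comNzRingType) (x : R),
    int_horner (dickson p) x = x ^+ p + p%:R * int_horner g x.
Proof.
move=> p_pr pk; have [g gE] := dickson_prime p_pr pk; exists g => R x.
rewrite /int_horner gE rmorphD /= map_polyXn map_polyZ hornerD hornerXn hornerZ.
by rewrite rmorph_nat.
Qed.

(** * Sums of two inverse roots of unity in the unramified extension *)

Section UnramifiedResidues.
Variables (p : nat) (p_pr : prime p).
Local Notation Zp := (padic_int p_pr).
Local Notation Qp := (padic_num p_pr).
Variables (L : closedFieldType) (iQ : {rmorphism Qp -> L}).
Hypothesis closL : is_padic_closure iQ.
Variables (k : closedFieldType) (red : L -> k).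
Hypothesis redP : is_residue_map iQ red.
Hypothesis char_k : p%:R = 0 :> k.
Variables (m : nat) (m_gt0 : (0 < m)%N) (Km : fieldExtType Qp).
Hypotheses (dimKm : \dim {:Km} = m) (unramKm : unramified Km).
Variable iK : {rmorphism Km -> L}.
Hypothesis iKQ : forall a : Qp, iK a%:A = iQ a.
Variables (F : finFieldType) (iF : {rmorphism F -> k}).
Hypothesis cardF : #|F| = (p ^ m)%N.

Local Notation OK x := (padic_integral iQ (iK x)).
Local Notation "a %:z" := (tofrac a : Qp) (at level 2, format "a %:z").
Implicit Types x y : Km.

(** The residue field of Km has [p ^ m] elements, namely the residues of the
    combinations of an integral basis with digits as coefficients; the
    product of its nonzero elements is unchanged by multiplication by one of
    them, so all of them are roots of ['X^(p ^ m) - 'X]. *)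
Lemma unramified_residue (t : F) : exists2 x, OK x & red (iK x) = iF t.
Proof.
have [e [[inte freee] gen]] := unramified_basis closL redP char_k dimKm unramKm iKQ.
pose X (c : {ffun 'I_m -> 'I_p}) := \sum_i ((c i)%:R : Zp)%:z *: e i.
have intX c : OK (X c) by apply: integral_Zp_comb.
pose phi c := red (iK (X c)).
have phi_inj : injective phi.
  move=> c c' ecc; apply/ffunP => i; apply/val_inj => /=.
  have /freee/(_ i) : red (iK (\sum_i ((c i)%:R - (c' i)%:R : Zp)%:z *: e i)) = 0.
    have -> : \sum_i ((c i)%:R - (c' i)%:R : Zp)%:z *: e i = X c - X c'.
      by rewrite -sumrB; apply: eq_bigr => j _; rewrite tofracB scalerBl.
    rewrite rmorphB (redD redP) ?(redN redP) //; last exact: padic_integralN.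
    by rewrite -!/(phi _) ecc subrr.
  rewrite padic_resD padic_resN !padic_res_nat expn1 modzDm -modzDmr modzNm.
  rewrite modzDmr => /dvdz_mod0P; rewrite -eqz_mod_dvd !modz_nat eqz_nat.
  by rewrite !modn_small ?ltn_ord // => /eqP.
have phi_res x : OK x -> red (iK x) \in codom phi.
  move=> intx; have [a xE] := gen x intx.
  have ai i : exists c : 'I_p, exists b, a i = c%:R + p%:R * b.
    have ri : (`|padic_res (a i) 1| < p)%N.
      rewrite -(padic_res_mod (a i) 1) expn1 -ltz_nat gez0_abs.
        by rewrite ltz_pmod // ltz_nat prime_gt0.
      by rewrite modz_ge0 // eqz_nat -lt0n prime_gt0.
    exists (Ordinal ri) => /=; rewrite -[p%:R]expr1; apply: padic_res_sub.
    rewrite padic_res_nat gez0_abs ?padic_res_mod //.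
    by rewrite -(padic_res_mod (a i) 1) modz_ge0 // expn1 eqz_nat -lt0n prime_gt0.
  have [c /choice[b cb]] := choice ai.
  apply/codomP; exists (finfun c).
  have -> : x = X (finfun c) + p%:R * \sum_i (b i)%:z *: e i.
    rewrite xE mulr_sumr -big_split; apply: eq_bigr => i _ /=.
    by rewrite ffunE cb tofracD scalerDl Zp_scale_p.
  have intb : OK (\sum_i (b i)%:z *: e i) by apply: integral_Zp_comb.
  rewrite rmorphD rmorphM rmorph_nat (redD redP) //.
    by rewrite (red_p_mul redP) ?addr0.
  by apply: padic_integralM => //; apply: padic_integral_nat.
have phiM (y z : k) : y \in codom phi -> z \in codom phi -> y * z \in codom phi.
  move=> /codomP[c ->] /codomP[d ->].
  by rewrite -(redM redP) // -rmorphM phi_res // rmorphM; apply: padic_integralM.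
have phi_uniq : uniq (codom phi) by rewrite map_inj_uniq ?enum_uniq.
have phi_size : size (codom phi) = #|F|.
  by rewrite size_codom card_ffun !card_ord cardF.
have phi_fix (z : k) : z \in codom phi -> z ^+ #|F| = z.
  have [->|z0] := eqVneq z 0.
    by move=> _; rewrite expr0n gtn_eqF // cardF expn_gt0 prime_gt0.
  move=> zI; pose S : seq k := rem (0 : k) (codom phi).
  have phi0 : (0 : k) \in codom phi.
    by rewrite -(red0 redP) -(rmorph0 iK) phi_res // rmorph0; apply: padic_integral_nat 0%N.
  have S_uniq : uniq S by apply: rem_uniq.
  have memS (y : k) : y \in S = (y != 0) && (y \in codom phi) by rewrite mem_rem_uniq.
  have sizeS : (size S).+1 = #|F|.
    by rewrite size_rem // prednK // -has_predT; apply/hasP; exists 0.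
  have zS : perm_eq [seq z * v | v <- S] S.
    have uzS : uniq [seq z * v | v <- S] by rewrite map_inj_uniq //; apply: mulfI.
    apply: uniq_perm => //.
    have [| |_ //] := uniq_min_size uzS (s2 := S); last by rewrite size_map.
    move=> _ /mapP[v + ->]; rewrite !memS => /andP[v0 vI].
    by rewrite mulf_neq0 // phiM.
  have := perm_big _ zS (op := *%R) (x := 1) (P := xpredT) (F := id).
  rewrite big_map big_split /= big_const_seq count_predT iter_mulr_1.
  have S0 : \prod_(v <- S) v != 0.
    by rewrite prodf_seq_neq0; apply/allP => v; rewrite memS => /andP[].
  by move=> /eqP; rewrite -subr_eq0 -{2}[\prod_(_ <- _) _]mul1r -mulrBl mulf_eq0
    (negbTE S0) orbF subr_eq0 -sizeS exprS => /eqP ->; rewrite mulr1.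
have iF_uniq : uniq (codom iF) by rewrite map_inj_uniq ?enum_uniq //; apply: fmorph_inj.
have [||_ eqI] := uniq_min_size phi_uniq (s2 := codom iF).
- by move=> z /phi_fix/frobenius_fixed_image-/(_ iF)[s <-]; apply: codom_f.
- by rewrite size_codom phi_size.
have : iF t \in codom phi by rewrite eqI codom_f.
by case/codomP => c ->; exists (X c).
Qed.

Lemma OK_nat n : OK n%:R.
Proof. by rewrite rmorph_nat; apply: padic_integral_nat. Qed.

Lemma OKD x y : OK x -> OK y -> OK (x + y).
Proof. by rewrite rmorphD; apply: padic_integralD. Qed.

Lemma OKM x y : OK x -> OK y -> OK (x * y).
Proof. by rewrite rmorphM; apply: padic_integralM. Qed.

Lemma OKN x : OK x -> OK (- x).
Proof. by rewrite rmorphN; apply: padic_integralN. Qed.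

Lemma OKX x n : OK x -> OK (x ^+ n).
Proof. by rewrite rmorphXn; apply: padic_integralX. Qed.

Lemma OK_int (a : int) : OK a%:~R.
Proof. by case: a => n; [exact: OK_nat | exact/OKN/OK_nat]. Qed.

Lemma OK_sum (I : Type) (r : seq I) (P : pred I) (f : I -> Km) :
  (forall i, P i -> OK (f i)) -> OK (\sum_(i <- r | P i) f i).
Proof. by move=> intf; elim/big_ind: _ => //; [exact: (OK_nat 0) | exact: OKD]. Qed.

Lemma OK_int_horner f x : OK x -> OK (int_horner f x).
Proof.
move=> intx; rewrite int_hornerE; apply: OK_sum => i _.
by apply: OKM; [apply: OK_int | apply: OKX].
Qed.

(** Congruence modulo p ^ n in the ring of integers; stated without subtraction,
    so that it can be used to rewrite [x]. *)
Definition cong_OK n x y := exists2 z, OK z & x = y + p%:R ^+ n * z.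

Lemma cong_OK_sub n x y : cong_OK n x y <-> exists2 z, OK z & x - y = p%:R ^+ n * z.
Proof.
split=> -[z intz e]; exists z => //; first by rewrite e addrC addKr.
by rewrite -e addrC subrK.
Qed.

Lemma cong_OK_mull n x y z : OK z -> cong_OK n x y -> cong_OK n (z * x) (z * y).
Proof.
by move=> intz [w intw ->]; exists (z * w); rewrite ?mulrDr 1?mulrCA //; apply: OKM.
Qed.

Lemma cong_OKD n x y x' y' :
  cong_OK n x y -> cong_OK n x' y' -> cong_OK n (x + x') (y + y').
Proof.
by move=> [z intz ->] [w intw ->]; exists (z + w); [apply: OKD | rewrite mulrDr addrACA].
Qed.

Lemma cong_OK_refl n x : cong_OK n x x.
Proof. by exists 0; rewrite ?mulr0 ?addr0 //; apply: (OK_nat 0). Qed.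

Lemma cong_OK_sym n x y : cong_OK n x y -> cong_OK n y x.
Proof. by move=> [z intz ->]; exists (- z); [apply: OKN | rewrite mulrN addrK]. Qed.

Lemma cong_OK_trans n y x z : cong_OK n x y -> cong_OK n y z -> cong_OK n x z.
Proof.
by move=> [v intv ->] [w intw ->]; exists (w + v); [apply: OKD | rewrite mulrDr addrA].
Qed.

Lemma cong_OK_le n l x y : (n <= l)%N -> cong_OK l x y -> cong_OK n x y.
Proof.
move=> /subnKC <- [z intz ->]; exists (p%:R ^+ (l - n) * z).
  by apply: OKM => //; apply/OKX/OK_nat.
by rewrite mulrA -exprD.
Qed.

Lemma cong_OKX n x y i :
  OK x -> OK y -> cong_OK n x y -> cong_OK n (x ^+ i) (y ^+ i).
Proof.
move=> intx inty cxy; elim: i => [|i IH]; first exact: cong_OK_refl.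
rewrite !exprS; apply: cong_OK_trans (cong_OK_mull intx IH) _.
by rewrite ![_ * y ^+ i]mulrC; apply: cong_OK_mull => //; apply: OKX.
Qed.

Lemma cong_OK_int_horner n f x y :
  OK x -> OK y -> cong_OK n x y -> cong_OK n (int_horner f x) (int_horner f y).
Proof.
move=> intx inty cxy; rewrite !int_hornerE.
elim/big_ind2: _ => [||i _]; [exact: cong_OK_refl | by move=> *; apply: cong_OKD |].
by apply: cong_OK_mull; [apply: OK_int | apply: cong_OKX].
Qed.

(** The p-th power gains a factor p on differences, because
    [x ^ p - y ^ p = (x - y) * \sum_i x ^ (p - 1 - i) * y ^ i] and the sum is
    congruent to [p * y ^ (p - 1)] modulo [x - y]. *)
Lemma cong_OK_pX n x y :
  OK x -> OK y -> cong_OK n.+1 x y -> cong_OK n.+2 (x ^+ p) (y ^+ p).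
Proof.
move=> intx inty cxy; apply/cong_OK_sub; rewrite subrXX.
have [z intz ->] := (cong_OK_sub _ _ _).1 cxy.
have [w intw ->] : exists2 w, OK w &
    \sum_(i < p) x ^+ (p.-1 - i) * y ^+ i = p%:R * w.
  have [w intw e] : cong_OK 1 (\sum_(i < p) x ^+ (p.-1 - i) * y ^+ i)
                          (\sum_(i < p) y ^+ p.-1).
    elim/big_ind2: _ => [||i _]; [exact: cong_OK_refl | by move=> *; apply: cong_OKD |].
    have -> : y ^+ p.-1 = y ^+ i * y ^+ (p.-1 - i).
      by rewrite -exprD subnKC // -ltnS prednK ?prime_gt0.
    rewrite mulrC; apply: cong_OK_mull; first exact: OKX.
    by apply: cong_OKX => //; apply: cong_OK_le cxy.
  exists (y ^+ p.-1 + w); first by apply: OKD => //; apply: OKX.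
  by rewrite e sumr_const card_ord mulrDr expr1 !mulr_natl.
exists (z * w); first exact: OKM.
by rewrite mulrACA -exprSr.
Qed.

Definition dickson_p x : Km := int_horner (dickson p) x.

Lemma OK_dickson_p x : OK x -> OK (dickson_p x).
Proof. exact: OK_int_horner. Qed.

(** The polynomial is ['X^p + p * g], and both terms gain a factor p on
    differences. *)
Lemma dickson_p_contract n x y :
  OK x -> OK y -> cong_OK n.+1 x y -> cong_OK n.+2 (dickson_p x) (dickson_p y).
Proof.
have [g gE] := dickson_prime_horner p_pr char_k.
move=> intx inty cxy; rewrite /dickson_p !gE; apply: cong_OKD; first exact: cong_OK_pX.
have [z intz ->] := cong_OK_int_horner g intx inty cxy.
by exists z; rewrite // mulrDr mulrA -exprS.
Qed.

Lemma red_dickson_p x : OK x -> red (iK (dickson_p x)) = red (iK x) ^+ p.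
Proof.
have [g gE] := dickson_prime_horner p_pr char_k => intx.
rewrite /dickson_p gE rmorphD rmorphM rmorph_nat rmorphXn.
have intg : OK (int_horner g x) by apply: OK_int_horner.
rewrite (redD redP) ?(red_p_mul redP) ?addr0 ?(redX redP) //.
  exact: padic_integralX.
by apply: padic_integralM => //; apply: padic_integral_nat.
Qed.

Lemma red_eq_cong x y : OK x -> OK y -> red (iK x) = red (iK y) -> cong_OK 1 x y.
Proof.
move=> intx inty exy; have intxy : OK (x - y) by apply: OKD => //; apply: OKN.
apply/cong_OK_sub; apply: (unramified_divp redP unramKm iKQ intxy).
rewrite rmorphB (redD redP) ?(redN redP) ?exy ?subrr //; exact: padic_integralN.
Qed.

(** [iter m dickson_p] is a contraction which preserves every residue class. *)
Lemma dickson_fixpoint (t : F) : exists x,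
  [/\ OK x, red (iK x) = iF t & iter m dickson_p x = x].
Proof.
pose E := iter m dickson_p.
have intE x : OK x -> OK (E x).
  by move=> intx; rewrite /E; elim: m => //= ? ?; apply: OK_dickson_p.
have cE n x y : OK x -> OK y -> cong_OK n.+1 x y -> cong_OK n.+2 (E x) (E y).
  move=> intx inty cxy; rewrite /E; case: (m) m_gt0 => // m' _.
  suff [? [? ?]] : OK (iter m' dickson_p x) /\ OK (iter m' dickson_p y) /\
      cong_OK n.+1 (iter m' dickson_p x) (iter m' dickson_p y).
    by rewrite !iterS; apply: dickson_p_contract.
  elim: m' => //= m' [? [? ?]]; split; first exact: OK_dickson_p.
  by split; [exact: OK_dickson_p | apply/(@cong_OK_le _ n.+2)/dickson_p_contract].
have [x0 intx0 redx0] := unramified_residue t.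
pose X n := iter n E x0; have intX n : OK (X n) by elim: n => //= ? ?; apply: intE.
have redE x : OK x -> red (iK (E x)) = red (iK x) ^+ (p ^ m).
  move=> intx; rewrite /E; elim: (m) => [|l IH]; first by rewrite expn0 expr1.
  rewrite iterS red_dickson_p ?IH -?exprM -?expnSr //.
  by elim: l {IH} => //= l IH; apply: OK_dickson_p.
have cX n : cong_OK n.+1 (X n.+1) (X n).
  elim: n => [|n IH]; last exact: (cE n (X n.+1) (X n)).
  apply: red_eq_cong => //=; first exact: intE.
  by rewrite redE // redx0 -rmorphXn -cardF expf_card.
have /choice[Y YP] n : exists y, OK y /\ X n.+1 - X n = p%:R ^+ n * (p%:R * y).
  have [y inty e] := (cong_OK_sub _ _ _).1 (cX n).
  by exists y; rewrite e mulrA -exprSr.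
have intY n : OK (p%:R * Y n) by apply: OKM; [apply: OK_nat | case: (YP n)].
have [s ints sP] := unramified_complete closL redP char_k dimKm unramKm iKQ intY.
pose x := x0 + s; have intx : OK x by apply: OKD.
have xX n : cong_OK n x (X n).
  have [z intz sE] := sP n; exists z => //; rewrite /x sE addrA; congr (_ + _).
  rewrite (eq_bigr (fun j : 'I_n => X j.+1 - X j)) => [|j _]; last by case: (YP j).
  rewrite -(big_mkord xpredT (fun j => X j.+1 - X j)) telescope_sumr //.
  by rewrite addrC subrK.
exists x; split=> //.
  have [z intz ->] := cong_OK_trans (xX 1%N) (cX 0%N).
  rewrite expr1 rmorphD (redD redP) //; last by apply: OKM => //; apply: OK_nat.
  by rewrite rmorphM rmorph_nat (red_p_mul redP) ?addr0.
apply/eqP; rewrite -subr_eq0; apply/eqP.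
apply: (unramified_separated closL redP char_k (iK := iK)) => n.
apply/cong_OK_sub; apply: (@cong_OK_le _ n.+1) => //.
apply: (@cong_OK_trans _ (X n.+2)); last first.
  apply: cong_OK_trans (cong_OK_le (leqnSn _) (cX n.+1)) _.
  exact/cong_OK_sym/xX.
exact: cong_OK_le (leqnSn _) (cE n x (X n.+1) intx (intX _) (xX n.+1)).
Qed.

Lemma iter_dickson_p_horner (K : fieldType) n (z : K) : z != 0 ->
  iter n (int_horner (dickson p)) (z + z^-1) = z ^+ (p ^ n) + z ^- (p ^ n).
Proof.
move=> z0; elim: n => [|n IH]; first by rewrite expn0 !expr1.
rewrite iterS IH dickson_horner ?divff ?expf_neq0 // exprVn.
by rewrite -!exprM -!expnSr.
Qed.

(** An element of the unramified ring fixed by the Dickson polynomial of index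
    [q = p ^ m] is a sum [z + z^-1] with [z ^ (q - 1) = 1] or [z ^ (q + 1) = 1],
    and the reduction determines [z] up to inversion. *)
Lemma unity_trace_unramified (z : L) (t : F) :
  z ^+ ((p ^ m) ^ 2 - 1) = 1 -> red z + red z^-1 = iF t ->
  exists2 x, OK x & iK x = z + z^-1.
Proof.
set q := (p ^ m)%N => zN zt.
have q_gt1 : (1 < q)%N.
  by rewrite /q -{1}(expn0 p) ltn_exp2l ?prime_gt1.
have N0 : (0 < q ^ 2 - 1)%N by rewrite subn_gt0 -{1}(expn0 q) ltn_exp2l.
have Np : coprime (q ^ 2 - 1) p.
  rewrite subn1 coprime_sym.
  have : coprime (q ^ 2) (q ^ 2).-1 by rewrite coprimenP // expn_gt0 ltnW.
  by rewrite /q -expnM coprime_pexpl // muln_gt0 m_gt0.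
have unity_neq0 (v : L) : v ^+ (q ^ 2 - 1) = 1 -> v != 0.
  move=> vN; apply/eqP => v0; move/eqP: vN.
  by rewrite v0 expr0n gtn_eqF // eq_sym oner_eq0.
have z0 := unity_neq0 z zN.
have intU (v : L) : v ^+ (q ^ 2 - 1) = 1 -> padic_integral iQ v.
  exact: padic_integral_unity.
have [x [intx redx fixx]] := dickson_fixpoint t.
have [v v0 xv] := closed_sum_inverse (iK x).
have fixv : v ^+ q + v ^- q = v + v^-1.
  rewrite -iter_dickson_p_horner // -xv -[in RHS]fixx.
  elim: (m) => //= l IH; rewrite IH /dickson_p int_horner_rmorph //.
have vN : v ^+ (q ^ 2 - 1) = 1.
  have q0 : v ^+ q != 0 by rewrite expf_neq0.
  have : (v ^+ q - v) * (v ^+ q * v - 1) = 0.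
    have -> : (v ^+ q - v) * (v ^+ q * v - 1) =
      v ^+ q * v * ((v ^+ q + v ^- q) - (v + v^-1)) by field; rewrite v0 q0.
    by rewrite fixv subrr mulr0.
  have -> : (q ^ 2 - 1 = (q - 1) * (q + 1))%N by rewrite -subn_sqr exp1n.
  move/eqP; rewrite mulf_eq0 !subr_eq0 => /orP[] /eqP e.
    rewrite exprM (_ : v ^+ (q - 1) = 1) ?expr1n //.
    by apply: (mulIf v0); rewrite mul1r -exprSr subn1 prednK // ltnW.
  by rewrite mulnC exprM addn1 exprSr e expr1n.
have redV (w : L) : w ^+ (q ^ 2 - 1) = 1 -> red w * red w^-1 = 1.
  move=> wN; rewrite -(redM redP) ?divff ?(red1 redP) ?unity_neq0 //; apply: intU => //.
  by rewrite exprVn wN invr1.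
have vVN : v^-1 ^+ (q ^ 2 - 1) = 1 by rewrite exprVn vN invr1.
have tv : red v + red v^-1 = iF t.
  by rewrite -redx xv (redD redP) //; apply: intU.
have : (red z - red v) * (red z - red v^-1) = 0.
  have -> : (red z - red v) * (red z - red v^-1) =
    red z * ((red z + red z^-1) - (red v + red v^-1)) +
    (red v * red v^-1 - red z * red z^-1) by ring.
  by rewrite zt tv !redV // !subrr mulr0 addr0.
move/eqP; rewrite mulf_eq0 !subr_eq0 => /orP[] /eqP e.
  by exists x => //; rewrite xv (red_unity_inj redP char_k N0 Np zN vN e).
exists x => //; rewrite xv (red_unity_inj redP char_k N0 Np zN vVN e).
by rewrite invrK addrC.
Qed.

End UnramifiedResidues.

(** * Symmetric powers of 2 x 2 matrices *)

Section Mat2.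
Variable R : comNzRingType.
Implicit Types a b c d : R.

Lemma ord2_max : (ord_max : 'I_2) = 1. Proof. exact/val_inj. Qed.

Lemma mat2E a b c d :
  ((mat2 a b c d 0 0 = a) * (mat2 a b c d 0 1 = b) *
   (mat2 a b c d 1 0 = c) * (mat2 a b c d 1 1 = d))%type.
Proof. by rewrite !mxE. Qed.

Lemma mat2_eta (A : 'M[R]_2) : A = mat2 (A 0 0) (A 0 1) (A 1 0) (A 1 1).
Proof.
apply/matrixP => i j; rewrite mxE.
by case: i j => [[|[|//]] ?] [[|[|//]] ?] /=; congr (A _ _); apply/val_inj.
Qed.

Lemma mul_mat2 a b c d a' b' c' d' :
  mat2 a b c d *m mat2 a' b' c' d' =
  mat2 (a * a' + b * c') (a * b' + b * d') (c * a' + d * c') (c * b' + d * d').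
Proof.
rewrite [LHS]mat2_eta; congr mat2; rewrite !mxE !big_ord_recl big_ord0 addr0;
  by rewrite !mxE.
Qed.

Lemma det_mat2 a b c d : \det (mat2 a b c d) = a * d - b * c.
Proof.
rewrite (expand_det_row _ 0) !big_ord_recl big_ord0 addr0 /cofactor !det_mx11.
by rewrite !mxE /= expr0 expr1 mul1r mulN1r mulrN.
Qed.

Lemma mat2_1 : mat2 1 0 0 1 = 1%:M :> 'M[R]_2.
Proof. by rewrite [RHS]mat2_eta !mxE. Qed.

Lemma scale_mat2 x a b c d : x *: mat2 a b c d = mat2 (x * a) (x * b) (x * c) (x * d).
Proof. by rewrite [LHS]mat2_eta !mxE. Qed.

End Mat2.

Lemma map_mat2 (R S : comNzRingType) (f : R -> S) a b c d :
  map_mx f (mat2 a b c d) = mat2 (f a) (f b) (f c) (f d).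
Proof. by rewrite [LHS]mat2_eta !mxE. Qed.

Section Homogenization.
Variables (R S : comNzRingType) (h : {rmorphism R -> S}).
Implicit Types (f g : {poly R}) (x y : S).

(** The value at (x, y) of the form of degree [n] which dehomogenizes to [f]. *)
Definition homogenize n f x y := \sum_(l < n.+1) h f`_l * x ^+ l * y ^+ (n - l).

Lemma homogenizeD n f g x y :
  homogenize n (f + g) x y = homogenize n f x y + homogenize n g x y.
Proof.
rewrite -big_split; apply: eq_bigr => l _ /=.
by rewrite coefD rmorphD !mulrDl.
Qed.

Lemma homogenizeZ n c f x y : homogenize n (c *: f) x y = h c * homogenize n f x y.
Proof. by rewrite mulr_sumr; apply: eq_bigr => l _; rewrite coefZ rmorphM !mulrA. Qed.

Lemma homogenize_lin n a b f x y : (size f <= n.+1)%N ->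
  homogenize n.+1 ((a *: 'X + b%:P) * f) x y = (h a * x + h b * y) * homogenize n f x y.
Proof.
move=> szf; rewrite mulrDl mul_polyC -scalerAl homogenizeD !homogenizeZ mulrDl -!mulrA.
congr (h a * _ + h b * _).
  rewrite /homogenize big_ord_recl coefXM eqxx rmorph0 !mul0r add0r mulr_sumr.
  apply: eq_bigr => l _; rewrite coefXM /= exprS subSS; ring.
rewrite /homogenize big_ord_recr /= nth_default // rmorph0 !mul0r addr0 mulr_sumr.
apply: eq_bigr => l _; rewrite subSn ?exprS; first by ring.
by rewrite -ltnS.
Qed.

Lemma size_lin_exp a b c d i j :
  (size (((a *: 'X + b%:P) ^+ i * (c *: 'X + d%:P) ^+ j)%R : {poly R}) <= (i + j).+1)%N.
Proof.
have lin a' b' l : (size ((a' *: 'X + b'%:P) ^+ l : {poly R})%R <= l.+1)%N.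
  apply: leq_trans (size_poly_exp_leq _ _) _; rewrite ltnS.
  rewrite -[X in (_ <= X)%N]mul1n leq_mul2r -ltnS -[(_.-1).+1]/(_.-1.+1).
  have : (size (a' *: 'X + b'%:P : {poly R})%R <= 2)%N.
    rewrite (leq_trans (size_polyD _ _)) // geq_max.
    rewrite (leq_trans (size_scale_leq _ _)) ?size_polyX //.
    by rewrite (leq_trans (size_polyC_leq1 _)).
  by case: size => [|[|[|]]] // _; rewrite orbT.
apply: leq_trans (size_polyMleq _ _) _.
have := leq_add (lin a b i) (lin c d j).
by rewrite addSn addnS; case: (_ + _)%N.
Qed.

Lemma homogenize_lin_exp a b c d i j x y :
  homogenize (i + j) ((a *: 'X + b%:P) ^+ i * (c *: 'X + d%:P) ^+ j) x y =
  (h a * x + h b * y) ^+ i * (h c * x + h d * y) ^+ j.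
Proof.
elim: i => [|i IH]; last first.
  by rewrite addSn !exprS -!mulrA homogenize_lin ?IH ?size_lin_exp.
rewrite add0n !mul1r; elim: j => [|j IH].
  by rewrite /homogenize big_ord1 expr0 coef1 rmorph1 !mulr1.
rewrite !exprS homogenize_lin ?IH //.
by have := size_lin_exp 1 0 c d 0 j; rewrite mul1r.
Qed.

End Homogenization.

Section SymmetricPower.
Variable R : comNzRingType.
Implicit Types A B : 'M[R]_2.

(** The n-th symmetric power of the standard representation, in the basis of
    the monomials [x ^ i * y ^ (n - i)]. *)
Definition symx n A : 'M[R]_n.+1 := \matrix_(i, j)
  ((A 0 0 *: 'X + (A 0 1)%:P) ^+ i * (A 1 0 *: 'X + (A 1 1)%:P) ^+ (n - i))`_j.

Lemma symx_rowE n A (S : comNzRingType) (h : {rmorphism R -> S}) (x y : S) i :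
  \sum_j h (symx n A i j) * x ^+ j * y ^+ (n - j) =
  (h (A 0 0) * x + h (A 0 1) * y) ^+ i * (h (A 1 0) * x + h (A 1 1) * y) ^+ (n - i).
Proof.
have ni : (i + (n - i) = n)%N by rewrite subnKC // -ltnS.
rewrite -homogenize_lin_exp ni; apply: eq_bigr => j _; by rewrite mxE.
Qed.

(** Each row of [symx n A] is the list of coefficients of a product of linear
    forms, and [symx_rowE] substitutes linear forms for the variables.  *)
Lemma symxM n A B : symx n (A *m B) = symx n A *m symx n B.
Proof.
have poly_eq (v w : 'I_n.+1 -> R) : (forall j, v j = w j) <->
    \sum_j (v j)%:P * 'X ^+ j * 1 ^+ (n - j) = \sum_j (w j)%:P * 'X ^+ j * 1 ^+ (n - j).
  split=> [e|e j]; first by apply: eq_bigr => j _; rewrite e.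
  have co (z : 'I_n.+1 -> R) : (\sum_j (z j)%:P * 'X ^+ j * 1 ^+ (n - j))`_j = z j.
    rewrite coef_sum (bigD1 j) //= expr1n mulr1 coefCM coefXn eqxx mulr1.
    rewrite big1 ?addr0 // => l lj.
    by rewrite expr1n mulr1 coefCM coefXn eq_sym (inj_eq val_inj) (negbTE lj) mulr0.
  by rewrite -[LHS]co e co.
pose polyCm : {rmorphism R -> {poly R}} := polyC.
apply/matrixP => i; apply/poly_eq => /=.
rewrite (symx_rowE _ polyCm).
have -> : \sum_j ((symx n A *m symx n B) i j)%:P * 'X ^+ j * 1 ^+ (n - j) =
    \sum_l (symx n A i l)%:P *
      \sum_j (symx n B l j)%:P * 'X ^+ j * 1 ^+ (n - j) :> {poly R}.
  under eq_bigr => j _ do rewrite mxE rmorph_sum !mulr_suml.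
  rewrite exchange_big /=; apply: eq_bigr => l _; rewrite mulr_sumr.
  by apply: eq_bigr => j _; rewrite rmorphM /= !mulrA.
under eq_bigr => l _ do rewrite (symx_rowE _ polyCm) mulrA.
rewrite (symx_rowE _ polyCm) !mulr1 !mxE !big_ord_recl !big_ord0 !addr0.
rewrite !rmorphD !rmorphM /=.
rewrite (_ : lift ord0 ord0 = 1 :> 'I_2); last exact/val_inj.
by congr (_ ^+ _ * _ ^+ _); ring.
Qed.

Lemma symxZ n c A : symx n (c *: A) = c ^+ n *: symx n A.
Proof.
apply/matrixP => i j; rewrite !mxE !polyCM -!mul_polyC !polyCM -!mulrA -!mulrDr.
rewrite !exprMn mulrACA -exprD subnKC ?(leq_ord i) //.
by rewrite -polyC_exp coefCM.
Qed.

Lemma coef_lin_exp (a b : R) n j :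
  ((a *: 'X + b%:P) ^+ n)`_j = a ^+ j * b ^+ (n - j) *+ 'C(n, j).
Proof.
elim: n j => [|n IH] j.
  by rewrite expr0 coef1 bin0n; case: j => [|j]; rewrite ?mulr1 ?mulr0n ?expr0.
rewrite exprS mulrDl -scalerAl coefD coefZ coefXM coefCM !IH.
case: j => [|j] /=.
  by rewrite mulr0 add0r !bin0 !mulr1n !expr0 !mul1r !subn0 exprS.
rewrite binS mulrnDr addrC; congr (_ + _); last first.
  by rewrite subSS exprS -mulrA mulrnAr.
case: (ltnP j n) => [jn|nj]; last by rewrite bin_small // !mulr0n mulr0.
by rewrite subSS -(subnSK jn) [b ^+ (n - j.+1).+1]exprS mulrnAr mulrCA.
Qed.

(** The complete homogeneous symmetric polynomial of degree n in two variables,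
    which is the trace of a symmetric power in terms of the eigenvalues. *)
Definition complete_sum n (a b : R) := \sum_(i < n.+1) a ^+ i * b ^+ (n - i).

Lemma symx_trace_upper n A :
  A 1 0 = 0 -> \tr (symx n A) = complete_sum n (A 0 0) (A 1 1).
Proof.
move=> A10; apply: eq_bigr => i _; rewrite mxE A10 scale0r add0r -polyC_exp coefMC.
by rewrite coef_lin_exp subnn binn mulr1.
Qed.

Lemma symx_diag n (a d : R) i j :
  symx n (mat2 a 0 0 d) i j = (a ^+ i * d ^+ (n - i)) *+ (i == j).
Proof.
rewrite mxE !mat2E addr0 scale0r add0r -polyC_exp coefMC exprZn coefZ coefXn.
by rewrite eq_sym -val_eqE; case: (_ == _); rewrite ?mulr1 // !mulr0 mul0r.
Qed.

(** The middle coefficient of [(a * x + b * y) ^ r * (c * x + d * y) ^ r] is a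
    convolution of two rows of binomial coefficients; the symmetry of the second
    row turns their products into squares. *)
Lemma symx_center r (a b c d : R) :
  symx (r.*2) (mat2 a b c d) (inord r) (inord r) =
  \sum_(i < r.+1) (a * d) ^+ i * (b * c) ^+ (r - i) *+ ('C(r, i) ^ 2).
Proof.
rewrite mxE !mat2E inordK -?addnn ?ltnS ?leq_addl // addnK coefM.
apply: eq_bigr => i _; rewrite !coef_lin_exp bin_sub ?(leq_ord i) //.
rewrite subKn ?(leq_ord i) // mulrnAr mulrnAl -mulrnA -mulnn !exprMn.
by congr (_ *+ _); ring.
Qed.

End SymmetricPower.

(** * Legendre polynomials modulo p *)

(** In the variables [x + 1] and [x - 1] this form of degree r is the Legendre
    polynomial multiplied by [2 ^ r]. *)
Definition square_binomial_form (R : comNzRingType) r (a b : R) :=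
  \sum_(i < r.+1) a ^+ i * b ^+ (r - i) *+ ('C(r, i) ^ 2).

Section SquareBinomials.

(** The contiguity relation of squared binomial coefficients behind the
    recurrence of the Legendre polynomials. *)
Lemma bin_square_rec (r j : nat) (x := 'C(r, j)%:R : rat) (y := 'C(r, j.+1)%:R : rat)
    (z := 'C(r, j.+2)%:R : rat) :
  (r.+2)%:R * ('C(r.+2, j.+2)%:R ^+ 2) =
  (r.*2.+3)%:R * ('C(r.+1, j.+1)%:R ^+ 2 + 'C(r.+1, j.+2)%:R ^+ 2)
  - (r.+1)%:R * (x ^+ 2 - y ^+ 2 *+ 2 + z ^+ 2).
Proof.
have binR n l : (l.+1)%:R * 'C(n, l.+1)%:R = (n%:R - l%:R) * 'C(n, l)%:R :> rat.
  case: (leqP l n) => [ln|nl]; last by rewrite !bin_small ?mulr0 // ltnW.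
  by rewrite -natrB // -!natrM mul_bin_left.
have xy : (j.+1)%:R * y = (r%:R - j%:R) * x := binR r j.
have yz : (j.+2)%:R * z = (r%:R - j.+1%:R) * y := binR r j.+1.
have e1 : 'C(r.+1, j.+1)%:R = y + x by rewrite binS natrD.
have e2 : 'C(r.+1, j.+2)%:R = z + y by rewrite binS natrD.
have e3 : 'C(r.+2, j.+2)%:R = z + y + (y + x) by rewrite binS natrD e1 e2.
rewrite e1 e2 e3; move: x y z xy yz {e1 e2 e3 binR} => x y z.
rewrite -!natr1 -muln2 natrM -?natr1 mulr0n !add0r.
move: (r%:R : rat) (j%:R : rat) (ler0n rat j) => {}r {}j j0 xy yz.
have j1 : j + 1 != 0 by rewrite gt_eqF // ltr_wpDl.
have j2 : j + 1 + 1 != 0 by rewrite gt_eqF // ltr_wpDl // addr_ge0.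
have yE : y = (r - j) * x / (j + 1) by rewrite -xy mulrC mulKf.
have zE : z = (r - (j + 1)) * y / (j + 1 + 1) by rewrite -yz mulrC mulKf.
by rewrite zE yE; field; rewrite j1 j2.
Qed.

Definition square_binomial_poly r : {poly rat} := \poly_(i < r.+1) ('C(r, i)%:R ^+ 2).

Lemma coef_square_binomial r i : (square_binomial_poly r)`_i = 'C(r, i)%:R ^+ 2.
Proof.
by rewrite coef_poly; case: ltnP => // ri; rewrite bin_small // expr0n.
Qed.

Lemma square_binomial_poly_rec r :
  (r.+2)%:R *: square_binomial_poly r.+2 =
  (r.*2.+3)%:R *: ((1 *: 'X + 1%:P) * square_binomial_poly r.+1)
  + - (r.+1)%:R *: ((1 *: 'X + (-1)%:P) * ((1 *: 'X + (-1)%:P) * square_binomial_poly r)).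
Proof.
have cX0 (f : {poly rat}) : ('X * f)`_0 = 0 by rewrite coefXM.
have cXS (f : {poly rat}) l : ('X * f)`_l.+1 = f`_l by rewrite coefXM.
have lin (c : rat) (f : {poly rat}) : (1 *: 'X + c%:P) * f = 'X * f + c *: f.
  by rewrite scale1r mulrDl mul_polyC.
rewrite !lin; apply/polyP.
by case=> [|[|i]]; rewrite !(coefD, coefZ, cX0, cXS) !coef_square_binomial;
   rewrite ?bin_square_rec ?bin0 ?bin1 -?natr1 -?muln2 ?natrM; ring.
Qed.

Lemma square_binomial_form_homogenize r (a b : {poly rat}) :
  square_binomial_form r a b =
  homogenize (polyC : {rmorphism rat -> {poly rat}}) r (square_binomial_poly r) a b.
Proof.
apply: eq_bigr => i _; rewrite coef_square_binomial -natrX /= rmorph_nat.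
by rewrite -mulrA mulr_natl.
Qed.

(** With [a + b = 2 * x] and [(a - b) ^ 2 = 4] this is the recurrence of the
    Legendre polynomials, up to the powers of 2. *)
Lemma square_binomial_form_rec r (a b : {poly rat}) :
  (r.+2)%:R *: square_binomial_form r.+2 a b =
  (r.*2.+3)%:R *: ((a + b) * square_binomial_form r.+1 a b)
  - (r.+1)%:R *: ((a - b) ^+ 2 * square_binomial_form r a b).
Proof.
rewrite !square_binomial_form_homogenize -!mul_polyC.
rewrite -[X in X * _ = _]/((polyC : {rmorphism rat -> {poly rat}}) _).
rewrite -homogenizeZ square_binomial_poly_rec homogenizeD !homogenizeZ.
rewrite !homogenize_lin ?size_poly //=; last first.
  have := size_lin_exp (1 : rat) (-1) 0 1 1 0; rewrite expr1 expr0 mulr1 => sz.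
  apply: leq_trans (size_polyMleq _ _) _.
  by have := leq_add sz (size_poly r.+1 (fun i => 'C(r, i)%:R ^+ 2 : rat));
     rewrite -/(square_binomial_poly r); case: (_ + _)%N.
by rewrite !polyCN !polyC1 !mul1r !mulN1r expr2 !mulNr -!mulrA.
Qed.

End SquareBinomials.

Lemma legendre_square_binomial r :
  2 ^+ r *: legendre r = square_binomial_form r ('X + 1) ('X - 1).
Proof.
pose Q r := square_binomial_form r ('X + 1 : {poly rat}) ('X - 1).
suff: 2 ^+ r *: legendre r = Q r /\ 2 ^+ r.+1 *: legendre r.+1 = Q r.+1 by case.
elim: r => [|r [IH0 IH1]].
  rewrite /Q /square_binomial_form !big_ord_recl !big_ord0 /= !scale1r.
  split; first by rewrite !expr0 mulr1 addr0.
  rewrite expr1 scaler_nat (_ : bump 0 0 = 1%N) // bin0 binn subn0 subnn.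
  by rewrite !expr0 !expr1 -[(1 ^ 2)%N]/1%N; ring.
split=> //.
have r2 : (r.+2)%:R != 0 :> rat by rewrite pnatr_eq0.
apply: (scalerI r2); rewrite square_binomial_form_rec -/(Q _) -/(Q _) -IH0 -IH1.
rewrite -[legendre r.+2]/((r.+2)%:R^-1 *: ((r.+1.*2.+1)%:R *: ('X * legendre r.+1)
                                - r.+1%:R *: legendre r)).
rewrite scalerA mulrC -scalerA [_ *: (_^-1 *: _)]scalerA mulfV // scale1r.
rewrite (_ : 'X + 1 + ('X - 1) = 2 *: 'X); last first.
  by rewrite scaler_nat; ring.
rewrite (_ : ('X + 1 - ('X - 1)) ^+ 2 = (2 ^+ 2)%:P); last first.
  by rewrite -natrX rmorph_nat; ring.
rewrite mul_polyC -!scalerAl -!scalerAr !scalerBr !scalerA.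
congr (_ *: _ - _ *: _); rewrite ?exprS ?doubleS; ring.
Qed.

(** The map [ratr] is not additive in positive characteristic, but it behaves
    well on rational numbers whose denominator remains invertible. *)
Lemma ratr_div2X (E : fieldType) (z : int) n : 2 != 0 :> E ->
  ratr (z%:~R / 2 ^+ n) = z%:~R / 2 ^+ n :> E.
Proof.
move=> E2; set x : rat := _ / _.
have x2 : numq x * 2 ^+ n = z * denq x.
  apply/eqP; rewrite -(inj_eq (intr_inj (R := rat))) !rmorphM /= rmorphXn /=.
  rewrite -[(numq x)%:~R](divfK (_ : (denq x)%:~R != 0)) ?intr_eq0 ?denq_neq0 //.
  by rewrite divq_num_den /x mulrAC divfK // expf_neq0.
have dvd : (denq x %| 2 ^+ n)%Z.
  rewrite -(@Gauss_dvdzr _ (numq x)) ?x2 ?dvdz_mull //.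
  by rewrite coprimezE coprime_sym coprime_num_den.
have E2n : 2 ^+ n != 0 :> E by rewrite expf_neq0.
have den0 : (denq x)%:~R != 0 :> E.
  move: dvd => /dvdzP[c e]; apply: contra E2n => /eqP d0.
  have := congr1 (fun a : int => a%:~R : E) e.
  by rewrite rmorphXn rmorphM /= d0 mulr0 => ->.
rewrite /ratr; apply: (canLR (mulfK den0)); rewrite mulrAC; apply: (canRL (mulfK E2n)).
have := congr1 (fun a : int => a%:~R : E) x2.
by rewrite !rmorphM rmorphXn /=.
Qed.

Lemma legendre_in_square_binomial (E : fieldType) r (x : E) : 2 != 0 :> E ->
  2 ^+ r * (legendre_in E r).[x] = square_binomial_form r (x + 1) (x - 1).
Proof.
move=> E2; pose Z : {poly int} := square_binomial_form r ('X + 1) ('X - 1).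
have mapZ (R : comNzRingType) :
    map_poly intr Z = square_binomial_form r ('X + 1) ('X - 1) :> {poly R}.
  rewrite rmorph_sum; apply: eq_bigr => i _.
  by rewrite rmorphMn rmorphM !rmorphXn rmorphD rmorphB /= !map_polyX !rmorph1.
have legE : legendre r = (2 ^+ r)^-1 *: map_poly intr Z.
  by rewrite mapZ -legendre_square_binomial scalerA mulVf ?scale1r // expf_neq0.
have -> : legendre_in E r = (2 ^+ r)^-1 *: map_poly intr Z.
  apply/polyP => i; rewrite [LHS]coef_map_id0; last by rewrite /ratr mul0r.
  rewrite legE !coefZ !coef_map /=.
  by rewrite mulrC ratr_div2X // mulrC.
rewrite hornerZ mulVKf ?expf_neq0 // mapZ horner_sum; apply: eq_bigr => i _.
by rewrite hornerMn hornerM !horner_exp !hornerE.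
Qed.

Lemma square_binomial_formZ (R : comNzRingType) r (c a b : R) :
  square_binomial_form r (c * a) (c * b) = c ^+ r * square_binomial_form r a b.
Proof.
rewrite mulr_sumr; apply: eq_bigr => i _; rewrite mulrnAr; congr (_ *+ _).
by rewrite !exprMn mulrACA -exprD subnKC // -ltnS.
Qed.

(** * Sums over finite fields *)

(** The sum is multiplied by [f c] when the summation variable is translated
    by c. *)
Lemma sum_mult_char (E : finFieldType) (K : fieldType) (f : E -> K) :
  (forall x y, x != 0 -> y != 0 -> f (x * y) = f x * f y) ->
  (exists2 x, x != 0 & f x != 1) -> \sum_(x | x != 0) f x = 0.
Proof.
move=> fM [c c0 fc]; set S := \sum_(x | _) _.
have : S = f c * S.
  rewrite mulr_sumr /S (reindex_inj (mulfI c0)).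
  apply: eq_big => [x|x]; rewrite mulf_eq0 (negbTE c0) // => x0; exact: fM.
move/eqP; rewrite -subr_eq0 -{1}[S]mul1r -mulrBl mulf_eq0 subr_eq0 eq_sym.
by rewrite (negbTE fc) => /eqP.
Qed.

Section FiniteFieldSums.
Variable E : finFieldType.

Lemma finfield_expn_pred (x : E) : x != 0 -> x ^+ #|E|.-1 = 1.
Proof.
move=> x0; apply: (mulfI x0); rewrite -exprS prednK ?expf_card ?mulr1 //.
by apply/card_gt0P; exists 0.
Qed.

Lemma finfield_exp_neq1 e : ~~ (#|E|.-1 %| e)%N -> exists2 x : E, x != 0 & x ^+ e != 1.
Proof.
move=> Ne; apply: contrapT => H.
have e1 (x : E) : x != 0 -> x ^+ (e %% #|E|.-1) = 1.
  move=> x0; have <- : x ^+ e = 1.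
    by apply/eqP; apply: contrapT => /negP xe; apply: H; exists x.
  rewrite {2}(divn_eq e #|E|.-1) exprD mulnC exprM finfield_expn_pred //.
  by rewrite expr1n mul1r.
set d := (e %% _)%N in e1; have d0 : (0 < d)%N by rewrite lt0n.
have N0 : (0 < #|E|.-1)%N by rewrite -ltnS prednK ?finNzRing_gt1 // ltnW ?finNzRing_gt1.
have : (size (enum [pred x : E | x != (0 : E)%R]) <= d)%N.
  apply: (@max_unity_roots E) => //; last exact: enum_uniq.
  by apply/allP => x; rewrite mem_enum => /e1 xd; apply/unity_rootP.
by rewrite -cardE cardC1 leqNgt ltn_mod N0.
Qed.

Lemma natr_card_finfield : #|E|%:R = 0 :> E.
Proof.
apply: (addrI (\sum_(x : E) x)); rewrite addr0.
rewrite [in RHS](reindex_inj (addIr 1)) big_split /=; congr (_ + _).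
by rewrite sumr_const.
Qed.

Lemma sum_exp_finfield e :
  \sum_(x : E | x != 0) x ^+ e = if (#|E|.-1 %| e)%N then -1 else 0.
Proof.
case: ifPn => [/dvdnP[l ->]|Ne]; last first.
  apply: sum_mult_char; first by move=> x y _ _; rewrite exprMn.
  exact: finfield_exp_neq1.
under eq_bigr => x x0 do rewrite mulnC exprM finfield_expn_pred // expr1n.
rewrite sumr_const cardC1; apply: (addIr 1); rewrite addNr -mulrSr prednK.
  exact: natr_card_finfield.
by apply/card_gt0P; exists 0.
Qed.

End FiniteFieldSums.

Section TorusSums.
Variables (F F2 : finFieldType) (iF : {rmorphism F -> F2}).
Hypothesis cardF2 : #|F2| = (#|F| ^ 2)%N.
Local Notation q := #|F|.

Let q_gt1 : (1 < q)%N. Proof. exact: finNzRing_gt1. Qed.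

(** On the vector of weight i the torus acts by [a ^ i], and the sum of
    [a ^ (i + e)] vanishes unless q - 1 divides [i + e]. *)
Lemma split_torus_sum n e (B : 'M[F2]_2) :
  \sum_(a : F | a != 0) iF a ^+ e * \tr (symx n (mat2 (iF a) 0 0 1 *m B)) =
  - \sum_(i < n.+1 | (q.-1 %| i + e)%N) symx n B i i.
Proof.
transitivity (\sum_(i < n.+1) (\sum_(a : F | a != 0) iF (a ^+ (i + e))) * symx n B i i).
  under [RHS]eq_bigr => i _ do rewrite mulr_suml.
  rewrite exchange_big; apply: eq_bigr => a _.
  rewrite mulr_sumr; apply: eq_bigr => i _; rewrite symxM mxE (bigD1 i) //=.
  rewrite big1 ?addr0 => [|j ij]; last first.
    by rewrite symx_diag eq_sym (negbTE ij) mulr0n mul0r.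
  by rewrite symx_diag eqxx expr1n mulr1 mulrA -exprD addnC rmorphXn.
rewrite -sumrN [RHS]big_mkcond; apply: eq_bigr => i _.
rewrite -rmorph_sum sum_exp_finfield.
by case: ifP; rewrite ?rmorphN ?rmorph1 ?mulN1r // rmorph0 mul0r.
Qed.

(** The weights [0, .., 2r] differ from r by at most (q - 1) / 2. *)
Lemma dvdn_split_weight r i : (r.*2 <= q.-1)%N -> (i < (r.*2).+1)%N ->
  (q.-1 %| i + (q.-1 - r))%N = (i == r).
Proof.
have q1 : (0 < q.-1)%N by rewrite -ltnS prednK // ltnW.
move: q.-1 q1 => N N0 rN ir; apply/idP/eqP => [|->]; last first.
  by rewrite subnKC // (leq_trans _ rN) // -addnn leq_addl.
case: (ltngtP i r) => // [ir'|ri].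
  by rewrite gtnNdvd //; lia.
have -> : (i + (N - r) = N + (i - r))%N by lia.
by rewrite dvdn_addr // gtnNdvd //; lia.
Qed.

(** The exponent of [y] on the vector of weight i, twisted by the determinant
    [y ^ (q + 1)], is [q ^ 2 - 1 + (q - 1) * (r - i)], where
    [r - i] is smaller than [q + 1] in absolute value. *)
Lemma dvdn_nonsplit_weight r i : (r.*2 <= q.-1)%N -> (i < (r.*2).+1)%N ->
  ((q ^ 2).-1 %| i + q * (r.*2 - i) + (q + 1) * (q.-1 - r))%N = (i == r).
Proof.
case: q q_gt1 => [//|N]; rewrite -[N.+1.-1]/N !ltnS => N0 rN ir.
have -> : ((N.+1 ^ 2).-1 = N.+2 * N)%N by rewrite expnS expn1; lia.
apply/idP/eqP => [|->]; last first.
  have -> : (r + N.+1 * (r.*2 - r) + (N.+1 + 1) * (N - r) = N.+2 * N)%N by nia.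
  exact: dvdnn.
case: (ltngtP i r) => // [ir'|ri].
  have -> : (i + N.+1 * (r.*2 - i) + (N.+1 + 1) * (N - r) = N.+2 * N + N * (r - i))%N.
    by nia.
  rewrite dvdn_addr // gtnNdvd ?muln_gt0 ?N0 ?subn_gt0 //.
  by rewrite mulnC ltn_mul2r N0; lia.
rewrite gtnNdvd //; last by nia.
by rewrite addn_gt0 muln_gt0 /=; lia.
Qed.

(** Averaging over the diagonal matrices [diag (y, y ^ q)] projects the symmetric
    power onto its middle weight, which factors the middle coefficient of the
    product. *)
Lemma nonsplit_torus_sum r (M N : 'M[F2]_2) (i0 := inord r : 'I_(r.*2).+1) :
  (r.*2 <= q.-1)%N ->
  \sum_(y : F2 | y != 0) (y ^+ (q + 1)) ^+ (q.-1 - r) *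
    symx r.*2 (M *m mat2 y 0 0 (y ^+ q) *m N) i0 i0 =
  - (symx r.*2 M i0 i0 * symx r.*2 N i0 i0).
Proof.
move=> rq; have i0r : i0 = r :> nat by rewrite inordK // ltnS -addnn leq_addl.
transitivity (\sum_(i < (r.*2).+1) symx r.*2 M i0 i * symx r.*2 N i i0 *
   \sum_(y : F2 | y != 0) y ^+ (i + q * (r.*2 - i) + (q + 1) * (q.-1 - r))).
  under [RHS]eq_bigr => i _ do rewrite mulr_sumr.
  rewrite exchange_big; apply: eq_bigr => y _.
  rewrite !symxM mxE mulr_sumr; apply: eq_bigr => i _; rewrite mxE (bigD1 i) //=.
  rewrite big1 ?addr0 => [|j ij]; last first.
    by rewrite symx_diag (negbTE ij) mulr0n mulr0.
  by rewrite symx_diag eqxx mulr1n -!exprM !exprD; ring.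
have wt (i : 'I_(r.*2).+1) :
    ((q ^ 2).-1 %| i + q * (r.*2 - i) + (q + 1) * (q.-1 - r))%N = (i == i0).
  by rewrite dvdn_nonsplit_weight // -val_eqE /= i0r.
rewrite (bigD1 i0) //= [X in _ + X]big1 ?addr0 => [|i ii0]; last first.
  by rewrite sum_exp_finfield cardF2 wt (negbTE ii0) mulr0.
by rewrite sum_exp_finfield cardF2 wt eqxx mulrN1.
Qed.

(** The columns of [mat2 (u + s) (u - s) 1 1] are the eigenvectors of the
    non-split torus translated by u, and the last matrix is its inverse, so the
    sum is over products of the two tori.  Both sums select the middle weight,
    and what remains is the product of the middle coefficients of the symmetric
    powers of that matrix and of its inverse. *)
Lemma torus_sum_legendre r (u s : F2) : (r.*2 <= q.-1)%N -> 2 != 0 :> F2 -> s != 0 ->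
  \sum_(a : F | a != 0) \sum_(y : F2 | y != 0)
    (iF a * y ^+ (q + 1)) ^+ (q.-1 - r) *
    \tr (symx r.*2 (mat2 (iF a) 0 0 1 *m
       (mat2 (u + s) (u - s) 1 1 *m mat2 y 0 0 (y ^+ q) *m
        ((2 * s)^-1 *: mat2 1 (s - u) (-1) (u + s))))) =
  (legendre_in F2 r).[u / s] ^+ 2.
Proof.
move=> rq F2_2 s0; set M := mat2 (u + s) _ _ _; set N := _ *: _.
pose i0 : 'I_(r.*2).+1 := inord r.
have i0r : i0 = r :> nat by rewrite inordK // ltnS -addnn leq_addl.
have wt (i : 'I_(r.*2).+1) : (q.-1 %| i + (q.-1 - r))%N = (i == i0).
  by rewrite dvdn_split_weight // -val_eqE /= i0r.
rewrite exchange_big /=.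
under eq_bigr => y y0.
  under eq_bigr => a _ do rewrite exprMn mulrAC [_ * _ * _]mulrC.
  rewrite -mulr_sumr split_torus_sum (big_pred1 i0) => [|i]; last exact: wt.
  rewrite mulrN; over.
rewrite sumrN nonsplit_torus_sum // opprK /N /M symxZ [X in _ * X]mxE !symx_center.
rewrite -!/(square_binomial_form _ _ _).
have -> : square_binomial_form r ((u + s) * 1) ((u - s) * 1) =
          (2 * s) ^+ r * (legendre_in F2 r).[u / s].
  rewrite exprMn mulrAC legendre_in_square_binomial // [_ * s ^+ r]mulrC -square_binomial_formZ.
  by rewrite mulrDr mulrBr [s * (u / s)]mulrC divfK // !mulr1.
have -> : square_binomial_form r (1 * (u + s)) ((s - u) * -1) =
          (2 * s) ^+ r * (legendre_in F2 r).[u / s].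
  rewrite exprMn mulrAC legendre_in_square_binomial // [_ * s ^+ r]mulrC -square_binomial_formZ.
  by rewrite mul1r mulrN1 opprB mulrDr mulrBr [s * (u / s)]mulrC divfK // !mulr1.
have s20 : (2 * s) ^+ r != 0 by rewrite expf_neq0 // mulf_neq0.
by rewrite -addnn exprD exprVn; field.
Qed.

End TorusSums.

(** * Conjugacy classes and class functions of PGL_2 *)

(** An eigenvector of A is taken as the bottom row of P. *)
Lemma eigen_mat2_conj (K : fieldType) (A : 'M[K]_2) (l : K) : root (char_poly A) l ->
  exists P a b, P \in unitmx /\ P *m A = mat2 a b 0 l *m P.
Proof.
rewrite -eigenvalue_root_char => /eigenvalueP[v vA v0].
have vE : v = \row_j (if j == 0 then v 0 0 else v 0 1).
  by apply/rowP; case=> [[|[|//]] ?]; rewrite !mxE /=; congr (v _ _); apply/val_inj.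
pose w : 'rV[K]_2 := if v 0 1 != 0 then delta_mx 0 0 else delta_mx 0 1.
pose P := mat2 (w 0 0) (w 0 1) (v 0 0) (v 0 1).
have Pu : P \in unitmx.
  rewrite unitmxE unitfE det_mat2 /w; case: ifP => [v1|/negbFE/eqP v1].
    by rewrite !mxE /= mul1r mul0r subr0.
  rewrite !mxE /= mul0r mul1r sub0r oppr_eq0; apply: contra v0 => /eqP v00.
  by apply/eqP/rowP => j; rewrite vE v00 v1 !mxE if_same.
exists P, (((P *m A) *m invmx P) 0 0), (((P *m A) *m invmx P) 0 1); split=> //.
rewrite -[LHS](mulmxKV Pu); congr (_ *m P).
have rowP1 : row 1 P = v.
  by rewrite [RHS]vE; apply/rowP => j; rewrite !mxE /=.
have row1 : row 1 (P *m A *m invmx P) = row 1 (l%:M : 'M_2).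
  rewrite !row_mul rowP1 vA -scalemxAl -rowP1 -row_mul mulmxV //.
  by rewrite -[l%:M]scalemx1 linearZ.
rewrite [LHS]mat2_eta; congr mat2.
  by have /rowP/(_ 0) := row1; rewrite !mxE.
by have /rowP/(_ 1) := row1; rewrite !mxE.
Qed.

(** In upper triangular form, a unipotent conjugation clears the corner entry if
    the eigenvalues differ, and a diagonal one normalizes it otherwise. *)
Lemma mat2_normal_form (K : fieldType) (A : 'M[K]_2) (l : K) : root (char_poly A) l ->
  exists P T, [/\ P \in unitmx, P *m A = T *m P &
    [\/ T = mat2 l 0 0 l, T = mat2 l 1 0 l | exists2 a, a != l & T = mat2 a 0 0 l]].
Proof.
move=> /eigen_mat2_conj[P [a [b [Pu PA]]]].
have conj (C T : 'M[K]_2) : C \in unitmx -> C *m mat2 a b 0 l = T *m C ->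
    C *m P \in unitmx /\ C *m P *m A = T *m (C *m P).
  by move=> Cu CT; rewrite unitmx_mul Cu Pu -mulmxA PA !mulmxA CT.
have [al|al] := eqVneq a l; last first.
  pose C := mat2 1 (b / (a - l)) 0 1.
  have Cu : C \in unitmx by rewrite unitmxE det_mat2 mulr0 subr0 mulr1 unitr1.
  have [|Cu' e] := conj C (mat2 a 0 0 l) Cu.
    rewrite !mul_mat2; congr mat2; rewrite ?(mulr0, mul0r, addr0, add0r, mulr1, mul1r) //.
    by have al' : a - l != 0 by [rewrite subr_eq0]; field.
  by exists (C *m P), (mat2 a 0 0 l); split=> //; apply: Or33; exists a.
have [b0|b0] := eqVneq b 0.
  by exists P, (mat2 l 0 0 l); split=> //; [rewrite PA al b0 | apply: Or31].
pose C := mat2 1 0 0 b.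
have Cu : C \in unitmx by rewrite unitmxE det_mat2 mulr0 subr0 mul1r unitfE.
have [|Cu' e] := conj C (mat2 l 1 0 l) Cu.
  rewrite !mul_mat2 al; congr mat2; rewrite ?(mulr0, mul0r, addr0, add0r, mulr1, mul1r) //.
  by rewrite mulrC.
by exists (C *m P), (mat2 l 1 0 l); split=> //; apply: Or32.
Qed.

Lemma unit_mat2 (K : fieldType) (a b c d : K) :
  (mat2 a b c d \in unitmx) = (a * d - b * c != 0).
Proof. by rewrite unitmxE unitfE det_mat2. Qed.

Section PGLRepresentation.
Variable F : finFieldType.
Local Notation GL := {'GL_2[F]}.
Local Notation Z := (GL2_center F).
Implicit Types A B P T : 'M[F]_2.

Lemma GLval_inj : injective (@GLval 2 F). Proof. exact: val_inj. Qed.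

Lemma GLvalM (g h : GL) : GLval (g * h)%g = (GLval g : 'M[F]_2) *m GLval h.
Proof. by []. Qed.

Lemma GL2_ofK A : A \in unitmx -> GLval (GL2_of A) = A.
Proof. by move=> Au; apply: insubdK. Qed.

Lemma GL2_val_unit (g : GL) : (GLval g : 'M[F]_2) \in unitmx.
Proof. exact: (valP g). Qed.

Lemma GL2_ofM A B : A \in unitmx -> B \in unitmx ->
  GL2_of (A *m B) = (GL2_of A * GL2_of B)%g.
Proof.
move=> Au Bu; apply: GLval_inj; rewrite GLvalM !GL2_ofK //.
by rewrite unitmx_mul Au.
Qed.

Lemma GL2_norm (g : GL) : g \in 'N(Z)%g.
Proof. by apply: (fintype.subsetP (normal_norm (center_normal 'GL_2[F]))); rewrite inE. Qed.

Lemma coset_PGL2 (g : GL) : coset Z g \in PGL2 F.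
Proof. by apply: mem_quotient; rewrite inE. Qed.

Lemma pgl_PGL2 A : pgl A \in PGL2 F. Proof. exact: coset_PGL2. Qed.

Lemma pglM A B : A \in unitmx -> B \in unitmx -> pgl (A *m B) = (pgl A * pgl B)%g.
Proof. by move=> Au Bu; rewrite /pgl GL2_ofM // morphM ?GL2_norm. Qed.

Lemma pgl_scalar (a : F) : a != 0 -> pgl (mat2 a 0 0 a) = 1%g.
Proof.
move=> a0; apply: coset_id.
have au : mat2 a 0 0 a \in unitmx by rewrite unit_mat2 mulr0 subr0 mulf_neq0.
apply/centerP; split; first by rewrite inE.
move=> g _; apply: GLval_inj; rewrite !GLvalM GL2_ofK //.
rewrite [GLval g]mat2_eta !mul_mat2.
by congr mat2; rewrite ?(mulr0, mul0r, addr0, add0r) // mulrC.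
Qed.

Lemma pglZ (c : F) A : c != 0 -> A \in unitmx -> pgl (c *: A) = pgl A.
Proof.
move=> c0 Au; have -> : c *: A = mat2 c 0 0 c *m A.
  by rewrite [A]mat2_eta scale_mat2 mul_mat2; congr mat2; rewrite mul0r ?addr0 ?add0r.
by rewrite pglM ?pgl_scalar ?mul1g // unit_mat2 mulr0 subr0 mulf_neq0.
Qed.

Lemma pgl1 : pgl (1%:M : 'M[F]_2) = 1%g.
Proof. by rewrite -mat2_1 pgl_scalar ?oner_eq0. Qed.

Section Trace.
Variables (L : fieldType) (n : nat) (rG : mx_representation L (PGL2 F) n).

Lemma repr_pglM A B : A \in unitmx -> B \in unitmx ->
  rG (pgl (A *m B)) = rG (pgl A) *m rG (pgl B).
Proof. by move=> Au Bu; rewrite pglM // repr_mxM ?pgl_PGL2. Qed.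

Lemma trace_pgl_conj P A T : P \in unitmx -> A \in unitmx -> T \in unitmx ->
  P *m A = T *m P -> \tr (rG (pgl A)) = \tr (rG (pgl T)).
Proof.
move=> Pu Au Tu e; have -> : A = invmx P *m (T *m P) by rewrite -e mulKmx.
rewrite repr_pglM ?unitmx_mul ?unitmx_inv ?Pu ?Tu // repr_pglM // mxtrace_mulC.
by rewrite -mulmxA -repr_pglM ?unitmx_inv // mulmxV // pgl1 repr_mx1 mulmx1.
Qed.

(** The character values on the four kinds of conjugacy classes: central, central
    times unipotent, split with eigenvalues a and b, and elliptic with an
    eigenvalue y. *)
Definition class_traces (F2 : finFieldType) (iF : {rmorphism F -> F2})
    (dim un : L) (sp : F -> L) (el : F2 -> L) : Prop :=
  [/\ forall a, a != 0 -> \tr (rG (pgl (mat2 a 0 0 a))) = dim,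
      forall a, a != 0 -> \tr (rG (pgl (mat2 a 1 0 a))) = un,
      forall a b, a != 0 -> b != 0 -> a != b ->
        \tr (rG (pgl (mat2 a 0 0 b))) = sp (a / b)
    & forall A y, A \in unitmx -> (forall a, y != iF a) ->
        root (char_poly (map_mx iF A)) y -> \tr (rG (pgl A)) = el y].

End Trace.

(** * Traces on spaces of functions *)

(** If the functions [Q x] lie in [V] and reproduce the elements of [V], then
    [Q] is the kernel of a projection onto [V]. *)
Lemma isom_functions_trace (L : fieldType) n (rG : mx_representation L (PGL2 F) n)
    (V : {ffun GL -> L^o} -> Prop) (w : GL -> L) (Q : GL -> {ffun GL -> L^o}) :
  isom_functions rG V w -> (forall x, V (Q x)) ->
  (forall f, V f -> forall y, f y = \sum_x f x * Q x y) ->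
  forall g, \tr (rG (coset Z g)) = w g * \sum_x Q x (x * g)%g.
Proof.
move=> [T [Tinj TV TG]] QV Qrep g.
have /choice[s sP] x : exists v, T v = Q x by apply/TV/QV.
have vE v : v = \sum_x (T v x) *: s x.
  apply: Tinj; rewrite linear_sum; apply/ffunP => y; rewrite sum_ffunE.
  rewrite (Qrep (T v)); last by apply/TV; exists v.
  by apply: eq_bigr => x _; rewrite linearZ sP ffunE.
set A := rG _; pose e j : 'cV[L]_n := delta_mx j 0.
transitivity (\sum_j \sum_x (T (A *m e j) x) * (s x) j 0).
  apply: eq_bigr => j _; have -> : A j j = (A *m e j) j 0.
    rewrite mxE (bigD1 j) //= big1 ?addr0 => [|l lj]; rewrite !mxE eqxx ?mulr1 //.
    by rewrite (negbTE lj) mulr0.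
  rewrite {1}[A *m e j]vE summxE; apply: eq_bigr => x _; by rewrite !mxE.
rewrite exchange_big mulr_sumr; apply: eq_bigr => x _ /=.
rewrite -sP -TG -/A {2}(_ : s x = \sum_j (s x) j 0 *: e j).
  rewrite mulmx_sumr linear_sum sum_ffunE; apply: eq_bigr => j _.
  by rewrite -scalemxAr linearZ ffunE mulrC.
by rewrite {1}[s x]matrix_sum_delta; apply: eq_bigr => j _; rewrite big_ord1.
Qed.

End PGLRepresentation.

(** * Traces of principal series *)

Section BorelTraces.
Variable F : finFieldType.
Local Notation GL := {'GL_2[F]}.
Local Notation q := #|F|.
Local Notation "x ~00" := ((GLval x : 'M[F]_2) 0 0) (at level 2, format "x ~00").
Local Notation "x ~01" := ((GLval x : 'M[F]_2) 0 1) (at level 2, format "x ~01").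
Local Notation "x ~10" := ((GLval x : 'M[F]_2) 1 0) (at level 2, format "x ~10").
Local Notation "x ~11" := ((GLval x : 'M[F]_2) 1 1) (at level 2, format "x ~11").
Implicit Types (b c x y g h : GL).

Definition borel x := x~10 == 0.

Lemma mulmx2E m n (A : 'M[F]_(m, 2)) (B : 'M[F]_(2, n)) i j :
  (A *m B) i j = A i 0 * B 0 j + A i 1 * B 1 j.
Proof.
rewrite mxE !big_ord_recl big_ord0 addr0; congr (_ + A _ _ * B _ _); exact/val_inj.
Qed.

Lemma GL_neq0 x : x~00 * x~11 - x~01 * x~10 != 0.
Proof. by rewrite -det_mat2 -mat2_eta -unitfE -unitmxE GL2_val_unit. Qed.

Lemma borel_neq0 b : borel b -> b~00 != 0 /\ b~11 != 0.
Proof.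
by move=> /eqP b0; have := GL_neq0 b; rewrite b0 mulr0 subr0 mulf_eq0 negb_or => /andP.
Qed.

Lemma borelM b c : borel b ->
  [/\ borel (b * c)%g = borel c, borel c -> (b * c)%g~00 = b~00 * c~00
    & borel c -> (b * c)%g~11 = b~11 * c~11].
Proof.
move=> Bb; have [b0 b1] := borel_neq0 Bb; move/eqP: (Bb) => b10.
rewrite /borel !GLvalM !mulmx2E b10 !mul0r !add0r mulf_eq0 (negbTE b1) /=.
by split=> // /eqP ->; rewrite mulr0 addr0.
Qed.

Lemma borel1 : borel 1%g. Proof. by rewrite /borel GL_1E !mxE. Qed.

Local Notation cB := #|[pred b | borel b]|.

Lemma card_borel_gt0 : (0 < cB)%N.
Proof. by apply/card_gt0P; exists 1%g; rewrite inE borel1. Qed.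

(** The matrices whose bottom row lies on a given line form a right translate
    of the Borel subgroup. *)
Lemma card_bottom_row (t : F) : #|[pred x : GL | x~11 == t * x~10]| = cB.
Proof.
pose W := GL2_of (mat2 0 1 1 t).
have WE : GLval W = mat2 0 1 1 t.
  by rewrite GL2_ofK // unit_mat2 mul0r sub0r mulr1 oppr_eq0 oner_eq0.
rewrite -(card_image (mulIg W) [pred b | borel b]); apply: eq_card => y.
rewrite inE; apply/idP/fintype.imageP => [/eqP y1|[x]].
  exists (y * W^-1)%g; last by rewrite mulgKV.
  rewrite inE /borel; set x := (y * _)%g.
  have yE : y = (x * W)%g by rewrite /x mulgKV.
  move: y1; rewrite yE !GLvalM WE !mulmx2E !mat2E !mulr0 !mulr1 add0r.
  by move=> /eqP; rewrite [t * _]mulrC -subr_eq0 addrK.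
rewrite inE => /eqP Bx ->; rewrite !GLvalM WE !mulmx2E !mat2E Bx.
by rewrite !mul0r !add0r mulr1 mulrC.
Qed.

(** The bottom row of a matrix lies on exactly one of the q + 1 lines of the
    plane. *)
Lemma card_GL2_borel : #|{: GL}| = (q.+1 * cB)%N.
Proof.
have lines x : (1 = borel x + \sum_(t : F) (x~11 == t * x~10)%R)%N.
  have [Bx|Bx] := boolP (borel x).
    rewrite big1 // => t _; have [_ x1] := borel_neq0 Bx.
    by rewrite (eqP Bx) mulr0 (negbTE x1).
  rewrite (bigD1 (x~11 / x~10)) //= divfK // eqxx big1 // => t tx.
  apply/eqP; rewrite eqb0; apply: contra tx => /eqP ->.
  by rewrite mulfK.
rewrite -sum1_card (eq_bigr _ (fun x _ => lines x)) big_split /= mulSn.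
congr (_ + _)%N; first by rewrite -big_mkcond sum1_card.
transitivity (\sum_(t : F) cB)%N; last by rewrite sum_nat_const.
rewrite exchange_big; apply: eq_bigr => t _.
rewrite -(card_bottom_row t) -sum1_card [RHS]big_mkcond; apply: eq_bigr => x _.
by rewrite inE; case: (_ == _).
Qed.

Section Kernel.
Variable L : fieldType.
Hypothesis charL : forall n, (n%:R == 0 :> L) = (n == 0%N).
Variables mu1 mu2 : F -> L.
Hypothesis mu1M : forall x y : F, x != 0 -> y != 0 -> mu1 (x * y) = mu1 x * mu1 y.
Hypothesis mu2M : forall x y : F, x != 0 -> y != 0 -> mu2 (x * y) = mu2 x * mu2 y.

Let mu b := mu1 b~00 * mu2 b~11.

Let muM b c : borel b -> borel c -> mu (b * c)%g = mu b * mu c.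
Proof.
move=> Bb Bc; have [_ /(_ Bc) e0 /(_ Bc) e1] := borelM c Bb.
have [b0 b1] := borel_neq0 Bb; have [c0 c1] := borel_neq0 Bc.
by rewrite /mu e0 e1 mu1M // mu2M // mulrACA.
Qed.

(** The reproducing kernel of the equivariant functions: averaging a function
    over the Borel subgroup against the inverse of the character. *)
Definition borel_kernel x : {ffun GL -> L^o} :=
  [ffun y => if borel (y * x^-1)%g then mu (y * x^-1)%g / cB%:R else 0].

Lemma borel_equivariantE f : borel_equivariant mu1 mu2 f <->
  forall b y, borel b -> f (b * y)%g = mu b * f y.
Proof.
rewrite /borel_equivariant /borel /mu ord2_max -[ord0]/(0 : 'I_2).
by split=> [H b y /eqP Bb|H b y Bb]; [exact: H | apply: H; apply/eqP].
Qed.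

Lemma borel_kernel_equivariant x : borel_equivariant mu1 mu2 (borel_kernel x).
Proof.
apply/borel_equivariantE => b y Bb; rewrite !ffunE -mulgA.
have [-> _ _] := borelM (y * x^-1)%g Bb.
by case: ifP => [By|_]; rewrite ?mulr0 // muM // mulrA.
Qed.

Lemma cB_neq0 : cB%:R != 0 :> L.
Proof. by rewrite charL -lt0n card_borel_gt0. Qed.

Lemma borel_kernel_reproducing f : borel_equivariant mu1 mu2 f ->
  forall y, f y = \sum_x f x * borel_kernel x y.
Proof.
move=> /borel_equivariantE fB y.
rewrite (reindex_inj (h := fun b => (b^-1 * y)%g)) => [|b c /mulIg/invg_inj//] /=.
transitivity (\sum_(b | borel b) f y / cB%:R).
  by rewrite sumr_const -[RHS]mulr_natr divfK ?cB_neq0.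
rewrite big_mkcond; apply: eq_bigr => b _.
rewrite ffunE invMg invgK mulKVg; case: ifP => Bb; last by rewrite mulr0.
by rewrite mulrA [f (b^-1 * y)%g * _]mulrC -fB // mulKVg.
Qed.

(** The value of the induced character at g. *)
Definition borel_trace g := \sum_x borel_kernel x (x * g)%g.

Lemma borel_traceE g : borel_trace g =
  (\sum_(x | borel (x * g * x^-1)%g) mu (x * g * x^-1)%g) / cB%:R.
Proof.
rewrite /borel_trace mulr_suml [RHS]big_mkcond; apply: eq_bigr => x _.
by rewrite ffunE.
Qed.

Lemma borel_trace_scalar (a : F) : a != 0 ->
  borel_trace (GL2_of (mat2 a 0 0 a)) = (q.+1)%:R * (mu1 a * mu2 a).
Proof.
move=> a0; set g := GL2_of _.
have gE : GLval g = mat2 a 0 0 a by rewrite GL2_ofK // unit_mat2 mulr0 subr0 mulf_neq0.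
have xg x : (x * g * x^-1 = g)%g.
  apply: (mulIg x); rewrite mulgKV; apply: GLval_inj; rewrite !GLvalM gE.
  rewrite [GLval x]mat2_eta !mul_mat2.
  by congr mat2; rewrite ?(mulr0, mul0r, addr0, add0r) // mulrC.
have Bg : borel g by rewrite /borel gE !mat2E.
rewrite borel_traceE (eq_bigr (fun=> mu1 a * mu2 a)) => [|x _]; last first.
  by rewrite xg /mu gE !mat2E.
rewrite (eq_bigl predT) => [|x]; last by rewrite xg Bg.
rewrite sumr_const card_GL2_borel -[_ *+ _]mulr_natl natrM mulrAC mulfK ?cB_neq0 //.
Qed.

(* The bottom row of [x] is an eigenvector of [g] as soon as [x * g * x^-1] is
   upper triangular. *)
Let conjE x g h : (h * x = x * g)%g -> forall i j,
  (GLval h : 'M[F]_2) i 0 * (GLval x : 'M[F]_2) 0 j +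
    (GLval h : 'M[F]_2) i 1 * (GLval x : 'M[F]_2) 1 j =
  (GLval x : 'M[F]_2) i 0 * (GLval g : 'M[F]_2) 0 j +
    (GLval x : 'M[F]_2) i 1 * (GLval g : 'M[F]_2) 1 j.
Proof. by move=> e i j; rewrite -!mulmx2E -!GLvalM e. Qed.

(** The only eigenline of [g] is the one spanned by the bottom row of the
    elements of the Borel subgroup. *)
Lemma borel_trace_jordan (a : F) : a != 0 ->
  borel_trace (GL2_of (mat2 a 1 0 a)) = mu1 a * mu2 a.
Proof.
move=> a0; set g := GL2_of _.
have gE : GLval g = mat2 a 1 0 a by rewrite GL2_ofK // unit_mat2 mulr0 subr0 mulf_neq0.
rewrite borel_traceE; apply: (canLR (mulfK cB_neq0)).
have key x (h := (x * g * x^-1)%g) : (borel h = borel x) /\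
    (borel x -> mu h = mu1 a * mu2 a).
  have /conjE E : (h * x = x * g)%g by rewrite mulgKV.
  have := (E 0 0, E 1 0, E 1 1); rewrite gE !mat2E !mulr0 !addr0 !mulr1.
  move=> [[e00 e10] e11].
  suff H : borel h = borel x.
    split=> // Bx; have Bh : borel h by rewrite H.
    have [x0 x1] := borel_neq0 Bx; move: Bx Bh => /eqP x10 /eqP h10.
    rewrite ?x10 ?h10 ?mulr0 ?mul0r ?addr0 ?add0r in e00.
    rewrite ?x10 ?h10 ?mulr0 ?mul0r ?addr0 ?add0r in e11.
    have -> : mu h = mu1 h~00 * mu2 h~11 by [].
    have -> : h~00 = a by apply: (mulIf x0); rewrite e00 mulrC.
    by have -> : h~11 = a by apply: (mulIf x1); rewrite e11 mulrC.
  apply/idP/idP => /eqP z; apply/eqP; last first.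
    have [x0 _] := borel_neq0 (introT eqP z); rewrite z mulr0 addr0 mul0r in e10.
    by move/eqP: e10; rewrite mulf_eq0 (negbTE x0) orbF => /eqP.
  apply/eqP; apply: contraT => x10; rewrite z ?mul0r ?add0r in e10; rewrite z ?mul0r ?add0r in e11.
  have h11 : (GLval h : 'M[F]_2) 1 1 = a by apply: (mulIf x10); rewrite e10 mulrC.
  case/eqP: x10; apply: (addIr (x~11 * a)).
  by rewrite add0r -e11 h11 mulrC.
rewrite (eq_bigl borel) => [|x]; last by have [] := key x.
rewrite (eq_bigr (fun=> mu1 a * mu2 a)) => [|x Bx]; last by have [_ ->] := key x.
by rewrite sumr_const mulr_natr.
Qed.

(** There are two eigenlines, and on the bottom row spanning the second one the
    eigenvalues are exchanged. *)
Lemma borel_trace_diag (a d : F) : a != 0 -> d != 0 -> a != d ->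
  borel_trace (GL2_of (mat2 a 0 0 d)) = mu1 a * mu2 d + mu1 d * mu2 a.
Proof.
move=> a0 d0 ad; set g := GL2_of _.
have gE : GLval g = mat2 a 0 0 d by rewrite GL2_ofK // unit_mat2 mulr0 subr0 mulf_neq0.
rewrite borel_traceE; apply: (canLR (mulfK cB_neq0)).
have E x (h := (x * g * x^-1)%g) : [/\ h~00 * x~00 + h~01 * x~10 = x~00 * a,
    h~00 * x~01 + h~01 * x~11 = x~01 * d, h~10 * x~00 + h~11 * x~10 = x~10 * a
  & h~10 * x~01 + h~11 * x~11 = x~11 * d].
  have /conjE E : (h * x = x * g)%g by rewrite mulgKV.
  have := (E 0 0, E 0 1, E 1 0, E 1 1); rewrite gE !mat2E !mulr0 !addr0 !add0r.
  by case=> [[[]]].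
have Bx x : borel (x * g * x^-1)%g = borel x || (x~11 == 0).
  have [e00 e01 e10 e11] := E x; set h := (x * g * x^-1)%g in e00 e01 e10 e11 *.
  apply/idP/orP => [/eqP h10|[Bx|/eqP x1]].
  - have [//|x10] := boolP (borel x); first by left.
    right; apply: contraT => x1; rewrite h10 ?mul0r ?add0r in e10; rewrite h10 ?mul0r ?add0r in e11.
    case/eqP: ad; transitivity h~11.
      by apply: (mulIf x10); rewrite e10 mulrC.
    by apply: (mulIf x1); rewrite e11 mulrC.
  - have [x0 _] := borel_neq0 Bx; rewrite (eqP Bx) mulr0 addr0 mul0r in e10.
    by move/eqP: e10; rewrite mulf_eq0 (negbTE x0) orbF.
  - have := GL_neq0 x; rewrite x1 mulr0 sub0r oppr_eq0 mulf_eq0 negb_or => /andP[x01 _].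
    rewrite x1 mulr0 addr0 mul0r in e11.
    by move/eqP: e11; rewrite mulf_eq0 (negbTE x01) orbF.
rewrite (eq_bigl (fun x => borel x || (x~11 == 0))) //.
rewrite (bigID borel) /= mulrDl; congr (_ + _).
  rewrite (eq_big borel (fun=> mu1 a * mu2 d)) => [|x|x /andP[_ Bx']].
  - by rewrite sumr_const mulr_natr.
  - by case: (borel x); rewrite ?andbF.
  have [e00 e01 e10 e11] := E x; have [x0 x1] := borel_neq0 Bx'.
  have /eqP h10 : borel (x * g * x^-1)%g by rewrite Bx Bx'.
  rewrite ?(eqP Bx') ?h10 ?mulr0 ?mul0r ?addr0 ?add0r in e00.
  rewrite ?(eqP Bx') ?h10 ?mulr0 ?mul0r ?addr0 ?add0r in e11.
  rewrite /mu; have -> : (x * g * x^-1)%g~00 = a.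
    by apply: (mulIf x0); rewrite e00 mulrC.
  by have -> : (x * g * x^-1)%g~11 = d by apply: (mulIf x1); rewrite e11 mulrC.
rewrite (eq_big (fun x => x~11 == 0 * x~10) (fun=> mu1 d * mu2 a)) => [|x|x].
- by rewrite sumr_const card_bottom_row mulr_natr.
- rewrite mul0r; have [Bx'|//] := boolP (borel x); last by rewrite andbT.
  by rewrite andbF; have [_ /negbTE ->] := borel_neq0 Bx'.
move=> /andP[Bh nB]; have /eqP x1 : x~11 == 0 by move: Bh; rewrite (negbTE nB).
have [e00 e01 e10 e11] := E x.
have /eqP h10 : borel (x * g * x^-1)%g by rewrite Bx.
have := GL_neq0 x; rewrite x1 mulr0 sub0r oppr_eq0 mulf_eq0 negb_or => /andP[x01 x10].
rewrite ?x1 ?h10 ?mulr0 ?mul0r ?addr0 ?add0r in e01.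
rewrite ?x1 ?h10 ?mulr0 ?mul0r ?addr0 ?add0r in e10.
rewrite /mu; have -> : (x * g * x^-1)%g~00 = d.
  by apply: (mulIf x01); rewrite e01 mulrC.
by have -> : (x * g * x^-1)%g~11 = a by apply: (mulIf x10); rewrite e10 mulrC.
Qed.

(** The bottom row of [x] would be an eigenvector. *)
Lemma borel_trace_elliptic g :
  (forall l, ~~ root (char_poly (GLval g)) l) -> borel_trace g = 0.
Proof.
move=> nroot; rewrite borel_traceE big_pred0 ?mul0r // => x; apply/negP.
set h := (x * g * x^-1)%g => /eqP h10.
have /conjE E : (h * x = x * g)%g by rewrite mulgKV.
have /negP[] := nroot h~11; rewrite -eigenvalue_root_char; apply/eigenvalueP.
exists (row 1 (GLval x)).
  apply/rowP => j; have := E 1 j; rewrite h10 mul0r add0r => e.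
  transitivity (x~10 * (GLval g : 'M[F]_2) 0 j + x~11 * (GLval g : 'M[F]_2) 1 j).
    by rewrite mulmx2E !mxE.
  by rewrite -e [RHS]mxE [X in _ = _ * X]mxE.
apply/eqP => /rowP r0; have /eqP := GL_neq0 x; case.
have [x10 x11] : x~10 = 0 /\ x~11 = 0.
  by split; [have := r0 0 | have := r0 1]; rewrite !mxE.
by rewrite x10 x11 !mulr0 subrr.
Qed.

End Kernel.

End BorelTraces.

(** * Class functions attached to the parametrized representations *)

Lemma trace_mat2 (R : comNzRingType) (A : 'M[R]_2) : \tr A = A 0 0 + A 1 1.
Proof.
rewrite /mxtrace !big_ord_recl big_ord0 addr0; congr (_ + A _ _); exact/val_inj.
Qed.

Lemma char_poly_mat2 (K : fieldType) (A : 'M[K]_2) (l : K) :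
  (char_poly A).[l] = l ^+ 2 - \tr A * l + \det A.
Proof.
rewrite /char_poly; have -> : char_poly_mx A = mat2 ('X - (A 0 0)%:P) (- (A 0 1)%:P) (- (A 1 0)%:P)
    ('X - (A 1 1)%:P).
  by rewrite [LHS]mat2_eta !mxE /= !sub0r.
have detE : \det A = A 0 0 * A 1 1 - A 0 1 * A 1 0 by rewrite {1}[A]mat2_eta det_mat2.
by rewrite det_mat2 detE trace_mat2 !(hornerD, hornerN, hornerM, hornerX, hornerC); ring.
Qed.

Section Frobenius.
Variables (F : finFieldType) (K : fieldType) (iF : {rmorphism F -> K}).
Variables (p m : nat) (p_pr : prime p).
Hypothesis cardF : #|F| = (p ^ m)%N.
Local Notation q := #|F|.

Lemma card_frobeniusD (x y : K) : (x + y) ^+ q = x ^+ q + y ^+ q.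
Proof.
have pK : p \in [pchar K] by rewrite (fmorph_pchar iF) (card_finPcharP cardF).
by apply: exprDn_pchar; rewrite (eq_pnat _ (pcharf_eq pK)) cardF pnatX pnat_id.
Qed.

Lemma iF_frobenius (a : F) : iF a ^+ q = iF a.
Proof. by rewrite -rmorphXn expf_card. Qed.

(** The Frobenius map permutes the two roots of the characteristic polynomial
    of a matrix over F, so that a root which is not fixed determines both. *)
Lemma frobenius_eigenvalues (A : 'M[F]_2) (y : K) : y ^+ q != y ->
  root (char_poly (map_mx iF A)) y ->
  iF (\tr A) = y + y ^+ q /\ iF (\det A) = y * y ^+ q.
Proof.
move=> yq; rewrite rootE char_poly_mat2 det_map_mx trace_map_mx.
set t := iF _; set d := iF _ => /eqP e.
have e' : (y ^+ q) ^+ 2 - t * y ^+ q + d = 0.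
  have N1 : (-1) ^+ q = -1 :> K by have := iF_frobenius (-1); rewrite rmorphN1.
  have q0 : (q == 0)%N = false by rewrite gtn_eqF // ltnW // finNzRing_gt1.
  have := congr1 (fun x => x ^+ q) e; rewrite expr0n q0.
  rewrite !card_frobeniusD -[- (t * y)]mulN1r !exprMn N1 mulN1r.
  by rewrite -/t (iF_frobenius (\det A)) (iF_frobenius (\tr A)) expr2.
have tE : t = y + y ^+ q.
  have : (y ^+ q - y) * (y + y ^+ q - t) = 0.
    by rewrite -(subrr 0) -{1}e' -e; ring.
  by move=> /eqP; rewrite mulf_eq0 !subr_eq0 (negbTE yq) => /eqP.
split=> //; move/eqP: e; rewrite addr_eq0 tE => /eqP e.
by apply: (can_inj opprK); rewrite -e; ring.
Qed.

End Frobenius.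

Section Eigenvalues.
Variables (F F2 : finFieldType) (iF : {rmorphism F -> F2}).
Variables (p m : nat) (p_pr : prime p).
Hypothesis cardF : #|F| = (p ^ m)%N.
Local Notation q := #|F|.

Lemma in_iF_frobenius (y : F2) : (forall a, y != iF a) -> y ^+ q != y.
Proof.
move=> ny; apply/eqP => /frobenius_fixed_image-/(_ iF)[a ay].
by have /eqP[] := ny a.
Qed.

Lemma elliptic_no_root (A : 'M[F]_2) (y : F2) : (forall a, y != iF a) ->
  root (char_poly (map_mx iF A)) y -> forall l, ~~ root (char_poly A) l.
Proof.
move=> ny yA l; apply/negP => /[dup] lA.
rewrite rootE char_poly_mat2 => /eqP e.
have : (y - iF l) * (y - iF (\tr A - l)) = 0.
  move: yA; rewrite rootE char_poly_mat2 det_map_mx trace_map_mx => /eqP.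
  have -> : \det A = l * (\tr A - l).
    by apply/eqP; rewrite -subr_eq0 -e; apply/eqP; ring.
  by move=> <-; rewrite rmorphM rmorphB; ring.
by move/eqP; rewrite mulf_eq0 !subr_eq0 (negbTE (ny _)) (negbTE (ny _)).
Qed.

Section ClassTraces.
Variables (L : fieldType) (psi : F2 -> L) (chi : F -> L).
Hypothesis charL : forall n, (n%:R == 0 :> L) = (n == 0%N).
Hypothesis psi1 : psi 1 = 1.
Hypothesis psiM : forall x y, x != 0 -> y != 0 -> psi (x * y) = psi x * psi y.
Hypothesis chiE : forall a, a != 0 -> chi a = psi (iF a).
Variables (n : nat) (rG : mx_representation L (PGL2 F) n).

Lemma psiX y j : y != 0 -> psi (y ^+ j) = psi y ^+ j.
Proof.
move=> y0; elim: j => [|j IH]; first by rewrite !expr0.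
by rewrite !exprS psiM ?expf_neq0 // IH.
Qed.

Lemma psi_neq0 y : y != 0 -> psi y != 0.
Proof.
move=> y0; apply/eqP => psi0; have := psi1; rewrite -(divff y0) psiM ?invr_eq0 //.
by rewrite psi0 mul0r => /eqP; rewrite eq_sym oner_eq0.
Qed.

Lemma psiV y : y != 0 -> psi y^-1 = (psi y)^-1.
Proof.
move=> y0; apply: (mulIf (psi_neq0 y0)); rewrite mulVf ?psi_neq0 //.
by rewrite -psiM ?invr_eq0 // mulVf.
Qed.

Lemma chiM x y : x != 0 -> y != 0 -> chi (x * y) = chi x * chi y.
Proof.
by move=> x0 y0; rewrite !chiE ?mulf_neq0 // rmorphM psiM ?fmorph_eq0.
Qed.

Lemma chi_div x y : x != 0 -> y != 0 -> psi (iF (x / y)) = chi x / chi y.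
Proof.
by move=> x0 y0; rewrite !chiE // fmorph_div psiM ?invr_eq0 ?fmorph_eq0 // psiV ?fmorph_eq0.
Qed.

Lemma chi_neq0 x : x != 0 -> chi x != 0.
Proof. by move=> x0; rewrite chiE // psi_neq0 // fmorph_eq0. Qed.

Lemma chi_order x : x != 0 -> chi x ^+ q.-1 = 1.
Proof.
move=> x0; have ix0 : iF x != 0 by rewrite fmorph_eq0.
by rewrite chiE // -psiX // -rmorphXn finfield_expn_pred // rmorph1.
Qed.

(** The trace is a sum over the fixed points on the projective line: q + 1 of
    them for a scalar matrix, one for a Jordan block, two for a split matrix and
    none for an elliptic one. *)
Lemma principal_series_traces r :
  is_principal_series rG (fun a => chi a ^+ r) (fun a => chi a ^- r) ->
  class_traces rG iF (q.+1)%:R 1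
    (fun z => psi (iF z) ^+ r + psi (iF z) ^- r) (fun=> 0).
Proof.
set mu1 := fun a => chi a ^+ r; set mu2 := fun a => chi a ^- r => PS.
have mu1M x y : x != 0 -> y != 0 -> mu1 (x * y) = mu1 x * mu1 y.
  by move=> x0 y0; rewrite /mu1 chiM // exprMn.
have mu2M x y : x != 0 -> y != 0 -> mu2 (x * y) = mu2 x * mu2 y.
  by move=> x0 y0; rewrite /mu2 chiM // exprMn invfM.
have mu12 a : a != 0 -> mu1 a * mu2 a = 1.
  by move=> a0; rewrite /mu1 /mu2 divff // expf_neq0 // chi_neq0.
have tr A : \tr (rG (pgl A)) = borel_trace mu1 mu2 (GL2_of A).
  rewrite (isom_functions_trace PS (borel_kernel_equivariant mu1M mu2M)) ?mul1r //.
  exact: borel_kernel_reproducing.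
split=> [a a0|a a0|a b a0 b0 ab|A y Au ny yA]; rewrite tr.
- by rewrite borel_trace_scalar // mu12 // mulr1.
- by rewrite borel_trace_jordan // mu12.
- rewrite borel_trace_diag // chi_div // /mu1 /mu2; congr (_ + _).
    by rewrite expr_div_n.
  by rewrite expr_div_n invf_div.
- by rewrite borel_trace_elliptic // GL2_ofK //; apply: elliptic_no_root yA.
Qed.

(** Subtracting a constant from the reproducing kernel of all the functions on
    P^1 gives that of the functions with sum 0. *)
Lemma Steinberg_traces : odd q ->
  is_Steinberg_twist rG (fun g => chi (\det (GLval g)) ^+ (q - 1)./2) ->
  class_traces rG iF q%:R 0 (fun z => psi (iF z) ^+ (q - 1)./2)
    (fun y => - psi y ^+ ((q + 1) * (q - 1)./2)).
Proof.
set w := fun g => _; set h := (q - 1)./2 => q_odd St.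
have h2 : (h * 2 = q.-1)%N.
  by rewrite muln2 /h subn1 halfK -subn1 oddB ?q_odd ?subn0 // ltnW ?finNzRing_gt1.
pose one (a : F) : L := 1.
have oneM x y : x != 0 -> y != 0 -> one (x * y) = one x * one y by rewrite mulr1.
pose cG : L := #|{: {'GL_2[F]}}|%:R.
have cG0 : cG != 0 by rewrite charL -lt0n; apply/card_gt0P; exists 1%g.
pose Q x : {ffun {'GL_2[F]} -> L^o} := [ffun y => borel_kernel one one x y - cG^-1].
have QE x y : Q x y = borel_kernel one one x y - cG^-1 by rewrite ffunE.
have sumQ x : \sum_y borel_kernel one one x y = 1.
  rewrite (reindex_inj (mulIg x)) /=.
  rewrite (eq_bigr (fun y => if borel y then #|[pred b | @borel F b]|%:R^-1 else 0)).
    by rewrite -big_mkcond sumr_const -[LHS]mulr_natr mulVf // cB_neq0.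
  by move=> y _; rewrite ffunE mulgK !mul1r.
have QV x : borel_equivariant (fun=> 1) (fun=> 1) (Q x) /\ \sum_y Q x y = 0.
  split.
    move=> b y Bb; rewrite !QE (borel_kernel_equivariant oneM oneM x y Bb).
    by rewrite /one !mul1r.
  under eq_bigr => y _ do rewrite QE.
  by rewrite sumrB sumQ sumr_const -[_ *+ _]mulr_natr mulVf // subrr.
have Qrep f : borel_equivariant (fun=> 1) (fun=> 1) f /\ \sum_x f x = 0 ->
    forall y, f y = \sum_x f x * Q x y.
  move=> [fB f0] y; rewrite {1}(borel_kernel_reproducing charL (fB : borel_equivariant one one f) y).
  under [RHS]eq_bigr => x _ do rewrite QE mulrBr.
  by rewrite sumrB -mulr_suml f0 mul0r subr0.
have tr A : \tr (rG (pgl A)) = w (GL2_of A) * (borel_trace one one (GL2_of A) - 1).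
  rewrite (isom_functions_trace St QV Qrep); congr (_ * _).
  under eq_bigr => x _ do rewrite QE.
  by rewrite sumrB sumr_const -[_ *+ _]mulr_natr mulVf.
split=> [a a0|a a0|a b a0 b0 ab|A y Au ny yA]; rewrite tr.
- rewrite borel_trace_scalar // !mulr1 -natr1 addrK /w GL2_ofK; last first.
    by rewrite unit_mat2 mulr0 subr0 mulf_neq0.
  by rewrite det_mat2 mulr0 subr0 chiM // -expr2 -exprM mulnC h2 chi_order // mul1r.
- by rewrite borel_trace_jordan // mulr1 subrr mulr0.
- rewrite borel_trace_diag // !mulr1 addrK mulr1 /w GL2_ofK; last first.
    by rewrite unit_mat2 mulr0 subr0 mulf_neq0.
  rewrite det_mat2 mulr0 subr0 chiM // chi_div // !exprMn; congr (_ * _).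
  rewrite exprVn; apply: (mulIf (expf_neq0 h (chi_neq0 b0))).
  by rewrite mulVf ?expf_neq0 ?chi_neq0 // -exprD addnn -muln2 h2 chi_order.
- rewrite borel_trace_elliptic ?sub0r; last first.
    by rewrite GL2_ofK //; apply: elliptic_no_root yA.
  have [_ detE] := frobenius_eigenvalues p_pr cardF (in_iF_frobenius ny) yA.
  have y0 : y != 0 by have := ny 0; rewrite rmorph0.
  have det0 : \det A != 0 by rewrite -unitfE -unitmxE.
  rewrite mulrN1 /w GL2_ofK // chiE // detE -exprS psiX // exprM addn1 //.
Qed.

Lemma cuspidal_traces r :
  is_cuspidal iF rG (fun y => psi y ^+ ((q - 1) * (r + 1))) ->
  class_traces rG iF (q - 1)%:R (-1) (fun=> 0)
    (fun y => - (psi y ^+ ((q - 1) * (r + 1)) + psi (y ^+ q) ^+ ((q - 1) * (r + 1)))).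
Proof.
move=> [_ cen uni spl ell].
have th1 a : a != 0 -> psi (iF a) ^+ ((q - 1) * (r + 1)) = 1.
  by move=> a0; rewrite -chiE // exprM subn1 chi_order // expr1n.
split=> [a a0|a a0|a b a0 b0 ab|A y Au ny yA].
- by rewrite cen // th1 // mulr1.
- by rewrite uni // th1.
- exact: spl.
- by apply: ell => //; rewrite GL2_ofK.
Qed.

Lemma trivial_traces : is_trivial_rep rG ->
  class_traces rG iF 1 1 (fun=> 1) (fun=> 1).
Proof.
move=> [n1 triv]; have tr A : \tr (rG (pgl A)) = 1.
  by rewrite triv ?pgl_PGL2 // mxtrace1 n1.
by split=> *; rewrite tr.
Qed.

End ClassTraces.
End Eigenvalues.

(** * Reduction of the characters modulo p *)

Section SymmetricTraces.
Variable K : fieldType.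
Implicit Types a b : K.

(** Multiplying by [a - b] leaves two powers, so that identities between
    characters can be checked on powers of the eigenvalues. *)
Lemma complete_sum_sub n a b : (a - b) * complete_sum n a b = a ^+ n.+1 - b ^+ n.+1.
Proof.
apply: oppr_inj; rewrite -mulNr !opprB subrXX /=; congr (_ * _).
by apply: eq_bigr => i _; rewrite mulrC.
Qed.

Lemma complete_sum_diag n a : complete_sum n a a = (n.+1)%:R * a ^+ n.
Proof.
rewrite /complete_sum (eq_bigr (fun=> a ^+ n)) ?sumr_const ?card_ord ?mulr_natl // => i _.
by rewrite -exprD subnKC // -ltnS.
Qed.

Lemma symx_trace_conj n (P A T : 'M[K]_2) : P \in unitmx -> P *m A = T *m P ->
  \tr (symx n A) = \tr (symx n T).
Proof.
move=> Pu e; have -> : A = invmx P *m (T *m P) by rewrite -e mulKmx.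
by rewrite symxM mxtrace_mulC -symxM mulmxK.
Qed.

Lemma det_conj (P A T : 'M[K]_2) : P \in unitmx -> P *m A = T *m P -> \det A = \det T.
Proof.
move=> Pu e; have dP : \det P != 0 by rewrite -unitfE -unitmxE.
by apply: (mulfI dP); rewrite -!det_mulmx e !det_mulmx mulrC.
Qed.

End SymmetricTraces.

Section CharacterReduction.
Variables (F F2 : finFieldType) (iF : {rmorphism F -> F2}).
Local Notation q := #|F|.

(** The trace at eigenvalues a and b of [Sym^2r (x) det^(q - 1 - r)] plus [eps]
    times that of [Sym^n (x) det^e].  The exponent of the first determinant is
    that of [det^-r], made non-negative. *)
Definition sym_character (K : fieldType) (r n e : nat) (eps a b : K) :=
  (a * b) ^+ (q.-1 - r) * complete_sum r.*2 a b +
  eps * ((a * b) ^+ e * complete_sum n a b).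

Section EigenvalueIdentities.
Variables (r : nat) (a b a' b' : F2).
Hypotheses (a0 : a != 0) (b0 : b != 0).
Hypotheses (aq : a ^+ q = a') (bq : b ^+ q = b').

Let expq (x x' : F2) j : x != 0 -> x ^+ q = x' -> (j <= q)%N -> x ^+ (q - j) = x' / x ^+ j.
Proof. by move=> x0 <- jq; rewrite exprB ?unitfE. Qed.

Let q_pred j : (q.-1 - j = q - j.+1)%N. Proof. by rewrite subnS predn_sub. Qed.

(** The right-hand side is [(a - b) * ((a / b) ^ r + (b / a) ^ r)] when the
    Frobenius map fixes a and b, and 0 when it exchanges them. *)
Lemma sym_character_ps : (r.*2 < q)%N -> a' * b' = a * b ->
  (a - b) * sym_character r (q.-1 - r.*2) r 1 a b =
  a * (a / b) ^+ r - b * (b / a) ^+ r + (a' * (b / a) ^+ r - b' * (a / b) ^+ r).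
Proof.
move=> rq ab'; have r1q : (r < q)%N by rewrite (leq_ltn_trans _ rq) // -addnn leq_addl.
have n1 : ((q.-1 - r.*2).+1 = q - r.*2)%N by rewrite q_pred -subSn ?subSS.
rewrite /sym_character mulrDr mul1r ![(a - b) * (_ * _)]mulrCA !complete_sum_sub n1.
rewrite q_pred !exprMn (expq a0 aq r1q) (expq b0 bq r1q).
rewrite (expq a0 aq (ltnW rq)) (expq b0 bq (ltnW rq)).
have -> : a' / a ^+ r.+1 * (b' / b ^+ r.+1) = (a ^+ r)^-1 * (b ^+ r)^-1.
  rewrite mulf_div ab' !exprS; have := expf_neq0 r a0; have := expf_neq0 r b0.
  by move: (a ^+ r) (b ^+ r) => X Y Y0 X0; field; rewrite X0 Y0 a0 b0.
rewrite !exprVn -!addnn !exprS !exprD.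
have ar0 := expf_neq0 r a0; have br0 := expf_neq0 r b0.
move: (a ^+ r) (b ^+ r) ar0 br0 => X Y X0 Y0.
by field; rewrite X0 Y0.
Qed.

(** The right-hand side is 0 when the Frobenius map fixes a and b, and
    [- (a - b) * ((a / b) ^ r.+1 + (b / a) ^ r.+1)] when it exchanges them. *)
Lemma sym_character_cusp : (r.*2.+2 < q)%N -> a' * b' = a * b ->
  (a - b) * sym_character r (q.-1 - r.*2.+2) r.+1 1 a b =
  a * (a / b) ^+ r - b * (b / a) ^+ r +
  (a' / a * (b / a) ^+ r * b - b' / b * (a / b) ^+ r * a).
Proof.
move=> rq ab'; have r1q : (r < q)%N.
  by move: rq; move: q => N; lia.
have n1 : ((q.-1 - r.*2.+2).+1 = q - r.*2.+2)%N by rewrite q_pred -subSn ?subSS.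
rewrite /sym_character mulrDr mul1r ![(a - b) * (_ * _)]mulrCA !complete_sum_sub n1.
rewrite q_pred !exprMn (expq a0 aq r1q) (expq b0 bq r1q).
rewrite (expq a0 aq (ltnW rq)) (expq b0 bq (ltnW rq)).
have -> : a' / a ^+ r.+1 * (b' / b ^+ r.+1) = (a ^+ r)^-1 * (b ^+ r)^-1.
  rewrite mulf_div ab' !exprS; have := expf_neq0 r a0; have := expf_neq0 r b0.
  by move: (a ^+ r) (b ^+ r) => X Y Y0 X0; field; rewrite X0 Y0 a0 b0.
rewrite !exprVn -!addnn !exprS !exprD.
have ar0 := expf_neq0 r a0; have br0 := expf_neq0 r b0.
move: (a ^+ r) (b ^+ r) ar0 br0 => X Y X0 Y0.
by field; rewrite X0 Y0 a0 b0.
Qed.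

Lemma sym_character_St n e : (r.*2 = q.-1)%N ->
  (a - b) * sym_character r n e 0 a b = (a * b) ^+ r * (a' - b').
Proof.
move=> rq; rewrite /sym_character mul0r addr0 mulrCA complete_sum_sub.
rewrite rq prednK ?aq ?bq; last by rewrite ltnW // finNzRing_gt1.
by rewrite -rq -addnn addnK.
Qed.

End EigenvalueIdentities.

Lemma sym_character_diag r n e (eps a : F2) : a ^+ q.-1 = 1 -> (r <= q.-1)%N ->
  eps = 0 \/ (q.-1 %| n + e.*2)%N ->
  sym_character r n e eps a a = (r.*2.+1)%:R + eps * (n.+1)%:R.
Proof.
move=> aq rq epsn; rewrite /sym_character !complete_sum_diag -expr2 -!exprM.
rewrite !mul2n mulrCA -exprD -doubleD subnK // -[(q.-1).*2]muln2 exprM aq expr1n mulr1.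
congr (_ + _); rewrite [_ * (n.+1%:R * _)]mulrCA -exprD [(_ + n)%N]addnC.
case: epsn => [->|/dvdnP[l ->]]; first by rewrite !mul0r.
by rewrite mulnC exprM aq expr1n mulr1.
Qed.

End CharacterReduction.

(** * Reduction of sums of Teichmuller lifts *)

Section TorusCharacters.
Variables (p : nat) (p_pr : prime p) (p_odd : odd p).
Local Notation Zp := (padic_int p_pr).
Local Notation Qp := (padic_num p_pr).
Variables (L : closedFieldType) (iQ : {rmorphism Qp -> L}).
Hypothesis closL : is_padic_closure iQ.
Variables (k : closedFieldType) (red : L -> k).
Hypothesis redP : is_residue_map iQ red.
Variables (m : nat) (m_gt0 : (0 < m)%N) (Km : fieldExtType Qp).
Hypotheses (dimKm : \dim {:Km} = m) (unramKm : unramified Km).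
Variable iK : {rmorphism Km -> L}.
Hypothesis iKQ : forall a : Qp, iK a%:A = iQ a.
Variables (F F2 : finFieldType) (iF : {rmorphism F -> F2}) (i2 : {rmorphism F2 -> k}).
Hypotheses (cardF : #|F| = (p ^ m)%N) (cardF2 : #|F2| = (#|F| ^ 2)%N).
Variables (chi : F -> L) (psi : F2 -> L).
Hypothesis chiP : is_Teichmuller iQ red (i2 \o iF : {rmorphism F -> k}) chi.
Hypothesis psiP : is_Teichmuller iQ red i2 psi.

Local Notation q := #|F|.

Let q_gt1 : (1 < q)%N := finNzRing_gt1 F.

Let char_F : p%:R = 0 :> F.
Proof. by have := card_finPcharP cardF p_pr; rewrite inE => /andP[_ /eqP]. Qed.

Let char_F2 : p%:R = 0 :> F2.
Proof. by rewrite -(rmorph_nat iF) char_F rmorph0. Qed.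

Let char_k : p%:R = 0 :> k.
Proof. by rewrite -(rmorph_nat i2) char_F2 rmorph0. Qed.

Let q_F2 : q%:R = 0 :> F2.
Proof. by rewrite -(rmorph_nat iF) natr_card_finfield rmorph0. Qed.

Let q_odd : odd q. Proof. by rewrite cardF oddX p_odd orbT. Qed.

Let q_gt2 : (2 < q)%N.
Proof. by move: q_gt1; rewrite leq_eqVlt => /orP[/eqP e|//]; move: q_odd; rewrite -e. Qed.

Let halfq : ((q - 1)./2 * 2 = q.-1)%N.
Proof. by rewrite muln2 subn1 halfK -subn1 oddB ?q_odd ?subn0 // ltnW. Qed.

(** Integrality in Km and the value of the residue go together because both
    are inherited by sums and products; the residues that matter lie in
    F_{q^2}. *)
Definition reduces_to (x : L) (v : F2) :=
  (exists2 z, padic_integral iQ (iK z) & iK z = x) /\ red x = i2 v.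

Let reduces_int x v : reduces_to x v -> padic_integral iQ x.
Proof. by case=> -[z intz <-]. Qed.

Lemma reduces_nat n : reduces_to n%:R n%:R.
Proof.
split; last by rewrite (red_nat redP) rmorph_nat.
by exists n%:R; rewrite rmorph_nat //; apply: padic_integral_nat.
Qed.

Lemma reducesD x y v w : reduces_to x v -> reduces_to y w -> reduces_to (x + y) (v + w).
Proof.
move=> Hx Hy; split; last first.
  rewrite (redD redP (reduces_int Hx) (reduces_int Hy)).
  by rewrite rmorphD Hx.2 Hy.2.
move: Hx Hy => -[[z intz <-] _] [[t intt <-] _]; exists (z + t); rewrite rmorphD //.
exact: padic_integralD.
Qed.

Lemma reducesM x y v w : reduces_to x v -> reduces_to y w -> reduces_to (x * y) (v * w).
Proof.
move=> Hx Hy; split; last first.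
  rewrite (redM redP (reduces_int Hx) (reduces_int Hy)).
  by rewrite rmorphM Hx.2 Hy.2.
move: Hx Hy => -[[z intz <-] _] [[t intt <-] _]; exists (z * t); rewrite rmorphM //.
exact: padic_integralM.
Qed.

Lemma reducesN x v : reduces_to x v -> reduces_to (- x) (- v).
Proof.
move=> Hx; split; last by rewrite (redN redP (reduces_int Hx)) rmorphN Hx.2.
move: Hx => -[[z intz <-] _]; exists (- z); rewrite rmorphN //.
exact: padic_integralN.
Qed.

Lemma reduces_sum (I : finType) (P : pred I) (f : I -> L) (g : I -> F2) :
  (forall i, P i -> reduces_to (f i) (g i)) ->
  reduces_to (\sum_(i | P i) f i) (\sum_(i | P i) g i).
Proof.
move=> H; elim/big_ind2: _ => //; [exact: (reduces_nat 0) | by move=> *; apply: reducesD].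
Qed.

Lemma reduces_natV n : coprime n p -> reduces_to n%:R^-1 n%:R^-1.
Proof.
move=> np; have intV := padic_integral_unit_inv iQ np.
have n0 : n%:R != 0 :> L.
  apply/eqP => n0; have nU := padic_nat_unit p_pr np.
  have : iQ (tofrac (n%:R * n%:R^-1 : Zp)) = 1 by rewrite divrr // !rmorph1.
  by rewrite !rmorphM !rmorph_nat n0 mul0r => /eqP; rewrite eq_sym oner_eq0.
split; first by exists n%:R^-1; rewrite fmorphV rmorph_nat.
have : red (n%:R * n%:R^-1) = 1 by rewrite divff // (red1 redP).
rewrite (redM redP) ?(red_nat redP) //; last exact: padic_integral_nat.
move=> e; rewrite fmorphV rmorph_nat.
have n0k : n%:R != 0 :> k.
  by apply/eqP => n0k; move/eqP: e; rewrite n0k mul0r eq_sym oner_eq0.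
by apply: (mulfI n0k); rewrite e divff.
Qed.

Lemma teichmuller_int y : y != 0 -> padic_integral iQ (psi y).
Proof. by move=> y0; case: (psiP.2 y y0). Qed.

Lemma teichmuller_red y : y != 0 -> red (psi y) = i2 y.
Proof. by move=> y0; case: (psiP.2 y y0). Qed.

Lemma teichmuller1 (E : finFieldType) (i : {rmorphism E -> k}) (f : E -> L) :
  is_Teichmuller iQ red i f -> f 1 = 1.
Proof.
move=> [fM fP]; have [_ r1] := fP 1 (oner_neq0 _).
have f0 : f 1 != 0.
  by apply/eqP => f0; move/eqP: r1; rewrite f0 (red0 redP) rmorph1 eq_sym oner_eq0.
by apply: (mulfI f0); rewrite -fM ?oner_neq0 // !mulr1.
Qed.

Lemma teichmuller_unity (E : finFieldType) (i : {rmorphism E -> k}) (f : E -> L) x :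
  is_Teichmuller iQ red i f -> x != 0 -> f x ^+ #|E|.-1 = 1.
Proof.
move=> fT x0; have fX j : f (x ^+ j) = f x ^+ j.
  elim: j => [|j IH]; first by rewrite !expr0 (teichmuller1 fT).
  by rewrite !exprS fT.1 ?expf_neq0 // IH.
by rewrite -fX finfield_expn_pred // (teichmuller1 fT).
Qed.

Let psi1 : psi 1 = 1 := teichmuller1 psiP.
Let psiM := psiP.1.
Let psiXj y j := psiX psi1 psiM (y := y) j.
Let psiVy y := psiV psi1 psiM (y := y).

Let coprime_q2 : coprime (q ^ 2).-1 p.
Proof.
rewrite coprime_sym; have : coprime (q ^ 2) (q ^ 2).-1 by rewrite coprimenP // expn_gt0 ltnW.
by rewrite {1}cardF -expnM coprime_pexpl // muln_gt0 m_gt0.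
Qed.

Let q2_gt0 : (0 < (q ^ 2).-1)%N.
Proof. by rewrite -subn1 subn_gt0 -{1}(expn0 q) ltn_exp2l. Qed.

Let q2E : ((q ^ 2).-1 = q.-1 * (q + 1))%N.
Proof. by rewrite -!subn1 -subn_sqr exp1n. Qed.

(** Both sides are roots of unity of order prime to p with the same residue. *)
Lemma teichmuller_restrict a : a != 0 -> chi a = psi (iF a).
Proof.
move=> a0; have ia0 : iF a != 0 by rewrite fmorph_eq0.
apply: (red_unity_inj redP char_k q2_gt0 coprime_q2).
- by rewrite q2E exprM (teichmuller_unity chiP a0) expr1n.
- by rewrite -cardF2 (teichmuller_unity psiP ia0).
- by rewrite teichmuller_red //; case: (chiP.2 a a0).
Qed.

(** The sum of y and its inverse is fixed by the Frobenius map, so it lies in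
    F_q. *)
Lemma reduces_psi_trace y : y != 0 -> y ^+ q = y \/ y ^+ q = y^-1 ->
  reduces_to (psi y + (psi y)^-1) (y + y^-1).
Proof.
move=> y0 yq; have yV0 : y^-1 != 0 by rewrite invr_eq0.
have rE : red (psi y + (psi y)^-1) = i2 (y + y^-1).
  rewrite -psiVy // (redD redP) ?teichmuller_red ?rmorphD //; exact: teichmuller_int.
split=> //.
have [t tE] : exists t, iF t = y + y^-1.
  apply: frobenius_fixed_image; rewrite (card_frobeniusD iF p_pr cardF) exprVn.
  by case: yq => ->; rewrite ?invrK // addrC.
have [z intz zE] : exists2 z, padic_integral iQ (iK z) & iK z = psi y + (psi y)^-1.
  pose ik : {rmorphism F -> k} := i2 \o iF.
  apply: (unity_trace_unramified closL redP char_k m_gt0 dimKm unramKm iKQ (iF := ik)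
            cardF (z := psi y) (t := t)).
    by rewrite -cardF -cardF2 subn1 (teichmuller_unity psiP).
  rewrite -psiVy // !teichmuller_red //= tE rmorphD //.
by exists z.
Qed.

Lemma sum_psi_exp j : ~~ ((q ^ 2).-1 %| j)%N -> \sum_(y | y != 0) psi y ^+ j = 0.
Proof.
move=> Nj; apply: sum_mult_char.
  by move=> x y x0 y0; rewrite psiM // exprMn.
rewrite -cardF2 in Nj; have [y y0 yj] := finfield_exp_neq1 Nj; exists y => //.
apply: contra yj => /eqP pj; rewrite -(inj_eq (fmorph_inj i2)) rmorphXn rmorph1.
by rewrite -teichmuller_red // -(redX redP) ?pj ?(red1 redP) //; apply: teichmuller_int.
Qed.

Lemma sum_psi_iF_exp j : ~~ (q.-1 %| j)%N -> \sum_(a : F | a != 0) psi (iF a) ^+ j = 0.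
Proof.
move=> Nj; apply: (@sum_mult_char F _ (fun a => psi (iF a) ^+ j)).
  by move=> x y x0 y0; rewrite rmorphM psiM ?fmorph_eq0 // exprMn.
have [y y0 yj] := finfield_exp_neq1 Nj; exists y => //.
have iy0 : iF y != 0 by rewrite fmorph_eq0.
apply: contra yj => /eqP pj; rewrite -(inj_eq (fmorph_inj iF)) -(inj_eq (fmorph_inj i2)).
rewrite !rmorphXn !rmorph1 -teichmuller_red // -(redX redP) ?pj ?(red1 redP) //.
exact: teichmuller_int.
Qed.

Lemma sum_psi_iF_expV j : ~~ (q.-1 %| j)%N -> \sum_(a : F | a != 0) psi (iF a) ^- j = 0.
Proof.
move=> Nj; rewrite -[RHS](sum_psi_iF_exp Nj) (reindex_inj (@invr_inj F)) /=.
apply: eq_big => [a|a]; rewrite invr_eq0 // => a0.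
by rewrite fmorphV psiVy ?fmorph_eq0 // exprVn invrK.
Qed.


Let charL n : (n%:R == 0 :> L) = (n == 0%N).
Proof.
rewrite -(rmorph_nat iQ) fmorph_eq0 -(rmorph_nat (tofrac (R := Zp))) tofrac_eq0.
apply/eqP/eqP => [n0|->//].
have := congr1 (fun x : Zp => padic_res x n) n0.
rewrite padic_res_nat padic_res0 modz_nat => /eqP; rewrite eqz_nat modn_small => [/eqP//|].
exact/ltn_expl/prime_gt1.
Qed.

(** The Frobenius map permutes the two eigenvalues, hence its square fixes
    them. *)
Lemma eigenvalue_quadratic (A : 'M[F]_2) : exists y, root (char_poly (map_mx iF A)) y.
Proof.
pose j : {rmorphism F -> k} := i2 \o iF.
have [z zA] : exists z, root (char_poly (map_mx j A)) z.
  by apply/closed_rootP; rewrite size_char_poly.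
have zq2 : z ^+ (q ^ 2) = z.
  rewrite expnS expn1 exprM; have [zq|zq] := eqVneq (z ^+ q) z; first by rewrite !zq.
  have [tE _] := frobenius_eigenvalues p_pr cardF zq zA.
  have := iF_frobenius j (\tr A).
  by rewrite tE (card_frobeniusD j p_pr cardF) addrC => /addIr.
have [y yz] := @frobenius_fixed_image F2 k i2 z (etrans (congr1 (fun l => z ^+ l) cardF2) zq2).
exists y; rewrite -(fmorph_root i2) map_char_poly -map_mx_comp yz.
exact: zA.
Qed.

Lemma iF_eq (y : F2) : (exists a, y = iF a) \/ (forall a, y != iF a).
Proof.
have [/existsP[a /eqP ->]|/existsPn H] := boolP [exists a, y == iF a].
  by left; exists a.
by right.
Qed.

Section Assembly.
Variables (n : nat) (rG : mx_representation L (PGL2 F) n) (r : nat).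
Hypothesis r_le : (r.*2 <= q.-1)%N.
Variables (n' e : nat) (eps : F2).

(** [sym_character] as a function of the matrix instead of its eigenvalues. *)
Definition sym_trace (A : 'M[F2]_2) : F2 :=
  \det A ^+ (q.-1 - r) * \tr (symx r.*2 A) + eps * (\det A ^+ e * \tr (symx n' A)).

Lemma sym_trace_upper (A : 'M[F2]_2) : A 1 0 = 0 ->
  sym_trace A = @sym_character F F2 r n' e eps (A 0 0) (A 1 1).
Proof.
move=> A10; rewrite /sym_trace !symx_trace_upper //.
by rewrite [A in \det A]mat2_eta det_mat2 A10 mulr0 subr0.
Qed.

Lemma sym_trace_conj (P A T : 'M[F2]_2) : P \in unitmx -> P *m A = T *m P ->
  sym_trace A = sym_trace T.
Proof.
by move=> Pu e1; rewrite /sym_trace !(symx_trace_conj _ Pu e1) (det_conj Pu e1).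
Qed.

(** Both sides are class functions, and every invertible matrix over F is
    conjugate over F to one of the three split normal forms, or over F_{q^2} to
    an upper triangular matrix with eigenvalues y and y ^ q. *)
Lemma class_traces_reduce dim un sp el :
  class_traces rG iF dim un sp el ->
  eps = 0 \/ (q.-1 %| n' + e.*2)%N ->
  reduces_to dim ((r.*2.+1)%:R + eps * (n'.+1)%:R) ->
  reduces_to un ((r.*2.+1)%:R + eps * (n'.+1)%:R) ->
  (forall a b, a != 0 -> b != 0 -> a != b ->
    reduces_to (sp (a / b)) (@sym_character F F2 r n' e eps (iF a) (iF b))) ->
  (forall y, (forall a, y != iF a) ->
    reduces_to (el y) (@sym_character F F2 r n' e eps y (y ^+ q))) ->
  forall A : 'M[F]_2, A \in unitmx -> reduces_to (\tr (rG (pgl A))) (sym_trace (map_mx iF A)).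
Proof.
move=> [Tdim Tun Tsp Tel] epsn Rdim Run Rsp Rel A Au.
have rq : (r <= q.-1)%N by rewrite (leq_trans _ r_le) // -addnn leq_addl.
have [/existsP[l lA]|/existsPn nroot] := boolP [exists l, root (char_poly A) l].
  have [P [T [Pu PA TE]]] := mat2_normal_form lA.
  have detA : \det A != 0 by rewrite -unitfE -unitmxE.
  have detT : \det T != 0 by rewrite -(det_conj Pu PA).
  have Tu : T \in unitmx by rewrite unitmxE unitfE.
  have PA2 : map_mx iF P *m map_mx iF A = map_mx iF T *m map_mx iF P.
    by rewrite -!map_mxM PA.
  rewrite (trace_pgl_conj _ Pu Au Tu PA) (sym_trace_conj _ PA2) ?map_unitmx //.
  case: TE => [||[a al]] TE; rewrite TE in detT *;
    rewrite det_mat2 mulr0 subr0 mulf_eq0 negb_or in detT; case/andP: detT => a0 l0;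
    rewrite map_mat2 sym_trace_upper ?mat2E ?rmorph0 //.
  - by rewrite Tdim // sym_character_diag // -rmorphXn finfield_expn_pred ?rmorph1.
  - by rewrite Tun // sym_character_diag // -rmorphXn finfield_expn_pred ?rmorph1.
  - by rewrite Tsp //; apply: Rsp.
pose A2 := map_mx iF A.
have [y yA] : exists y, root (char_poly A2) y := eigenvalue_quadratic A.
have ny a : y != iF a.
  by apply: contra (nroot a) => /eqP ya; move: yA; rewrite ya /A2 -map_char_poly fmorph_root.
have [P [a [b [Pu PA]]]] := eigen_mat2_conj yA.
have [trE detE] := frobenius_eigenvalues p_pr cardF (in_iF_frobenius ny) yA.
have aE : a = y ^+ q.
  have : \tr A2 = \tr (mat2 a b 0 y).
    have -> : A2 = invmx P *m (mat2 a b 0 y *m P) by rewrite -PA mulKmx.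
    by rewrite mxtrace_mulC mulmxK.
  by rewrite trace_map_mx trE trace_mat2 !mat2E addrC => /addIr.
rewrite (Tel A y) // (sym_trace_conj Pu PA) sym_trace_upper ?mat2E // aE.
have -> : @sym_character F F2 r n' e eps (y ^+ q) y = @sym_character F F2 r n' e eps y (y ^+ q).
  have csC l (c d : F2) : complete_sum l c d = complete_sum l d c.
    rewrite /complete_sum (reindex_inj rev_ord_inj) /=; apply: eq_bigr => i _.
    by rewrite subSS subKn ?leq_ord // mulrC.
  by rewrite /sym_character [y ^+ q * y]mulrC !(csC _ (y ^+ q)).
exact: Rel.
Qed.

End Assembly.


(** * Averages of the characters over the two tori *)

Section TorusSumsOfTraces.
Variables (n : nat) (rG : mx_representation L (PGL2 F) n).
Variables (dim un : L) (sp : F -> L) (el : F2 -> L).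
Hypothesis rG_traces : class_traces rG iF dim un sp el.

(** The identity is the only element of the split torus which is not of split
    type; the hypothesis corrects the value there. *)
Lemma split_torus_trace_sum : \sum_(a | a != 0) sp a + (dim - sp 1) = (q.-1)%:R ->
  \sum_(a : F | a != 0) \tr (rG (pgl (mat2 a 0 0 1))) = (q.-1)%:R.
Proof.
move: rG_traces => [Tdim _ Tsp _] <-.
rewrite [LHS](bigD1 1) ?oner_neq0 //= [in RHS](bigD1 1) ?oner_neq0 //=.
rewrite Tdim ?oner_neq0 // [RHS]addrC -addrA addKr; congr (_ + _).
by apply: eq_bigr => a /andP[a0 a1]; rewrite Tsp ?oner_neq0 // divr1.
Qed.

(** Summing the formula valid on elliptic classes over all y counts [elF]
    instead of [dim] at the q - 1 scalar matrices, which correspond to the y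
    in F. *)
Lemma nonsplit_torus_trace_sum (elF : L) (M : F2 -> 'M[F]_2) :
  (forall a, a != 0 -> el (iF a) = elF) ->
  \sum_(y | y != 0) el y + (q.-1)%:R * (dim - elF) = ((q ^ 2).-1)%:R ->
  (forall y, y != 0 -> M y \in unitmx) ->
  (forall a, M (iF a) = mat2 a 0 0 a) ->
  (forall y, (forall a, y != iF a) -> root (char_poly (map_mx iF (M y))) y) ->
  \sum_(y | y != 0) \tr (rG (pgl (M y))) = ((q ^ 2).-1)%:R.
Proof.
move: rG_traces => [Tdim _ _ Tel] elFE <- Mu MF My.
transitivity (\sum_(y | y != 0) (el y + \sum_(a : F | a != 0) (dim - elF) *+ (y == iF a))).
  apply: eq_bigr => y y0; case: (iF_eq y) => [[a ya]|ny].
    have a0 : a != 0 by rewrite -(fmorph_eq0 iF) -ya.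
    rewrite (bigD1 a) //= ya eqxx big1 ?addr0 => [|b /andP[_ ba]]; last first.
      by rewrite (inj_eq (fmorph_inj iF)) eq_sym (negbTE ba).
    by rewrite elFE // MF Tdim // addrC subrK.
  rewrite (Tel _ y) ?Mu ?My // big1 ?addr0 // => a _.
  by rewrite (negbTE (ny a)).
rewrite big_split; congr (_ + _); rewrite exchange_big /=.
rewrite (eq_bigr (fun=> dim - elF)) => [|a a0].
  by rewrite sumr_const cardC1 mulr_natl.
rewrite (bigD1 (iF a)) ?fmorph_eq0 //= eqxx big1 ?addr0 // => y /andP[_ ya].
by rewrite (negbTE ya).
Qed.

End TorusSumsOfTraces.

(** The trace [psi w + (psi w)^-1] is twice [psi w] and 2 is invertible
    modulo p. *)
Lemma reduces_psi_sign w : w ^+ 2 = 1 -> reduces_to (psi w) w.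
Proof.
move=> w2; have w0 : w != 0.
  by apply/eqP => w0; move/eqP: w2; rewrite w0 expr0n eq_sym oner_eq0.
have wV : w^-1 = w by apply: (mulfI w0); rewrite divff // -expr2 w2.
have wq : w ^+ q = w.
  by rewrite -(odd_double_half q) q_odd exprD expr1 -mul2n exprM w2 expr1n mulr1.
have := reduces_psi_trace w0 (or_introl wq).
rewrite -psiVy // wV -!mulr2n => H2.
have cop2 : coprime 2 p by rewrite coprime2n.
have := reducesM (reduces_natV cop2) H2.
have two0 : 2 != 0 :> L by rewrite charL.
have two2 : 2 != 0 :> F2.
  have /eqP := (reduces_natV cop2).2; have := reducesM (reduces_nat 2) (reduces_natV cop2).
  rewrite divff // => -[_ +] _; rewrite (red1 redP) => e1; apply/eqP => e2.
  by move/eqP: e1; rewrite e2 mul0r rmorph0 oner_eq0.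
by rewrite -(mulr_natl (psi w)) -(mulr_natl w) !mulKf.
Qed.

(** What the proof uses of each of the parametrized representations: modulo p
    its character is that of a symmetric power of degree 2r plus a multiple of
    that of a twisted symmetric power in which the split torus fixes no vector, and its
    averages over the two tori are 1, the torus which is not split being given
    by any family of matrices M y with eigenvalue y. *)
Definition torus_multiplicity_free n (rG : mx_representation L (PGL2 F) n) r :=
  (r.*2 <= q.-1)%N /\ exists n' e (eps : F2),
    [/\ forall i, (i <= n')%N -> ~~ (q.-1 %| i + e)%N,
        forall A : 'M[F]_2, A \in unitmx ->
          reduces_to (\tr (rG (pgl A))) (sym_trace r n' e eps (map_mx iF A)),
        \sum_(a : F | a != 0) \tr (rG (pgl (mat2 a 0 0 1))) = (q.-1)%:R
      & forall M : F2 -> 'M[F]_2, (forall y, y != 0 -> M y \in unitmx) ->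
          (forall a, M (iF a) = mat2 a 0 0 a) ->
          (forall y, (forall a, y != iF a) -> root (char_poly (map_mx iF (M y))) y) ->
          \sum_(y | y != 0) \tr (rG (pgl (M y))) = ((q ^ 2).-1)%:R].

Let natr_pred (N : nat) : (0 < N)%N -> (N.-1)%:R = N%:R - 1 :> L.
Proof. by move=> N0; rewrite -[in RHS](prednK N0) -natr1 addrK. Qed.

Let natr_q2 : ((q ^ 2).-1)%:R = (q.-1)%:R * (q%:R + 1) :> L.
Proof. by rewrite q2E natrM natrD. Qed.

Let q_gt0 : (0 < q)%N := ltnW q_gt1.

Let sub_iF_neq0 (a b : F) : a != b -> iF a - iF b != 0.
Proof. by rewrite subr_eq0 (inj_eq (fmorph_inj iF)). Qed.

Let frob2 (y : F2) : (y ^+ q) ^+ q = y.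
Proof. by rewrite -exprM mulnn -cardF2 expf_card. Qed.

Let nF_neq0 (y : F2) : (forall a, y != iF a) -> y != 0.
Proof. by move=> /(_ 0); rewrite rmorph0. Qed.

Let nF_sub (y : F2) : (forall a, y != iF a) -> y - y ^+ q != 0.
Proof. by move=> ny; rewrite subr_eq0 eq_sym; apply: in_iF_frobenius ny. Qed.

(** The second symmetric power is [Sym^(q - 1 - 2r) (x) det^r], with weights
    from r to q - 1 - r.  The dimensions [2r + 1] and [q - 2r] add up to
    [q + 1]. *)
Lemma principal_series_torus n (rG : mx_representation L (PGL2 F) n) r :
  (1 <= r <= (q - 3)./2)%N ->
  is_principal_series rG (fun a => chi a ^+ r) (fun a => chi a ^- r) ->
  torus_multiplicity_free rG r.
Proof.
move=> /andP[r1 rq] PS.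
have rq3 : (r.*2 <= q - 3)%N by move: rq; move: q => N; lia.
have TC := principal_series_traces charL psi1 psiM teichmuller_restrict PS.
have Nr : ~~ (q.-1 %| r)%N by rewrite gtnNdvd //; move: rq3; move: q => N; lia.
split; first by move: rq3 q_gt2; move: q => N; lia.
exists (q.-1 - r.*2)%N, r, 1; split.
- by move=> i ile; rewrite gtnNdvd //; move: rq3 q_gt2 ile r1; move: q => N; lia.
- have dimE : (r.*2.+1)%:R + 1 * ((q.-1 - r.*2).+1)%:R = (q.+1)%:R :> F2.
    by rewrite mul1r -natrD; congr _%:R; move: rq3 q_gt2; move: q => N; lia.
  apply: (class_traces_reduce _ TC) => //.
  + by move: rq3 q_gt2; move: q => N; lia.
  + by right; rewrite (_ : _ + _ = q.-1)%N //; move: rq3 q_gt2; move: q => N; lia.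
  + by rewrite dimE; apply: reduces_nat.
  + by rewrite dimE -natr1 q_F2 add0r; apply: (reduces_nat 1).
  + move=> a b a0 b0 ab; set z := iF (a / b).
    have ia0 : iF a != 0 by rewrite fmorph_eq0.
    have ib0 : iF b != 0 by rewrite fmorph_eq0.
    have z0 : z != 0 by rewrite fmorph_eq0 mulf_neq0 ?invr_eq0.
    have zr0 : z ^+ r != 0 by rewrite expf_neq0.
    have zq : (z ^+ r) ^+ q = z ^+ r by rewrite exprAC iF_frobenius.
    have := reduces_psi_trace zr0 (or_introl zq).
    rewrite psiXj //; congr (reduces_to _ _).
    apply: (mulfI (sub_iF_neq0 ab)).
    rewrite (sym_character_ps ia0 ib0 (iF_frobenius _ a) (iF_frobenius _ b)) //; last first.
      by move: rq3 q_gt2; move: q => N; lia.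
    rewrite /z fmorph_div -exprVn invf_div; ring.
  + move=> y ny; have y0 := nF_neq0 ny; have yq0 := expf_neq0 q y0.
    have := reduces_nat 0; congr (reduces_to _ _); apply: (mulfI (nF_sub ny)).
    rewrite (sym_character_ps y0 yq0 erefl (frob2 y)) //.
    * by ring.
    * by move: rq3 q_gt2; move: q => N; lia.
    * by rewrite mulrC.
- apply: (split_torus_trace_sum TC).
  rewrite big_split /= sum_psi_iF_exp // sum_psi_iF_expV // rmorph1 psi1.
  by rewrite expr1n invr1 natr_pred // -natr1; ring.
- move=> M; apply: (nonsplit_torus_trace_sum TC (elF := 0)) => //.
  by rewrite big1 // add0r subr0 natr_q2 natr1.
Qed.

(** The second symmetric power is [Sym^(q - 3 - 2r) (x) det^(r + 1)], with
    weights from r + 1 to q - 2 - r.  The dimensions [2r + 1] and [q - 2 - 2r]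
    add up to [q - 1]. *)
Lemma cuspidal_torus n (rG : mx_representation L (PGL2 F) n) r :
  (r <= (q - 3)./2)%N ->
  is_cuspidal iF rG (fun y => psi y ^+ ((q - 1) * (r + 1))) ->
  torus_multiplicity_free rG r.
Proof.
move=> rq cusp.
have rq3 : (r.*2 <= q - 3)%N by move: rq; move: q => N; lia.
have TC := cuspidal_traces psi1 psiM teichmuller_restrict cusp.
split; first by move: rq3 q_gt2; move: q => N; lia.
set N := ((q - 1) * (r + 1))%N in TC *.
have vN (y : F2) : y != 0 -> y ^+ N ^+ q = (y ^+ N)^-1.
  move=> y0; apply: (mulIf (expf_neq0 N y0)); rewrite mulVf ?expf_neq0 //.
  rewrite -exprSr -exprM /N -mulnA [((r + 1) * _)%N]mulnC mulnA subn1 -addn1 -q2E.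
  by rewrite exprM -cardF2 finfield_expn_pred // expr1n.
have psiN (a : F) : a != 0 -> psi (iF a) ^+ N = 1.
  move=> a0; rewrite -teichmuller_restrict // exprM subn1.
  by rewrite (teichmuller_unity chiP a0) expr1n.
exists (q.-1 - r.*2.+2)%N, r.+1, 1; split.
- by move=> i ile; rewrite gtnNdvd //; move: rq3 q_gt2 ile; move: q => K; lia.
- have dimE : (r.*2.+1)%:R + 1 * ((q.-1 - r.*2.+2).+1)%:R = (q - 1)%:R :> F2.
    by rewrite mul1r -natrD; congr _%:R; move: rq3 q_gt2; move: q => K; lia.
  apply: (class_traces_reduce _ TC) => //.
  + by move: rq3 q_gt2; move: q => K; lia.
  + by right; rewrite (_ : _ + _ = q.-1)%N //; move: rq3 q_gt2; move: q => K; lia.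
  + by rewrite dimE; apply: reduces_nat.
  + rewrite dimE natrB ?q_F2 ?sub0r //; exact/reducesN/(reduces_nat 1).
  + move=> a b a0 b0 ab; have := reduces_nat 0; congr (reduces_to _ _).
    have ia0 : iF a != 0 by rewrite fmorph_eq0.
    have ib0 : iF b != 0 by rewrite fmorph_eq0.
    apply: (mulfI (sub_iF_neq0 ab)).
    rewrite (sym_character_cusp ia0 ib0 (iF_frobenius _ a) (iF_frobenius _ b)) //.
      by rewrite !divff //; ring.
    by move: rq3 q_gt2; move: q => K; lia.
  + move=> y ny; have y0 := nF_neq0 ny; have yq0 := expf_neq0 q y0.
    have v0 := expf_neq0 N y0.
    have := reducesN (reduces_psi_trace v0 (or_intror (vN y y0))).
    rewrite -psiVy // -vN // exprAC !psiXj //; congr (reduces_to _ _).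
    have vE : y ^+ N = (y ^+ q / y) ^+ r.+1.
      rewrite /N exprM addn1; congr (_ ^+ _).
      by apply: (mulIf y0); rewrite divfK // -exprSr subn1 prednK.
    have vVE : (y ^+ q) ^+ N = (y / y ^+ q) ^+ r.+1.
      by rewrite exprAC vN // vE -exprVn invf_div.
    apply: (mulfI (nF_sub ny)); rewrite vE vVE.
    rewrite (sym_character_cusp y0 yq0 erefl (frob2 y)) //.
    * by rewrite !exprS; field; rewrite y0 yq0.
    * by move: rq3 q_gt2; move: q => K; lia.
    * by rewrite mulrC.
- apply: (split_torus_trace_sum TC).
  by rewrite big1 // add0r subr0 subn1.
- move=> M; apply: (nonsplit_torus_trace_sum TC (elF := - 2)).
    by move=> a a0; rewrite iF_frobenius psiN.
  have NN : ~~ ((q ^ 2).-1 %| N)%N.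
    rewrite q2E /N subn1 dvdn_pmul2l; last by move: q_gt1; move: q => K; lia.
    by rewrite gtnNdvd //; move: rq3 q_gt2; move: q => K; lia.
  rewrite sumrN big_split /= sum_psi_exp // add0r.
  rewrite (eq_bigr (fun y => psi y ^+ (q * N))) => [|y y0].
    rewrite sum_psi_exp ?oppr0 ?add0r; last first.
      by rewrite Gauss_dvdr // coprime_sym -(coprime_pexpl (k := 2)) // coprimenP // expn_gt0 q_gt0.
    by rewrite natr_q2 opprK natrB //; ring.
  by rewrite psiXj // -exprM.
Qed.

(** The first symmetric power, of dimension q, is the whole reduction. *)
Lemma Steinberg_torus n (rG : mx_representation L (PGL2 F) n) r :
  r = ((q - 1)./2)%N ->
  is_Steinberg_twist rG (fun g => chi (\det (GLval g)) ^+ (q - 1)./2) ->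
  torus_multiplicity_free rG r.
Proof.
move=> rE St.
have r2 : (r * 2 = q.-1)%N by rewrite rE halfq.
have TC := Steinberg_traces p_pr cardF charL psi1 psiM teichmuller_restrict q_odd St.
rewrite -rE in TC.
split; first by rewrite -muln2 r2.
have aq (a : F) : a != 0 -> iF a ^+ q.-1 = 1.
  by move=> a0; rewrite -rmorphXn finfield_expn_pred // rmorph1.
exists 0%N, 1%N, 0; split.
- by move=> i; rewrite leqn0 => /eqP ->; rewrite gtnNdvd //; move: q_gt2; move: q => N; lia.
- have dimE : (r.*2.+1)%:R + 0 * 1%:R = q%:R :> F2.
    by rewrite mul0r addr0 -muln2 r2 prednK.
  apply: (class_traces_reduce _ TC) => //.
  + by rewrite -muln2 r2.
  + by left.
  + by rewrite dimE; apply: reduces_nat.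
  + by rewrite dimE q_F2; apply: (reduces_nat 0).
  + move=> a b a0 b0 ab; set z := iF (a / b).
    have ia0 : iF a != 0 by rewrite fmorph_eq0.
    have ib0 : iF b != 0 by rewrite fmorph_eq0.
    have z0 : z != 0 by rewrite fmorph_eq0 mulf_neq0 ?invr_eq0.
    have z2 : (z ^+ r) ^+ 2 = 1 by rewrite -exprM r2 aq // mulf_neq0 ?invr_eq0.
    have := reduces_psi_sign z2; rewrite psiXj //; congr (reduces_to _ _).
    apply: (mulfI (sub_iF_neq0 ab)); rewrite mulrC.
    rewrite (sym_character_St (iF_frobenius _ a) (iF_frobenius _ b)) -?muln2 ?r2 //.
    congr (_ * _); rewrite /z fmorph_div expr_div_n exprMn; congr (_ * _).
    apply: (mulIf (expf_neq0 r ib0)); rewrite mulVf ?expf_neq0 //.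
    by rewrite -exprD addnn -muln2 r2 aq.
  + move=> y ny; have y0 := nF_neq0 ny.
    have w2 : (y ^+ ((q + 1) * r)) ^+ 2 = 1.
      by rewrite -exprM -mulnA r2 mulnC -q2E -cardF2 finfield_expn_pred.
    have := reducesN (reduces_psi_sign w2); rewrite psiXj //; congr (reduces_to _ _).
    apply: (mulfI (nF_sub ny)).
    rewrite (sym_character_St erefl (frob2 y)) -?muln2 ?r2 //.
    by rewrite exprM addn1 exprSr [y ^+ q * y]mulrC; ring.
- apply: (split_torus_trace_sum TC).
  rewrite sum_psi_iF_exp ?rmorph1 ?psi1 ?expr1n ?add0r ?natr_pred //.
  by rewrite gtnNdvd //; move: r2 q_gt2; move: q => N; lia.
- move=> M; apply: (nonsplit_torus_trace_sum TC (elF := -1)).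
    move=> a a0; rewrite -teichmuller_restrict //; congr (- _).
    rewrite -[q in (q + 1)%N](odd_double_half q) q_odd addnAC -muln2 -{1}[(1 + 1)%N]mul1n.
    rewrite -mulnDl -mulnA [(2 * r)%N]mulnC r2 mulnC exprM (teichmuller_unity chiP a0).
    by rewrite expr1n.
  rewrite sumrN sum_psi_exp ?oppr0 ?add0r ?natr_q2 ?opprK //.
  rewrite q2E mulnC dvdn_pmul2l ?addn1 //.
  by rewrite gtnNdvd //; move: r2 q_gt2; move: q => N; lia.
Qed.

Lemma trivial_torus n (rG : mx_representation L (PGL2 F) n) :
  is_trivial_rep rG -> torus_multiplicity_free rG 0.
Proof.
move=> triv; have TC := trivial_traces iF triv.
split=> //; exists 0%N, 1%N, 0; split.
- by move=> i; rewrite leqn0 => /eqP ->; rewrite gtnNdvd //; move: q_gt2; move: q => N; lia.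
- have symE (a b : F2) : (a * b) ^+ q.-1 = 1 -> @sym_character F F2 0 0 1 0 a b = 1.
    rewrite /sym_character mul0r addr0 subn0 => ->.
    by rewrite /complete_sum big_ord1 !expr0 !mulr1.
  apply: (class_traces_reduce _ TC) => //.
  + by left.
  + by rewrite mul0r addr0; apply: (reduces_nat 1).
  + by rewrite mul0r addr0; apply: (reduces_nat 1).
  + move=> a b a0 b0 ab; rewrite symE; first exact: (reduces_nat 1).
    by rewrite -rmorphM -rmorphXn finfield_expn_pred ?rmorph1 // mulf_neq0.
  + move=> y ny; rewrite symE; first exact: (reduces_nat 1).
    by rewrite -exprS -exprM mulnC -addn1 -q2E -cardF2 finfield_expn_pred // nF_neq0.
- apply: (split_torus_trace_sum TC).
  by rewrite sumr_const cardC1 subrr addr0.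
- move=> M; apply: (nonsplit_torus_trace_sum TC (elF := 1)) => //.
  by rewrite sumr_const cardC1 subrr mulr0 addr0 cardF2.
Qed.

Lemma is_pi_torus n (rG : mx_representation L (PGL2 F) n) r :
  is_pi iF rG chi psi r -> torus_multiplicity_free rG r.
Proof.
case=> [rq|rq|rE|->].
- exact: principal_series_torus.
- exact: cuspidal_torus.
- exact: Steinberg_torus.
- exact: trivial_torus.
Qed.

End TorusCharacters.

(** * The correlation coefficient as a trace *)

Section RankOne.
Variable K : fieldType.
Hypothesis charK : forall n, (n%:R == 0 :> K) = (n == 0%N).

(** The trace of an idempotent is its rank. *)
Lemma idempotent_rank1 n (e : 'M[K]_n) : e *m e = e -> \tr e = 1 ->
  exists (c : 'cV_n) (l : 'rV_n), e = c *m l.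
Proof.
move=> ee tr1; have eE := mulmx_base e.
have RL : row_base e *m col_base e = 1%:M.
  apply: (row_free_inj (row_base_free e)); apply: (row_full_inj (col_base_full e)).
  rewrite mul1mx; set A := col_base e in eE *; set B := row_base e in eE *.
  by have -> : A *m (B *m A *m B) = (A *m B) *m (A *m B) by [rewrite !mulmxA]; rewrite eE ee.
have r1 : \rank e = 1%N.
  have : (\rank e)%:R = 1 :> K.
    by have := congr1 mxtrace eE; rewrite mxtrace_mulC RL mxtrace1 tr1.
  move/eqP; rewrite -subr_eq0; case: (\rank e) => [|[|r]] //.
    by rewrite sub0r oppr_eq0 oner_eq0.
  by rewrite -natr1 addrK charK.
move: (col_base e) (row_base e) eE; rewrite r1 => c l <-; by exists c, l.
Qed.

End RankOne.

Section InvariantForm.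
Variables (C : numClosedFieldType) (gT : finGroupType) (G : {group gT}) (n : nat).
Variable rG : mx_representation C G n.

(** The standard inner product averaged over the group: the invariant inner
    product that the definition of the correlation coefficient asks for. *)
Definition average_form (u v : 'cV[C]_n) : C :=
  \sum_(g in G) \sum_i (rG g *m u) i 0 * Num.conj ((rG g *m v) i 0).

Fact average_form_bilinear :
  bilinear_for (GRing.Scale.Law.clone _ _ *%R _)
    (GRing.Scale.Law.clone _ _ (Num.conj \; *%R) _) average_form.
Proof.
split=> [w|w] a u v /=; rewrite /average_form mulr_sumr -big_split;
  apply: eq_bigr => g _; rewrite mulr_sumr -big_split; apply: eq_bigr => i _ /=;
  rewrite mulmxDr -scalemxAr !mxE.
  by rewrite mulrDl mulrA.
by rewrite rmorphD rmorphM mulrDr mulrCA.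
Qed.

HB.instance Definition _ := bilinear_isBilinear.Build C 'cV[C]_n 'cV[C]_n C
  _ _ average_form average_form_bilinear.

Fact average_form_hermitian u v :
  average_form u v = (-1) ^+ false * Num.conj (average_form v u).
Proof.
rewrite expr0 mul1r rmorph_sum; apply: eq_bigr => g _.
by rewrite rmorph_sum; apply: eq_bigr => i _; rewrite rmorphM /= conjCK mulrC.
Qed.

HB.instance Definition _ := isHermitianSesquilinear.Build C 'cV[C]_n
  false Num.conj average_form average_form_hermitian.

Fact average_form_gt0 u : u != 0 -> 0 < average_form u u.
Proof.
move=> u0; rewrite lt_def; have term_ge0 g i :
    0 <= (rG g *m u) i 0 * Num.conj ((rG g *m u) i 0) by rewrite mul_conjC_ge0.
have sum_ge0 g : 0 <= \sum_i (rG g *m u) i 0 * Num.conj ((rG g *m u) i 0).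
  by apply: sumr_ge0.
rewrite sumr_ge0 ?andbT => [|g _]; last exact: sum_ge0.
apply: contra u0; rewrite psumr_eq0 => [|g _]; last exact: sum_ge0.
move=> /allP/(_ 1%g (mem_index_enum _)); rewrite group1 /= psumr_eq0 // => /allP u0.
apply/eqP/colP => i; have := u0 i (mem_index_enum _).
by rewrite repr_mx1 mul1mx mul_conjC_eq0 mxE => /eqP.
Qed.

HB.instance Definition _ := isDotProduct.Build C 'cV[C]_n average_form
  average_form_gt0.

Lemma average_form_invariant g u v : g \in G ->
  average_form (rG g *m u) (rG g *m v) = average_form u v.
Proof.
move=> Gg; rewrite /average_form [RHS](reindex_inj (mulIg g)) /=.
apply: eq_big => [h|h Gh]; first by rewrite groupMr.
by apply: eq_bigr => i _; rewrite !mulmxA repr_mxM // -mulmxA.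
Qed.

End InvariantForm.

(** The projection onto the fixed vectors of a torus parametrized by the
    multiplicative group of a finite field.  The parametrization may repeat each
    element of the torus equally often, as it does when a non-split torus is
    parametrized by the quadratic extension. *)
Section TorusProjector.
Variables (K : fieldType) (gT : finGroupType) (G : {group gT}) (n : nat).
Variable rG : mx_representation K G n.
Variables (E : finFieldType) (h : E -> gT).
Hypothesis hG : forall x, x != 0 -> h x \in G.
Hypothesis hM : forall x y, x != 0 -> y != 0 -> h (x * y) = (h x * h y)%g.
Hypothesis cardE : (#|E|.-1)%:R != 0 :> K.

Definition torus_projector : 'M[K]_n :=
  (#|E|.-1)%:R^-1 *: \sum_(x : E | x != 0) rG (h x).

Lemma torus_projector_fixed (v : 'cV_n) :
  (forall x, x != 0 -> rG (h x) *m v = v) -> torus_projector *m v = v.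
Proof.
move=> fv; rewrite -scalemxAl mulmx_suml (eq_bigr (fun=> v)) //.
by rewrite sumr_const cardC1 -scaler_nat scalerA mulVf // scale1r.
Qed.

Lemma torus_mul_projector x : x != 0 -> rG (h x) *m torus_projector = torus_projector.
Proof.
move=> x0; rewrite -scalemxAr; congr (_ *: _); rewrite mulmx_sumr.
rewrite [RHS](reindex_inj (mulfI x0)) /=.
apply: eq_big => [y|y y0]; first by rewrite mulf_eq0 (negbTE x0).
by rewrite hM // repr_mxM ?hG.
Qed.

Lemma torus_projector_idem : torus_projector *m torus_projector = torus_projector.
Proof.
rewrite {1}/torus_projector -scalemxAl mulmx_suml.
rewrite (eq_bigr (fun=> torus_projector)) => [|x x0]; last exact: torus_mul_projector.
by rewrite sumr_const cardC1 -scaler_nat scalerA mulVf // scale1r.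
Qed.

Lemma torus_hV x : x != 0 -> h x^-1 = (h x)^-1%g.
Proof.
move=> x0; have h1 : h 1 = 1%g.
  by apply: (mulgI (h 1)); rewrite -hM ?oner_neq0 // mulr1 mulg1.
by apply: (mulgI (h x)); rewrite -hM ?invr_eq0 // divff // h1 mulgV.
Qed.

End TorusProjector.

Section CorrelationTrace.
Variables (R : realType) (gT : finGroupType) (G : {group gT}) (n : nat).
Local Notation C := R[i].
Variable rG : mx_representation C G n.

Let charC N : (N%:R == 0 :> C) = (N == 0%N). Proof. exact: pnatr_eq0. Qed.

(** The adjoint of a unitary operator is its inverse, and the torus is stable
    under inversion. *)
Lemma torus_projector_adjoint (E : finFieldType) (h : E -> gT)
    (f : {dot 'cV[C]_n for Num.conj}) :
  (forall x, x != 0 -> h x \in G) ->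
  (forall x y, x != 0 -> y != 0 -> h (x * y) = (h x * h y)%g) ->
  invariant_dot rG f -> forall u v,
  f (torus_projector rG h *m u) v = f u (torus_projector rG h *m v).
Proof.
move=> hG hM finv u v; rewrite -!scalemxAl !mulmx_suml linearZl_LR linearZr_LR /=.
rewrite conj_Creal ?rpredV ?realn //; congr (_ * _).
rewrite linear_sumlz linear_sumr [RHS](reindex_inj invr_inj) /=.
apply: eq_big => [x|x x0]; first by rewrite invr_eq0.
rewrite -(finv (h x) (hG x x0) u) mulmxA (torus_hV hM) // repr_mxV ?hG //.
by rewrite mulmxV ?mul1mx // repr_mx_unit ?hG.
Qed.

(** A self-adjoint idempotent of rank one is the orthogonal projection onto the
    line of its unit fixed vector. *)
Lemma rank1_projection (f : {dot 'cV[C]_n for Num.conj}) (e : 'M[C]_n) (v : 'cV_n) :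
  e *m e = e -> \tr e = 1 -> (forall u w, f (e *m u) w = f u (e *m w)) ->
  e *m v = v -> f v v = 1 -> forall u, e *m u = f u v *: v.
Proof.
move=> ee tre adj ev fvv u.
have [c [l eE]] := idempotent_rank1 charC ee tre.
have scal (w : 'cV_n) : e *m w = (l *m w) 0 0 *: c.
  by rewrite eE -mulmxA [l *m w]mx11_scalar mul_mx_scalar -mx11_scalar.
have lv0 : (l *m v) 0 0 != 0.
  apply: contra_eq_neq fvv => lv0; rewrite -ev scal lv0 scale0r.
  by rewrite linear0r eq_sym oner_eq0.
have cE : c = ((l *m v) 0 0)^-1 *: v.
  by apply: (scalerI lv0); rewrite scalerA divff // scale1r -scal ev.
have [a aE] : exists a, e *m u = a *: v.
  by exists ((l *m u) 0 0 * ((l *m v) 0 0)^-1); rewrite scal {1}cE scalerA.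
have -> : f u v = f (e *m u) v by rewrite adj ev.
by rewrite aE linearZl_LR /= fvv mulr1.
Qed.

Lemma dot_conj (f : {dot 'cV[C]_n for Num.conj}) u v : f u v = Num.conj (f v u).
Proof. by rewrite [LHS](@hermitian_subproof _ _ false Num.conj f u v) expr0 mul1r. Qed.

Variables (E1 E2 : finFieldType) (h1 : E1 -> gT) (h2 : E2 -> gT) (A B : {set gT}).
Hypothesis h1G : forall x, x != 0 -> h1 x \in G.
Hypothesis h2G : forall x, x != 0 -> h2 x \in G.
Hypothesis h1M : forall x y, x != 0 -> y != 0 -> h1 (x * y) = (h1 x * h1 y)%g.
Hypothesis h2M : forall x y, x != 0 -> y != 0 -> h2 (x * y) = (h2 x * h2 y)%g.
Hypothesis fixA : forall v, fixed_by rG A v <-> forall x, x != 0 -> rG (h1 x) *m v = v.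
Hypothesis fixB : forall v, fixed_by rG B v <-> forall x, x != 0 -> rG (h2 x) *m v = v.
Let eA := torus_projector rG h1.
Let eB := torus_projector rG h2.
Hypotheses (trA : \tr eA = 1) (trB : \tr eB = 1).

Let card_neq0 (E : finFieldType) : (#|E|.-1)%:R != 0 :> C.
Proof. by rewrite charC; have := finNzRing_gt1 E; case: #|E| => [|[]]. Qed.

Let idemA : eA *m eA = eA. Proof. exact: torus_projector_idem. Qed.
Let idemB : eB *m eB = eB. Proof. exact: torus_projector_idem. Qed.

Let correlation_value (f : {dot 'cV[C]_n for Num.conj}) vA vB :
  invariant_dot rG f -> fixed_by rG A vA -> f vA vA = 1 ->
  fixed_by rG B vB -> f vB vB = 1 -> `|f vA vB| ^+ 2 = \tr (eA *m eB).
Proof.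
move=> finv /fixA fA nA /fixB fB nB.
have projA := rank1_projection idemA trA (torus_projector_adjoint h1G h1M finv)
  (torus_projector_fixed (card_neq0 _) fA) nA.
have projB := rank1_projection idemB trB (torus_projector_adjoint h2G h2M finv)
  (torus_projector_fixed (card_neq0 _) fB) nB.
rewrite normCK -dot_conj.
transitivity (\sum_j f (delta_mx j 0) vB * f vB vA * vA j 0).
  rewrite {1}[vA]matrix_sum_delta.
  rewrite (eq_bigr (fun j => vA j 0 *: delta_mx j 0)) => [|j _]; last by rewrite big_ord1.
  rewrite linear_sumlz mulr_suml; apply: eq_bigr => j _.
  by rewrite linearZl_LR /=; ring.
apply: eq_bigr => j _.
have -> : (eA *m eB) j j = (eA *m (eB *m (delta_mx j 0 : 'cV_n))) j 0.
  by rewrite mulmxA -colE [RHS]mxE.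
by rewrite projB -scalemxAr projA scalerA [RHS]mxE.
Qed.

(* The generator of the image has norm 1 after division by the square root of
   its positive norm. *)
Let unit_fixed (f : {dot 'cV[C]_n for Num.conj}) (e : 'M[C]_n) : e *m e = e -> \tr e = 1 ->
  exists v, e *m v = v /\ f v v = 1.
Proof.
move=> ee tre; have [c [l eE]] := idempotent_rank1 charC ee tre.
have scal (w : 'cV_n) : e *m w = (l *m w) 0 0 *: c.
  by rewrite eE -mulmxA [l *m w]mx11_scalar mul_mx_scalar -mx11_scalar.
have lc : (l *m c) 0 0 = 1 by rewrite -tre eE mxtrace_mulC /mxtrace big_ord1.
have c0 : c != 0.
  by apply: contra_eq_neq lc => ->; rewrite mulmx0 mxE eq_sym oner_eq0.
have fcc : 0 < f c c := @neq0_dnorm_gt0 _ _ Num.conj f c c0; set t := sqrtC (f c c).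
have t0 : 0 < t by rewrite sqrtC_gt0.
exists (t^-1 *: c); split; first by rewrite -scalemxAr scal lc scale1r.
rewrite linearZl_LR linearZr_LR /= conj_Creal ?rpredV ?gtr0_real //.
by rewrite -[f c c]sqrtCK -/t expr2 mulKf ?mulVf // gt_eqF.
Qed.

(** For unit fixed vectors [vA] and [vB], [eA *m eB] maps w to the multiple
    [f w vB * f vB vA] of [vA], so its trace is [`|f vA vB| ^+ 2].  The value is
    thus the same for all the choices, and a choice exists by [average_form]. *)
Lemma correlation_trace : correlation rG A B = \tr (eA *m eB).
Proof.
rewrite /correlation; case: xgetP => [c ->|none].
  by case=> f [vA [vB [finv [fA nA] [fB nB] ->]]]; apply: correlation_value finv _ _ _ _.
pose f : {dot 'cV[C]_n for Num.conj} := average_form rG.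
have finv : invariant_dot rG f by move=> g Gg v w; apply: average_form_invariant.
have [vA [eAv nA]] := unit_fixed f idemA trA.
have [vB [eBv nB]] := unit_fixed f idemB trB.
have fA : fixed_by rG A vA.
  by apply/fixA => x x0; rewrite -eAv mulmxA torus_mul_projector.
have fB : fixed_by rG B vB.
  by apply/fixB => x x0; rewrite -eBv mulmxA torus_mul_projector.
by case: (none (`|f vA vB| ^+ 2)); exists f, vA, vB.
Qed.

End CorrelationTrace.

(** * The non-split torus as the multiplicative group of the quadratic extension *)

Section NonsplitTorus.
Variables (F F2 : finFieldType) (iF : {rmorphism F -> F2}).
Hypothesis cardF2 : #|F2| = (#|F| ^ 2)%N.
Variables (p m : nat) (p_pr : prime p).
Hypothesis cardF : #|F| = (p ^ m)%N.
Variables (alpha u : F) (s : F2).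
Hypothesis alpha_nsq : forall b : F, alpha != b ^+ 2.
Hypothesis s2 : s ^+ 2 = iF alpha.
Local Notation q := #|F|.

Lemma sqrt_notin_F (a : F) : s != iF a.
Proof.
apply/eqP => sa; have := alpha_nsq a; rewrite -(inj_eq (fmorph_inj iF)).
by rewrite -s2 sa rmorphXn eqxx.
Qed.

(** The other square root of alpha is the conjugate of s over F. *)
Lemma sqrt_frobenius : s ^+ q = - s.
Proof.
have : (s ^+ q - s) * (s ^+ q + s) = 0.
  by rewrite -subr_sqr -exprM mulnC exprM s2 iF_frobenius subrr.
move/eqP; rewrite mulf_eq0 subr_eq0 addr_eq0 => /orP[/eqP sq|/eqP //].
by have := in_iF_frobenius sqrt_notin_F; rewrite sq eqxx.
Qed.

Lemma quadratic_coord_inj a b a' b' :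
  iF a + iF b * s = iF a' + iF b' * s -> a = a' /\ b = b'.
Proof.
move=> e; have [bb|bb] := eqVneq b b'.
  by split=> //; move: e; rewrite bb => /addIr/fmorph_inj.
have /eqP[] := sqrt_notin_F ((a' - a) / (b - b')).
have b0 : iF b - iF b' != 0 by rewrite subr_eq0 (inj_eq (fmorph_inj iF)).
rewrite fmorph_div !rmorphB; apply: (mulfI b0); rewrite mulrCA divff // mulr1.
apply/eqP; rewrite -subr_eq0; apply/eqP.
transitivity ((iF a + iF b * s) - (iF a' + iF b' * s)); first by ring.
by rewrite e subrr.
Qed.

Lemma quadratic_coord (y : F2) : exists ab : F * F, y = iF ab.1 + iF ab.2 * s.
Proof.
pose f (ab : F * F) := iF ab.1 + iF ab.2 * s.
have f_inj : injective f.
  by case=> a b [a' b'] /quadratic_coord_inj[/= -> ->].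
have : y \in codom f by apply: (inj_card_onto f_inj); rewrite card_prod cardF2 mulnn.
by case/codomP => ab ->; exists ab.
Qed.

Definition coord1 y := (projT1 (cid (quadratic_coord y))).1.
Definition coord2 y := (projT1 (cid (quadratic_coord y))).2.

Lemma coordE y : y = iF (coord1 y) + iF (coord2 y) * s.
Proof. exact: projT2 (cid (quadratic_coord y)). Qed.

Lemma coord_unique y a b : y = iF a + iF b * s -> coord1 y = a /\ coord2 y = b.
Proof. by move=> e; apply: quadratic_coord_inj; rewrite -coordE. Qed.

(** Multiplication by [y = a + b * s] on the plane F2 over F, in the basis (1, s)
    conjugated by the unipotent matrix of u. *)
Definition nonsplit_mx y : 'M[F]_2 := mat2 (coord1 y + u * coord2 y)
  ((alpha - u ^+ 2) * coord2 y) (coord2 y) (coord1 y - u * coord2 y).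

Lemma nonsplit_mxE y a b : y = iF a + iF b * s ->
  nonsplit_mx y = mat2 (a + u * b) ((alpha - u ^+ 2) * b) b (a - u * b).
Proof. by move=> /coord_unique[<- <-]. Qed.

Lemma nonsplit_mxM x y : nonsplit_mx (x * y) = nonsplit_mx x *m nonsplit_mx y.
Proof.
have xE := coordE x; have yE := coordE y.
rewrite (@nonsplit_mxE _ (coord1 x * coord1 y + alpha * (coord2 x * coord2 y))
  (coord1 x * coord2 y + coord2 x * coord1 y)); last first.
  by rewrite {1}xE {1}yE !rmorphD !rmorphM -s2; ring.
by rewrite mul_mat2; congr mat2; ring.
Qed.

Lemma nonsplit_mx_scalar a : nonsplit_mx (iF a) = mat2 a 0 0 a.
Proof.
rewrite (@nonsplit_mxE _ a 0); first by rewrite !mulr0 addr0 subr0.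
by rewrite rmorph0 mul0r addr0.
Qed.

Lemma nonsplit_mx_unit y : y != 0 -> nonsplit_mx y \in unitmx.
Proof.
move=> y0; have : nonsplit_mx y *m nonsplit_mx y^-1 = 1%:M.
  by rewrite -nonsplit_mxM divff // -(rmorph1 iF) nonsplit_mx_scalar mat2_1.
by move/mulmx1_unit => [].
Qed.

Lemma nonsplit_mx_root y : root (char_poly (map_mx iF (nonsplit_mx y))) y.
Proof.
rewrite rootE char_poly_mat2 det_map_mx trace_map_mx.
rewrite /nonsplit_mx trace_mat2 !mat2E det_mat2.
move: (coord1 y) (coord2 y) (coordE y) => a b ->; apply/eqP.
rewrite !(rmorphB, rmorphD, rmorphM, rmorphXn) /= -s2; ring.
Qed.

Lemma pgl_nonsplit_mx y a b : y != 0 -> y = iF a + iF b * s ->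
  pgl (nonsplit_mx y) =
  (unipotent u * pgl (mat2 a (alpha * b)%R b a) * unipotent (- u)%R)%g.
Proof.
move=> y0 yE; have Uu (v : F) : mat2 1 v 0 1 \in unitmx.
  by rewrite unit_mat2 mulr0 subr0 mulr1 oner_neq0.
have NE : nonsplit_mx y = mat2 1 u 0 1 *m mat2 a (alpha * b) b a *m mat2 1 (- u) 0 1.
  by rewrite (nonsplit_mxE yE) !mul_mat2; congr mat2; ring.
have mu : mat2 a (alpha * b) b a \in unitmx.
  by have := nonsplit_mx_unit y0; rewrite NE !unitmx_mul !Uu andbT.
by rewrite NE pglM ?(pglM (Uu u) mu) ?Uu ?unitmx_mul ?Uu ?mu.
Qed.

(** The non-split torus is the group of the [a + b * s] modulo scalars: dividing
    by [a], or by [b] if [a = 0], gives the representatives [1 + z * s] and [s]. *)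
Lemma nonsplit_torus_shiftE :
  nonsplit_torus_shift alpha u = [set pgl (nonsplit_mx y) | y in [pred y : F2 | y != 0]].
Proof.
have y0 (a b : F) : (a != 0) || (b != 0) -> iF a + iF b * s != 0.
  move=> ab; apply/eqP => e; have [a0 b0] : a = 0 /\ b = 0.
    by apply: quadratic_coord_inj; rewrite e !rmorph0 mul0r addr0.
  by move: ab; rewrite a0 b0 eqxx.
have ku (a b : F) : (a != 0) || (b != 0) -> mat2 a (alpha * b) b a \in unitmx.
  move=> ab; rewrite unit_mat2 -mulrA -!expr2 subr_eq0; have [b0|b0] := eqVneq b 0.
    by move: ab; rewrite b0 eqxx orbF expr0n mulr0 expf_eq0.
  apply: contra (alpha_nsq (a / b)) => /eqP e.
  by rewrite expr_div_n e mulfK // expf_neq0.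
apply/finset.setP => g; apply/imsetP/imsetP => [[k kK ->]|[y y_neq0 ->]].
  have [a [b [ab kE]]] : exists a b, ((a != 0) || (b != 0)) /\ k = pgl (mat2 a (alpha * b) b a).
    move: kK; rewrite inE => /orP[/imsetP[z _ ->]|/finset.set1P ->].
      by exists 1, z; rewrite oner_neq0.
    by exists 0, 1; rewrite oner_neq0 orbT mulr1.
  exists (iF a + iF b * s); first by rewrite inE y0.
  by rewrite (pgl_nonsplit_mx (y0 a b ab) erefl) kE.
rewrite inE in y_neq0; have yE := coordE y.
move: (coord1 y) (coord2 y) yE => a b yE.
exists (pgl (mat2 a (alpha * b) b a)); last by rewrite (pgl_nonsplit_mx y_neq0 yE).
rewrite inE; have [a0|a0] := eqVneq a 0.
  have b0 : b != 0.
    by apply: contra y_neq0 => /eqP b0; rewrite yE a0 b0 rmorph0 mul0r addr0.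
  apply/orP; right; apply/finset.set1P; rewrite a0.
  have -> : mat2 0 (alpha * b) b 0 = b *: mat2 0 alpha 1 0.
    by rewrite scale_mat2; congr mat2; ring.
  by apply: pglZ => //; have := ku 0 1; rewrite mulr1 oner_neq0 orbT; apply.
apply/orP; left; apply/imsetP; exists (b / a) => //.
have -> : mat2 a (alpha * b) b a = a *: mat2 1 (alpha * (b / a)) (b / a) 1.
  by rewrite scale_mat2; congr mat2; field.
by apply: pglZ => //; apply: ku; rewrite oner_neq0.
Qed.

(** The columns of the left matrix are eigenvectors for y and its conjugate, and
    the right matrix is its inverse. *)
Lemma nonsplit_mx_diag (y : F2) : 2 != 0 :> F2 ->
  map_mx iF (nonsplit_mx y) =
  mat2 (iF u + s) (iF u - s) 1 1 *m mat2 y 0 0 (y ^+ q) *m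
  ((2 * s)^-1 *: mat2 1 (s - iF u) (-1) (iF u + s)).
Proof.
have sq := sqrt_frobenius; move=> F2_2; have s0 : s != 0 by have := sqrt_notin_F 0; rewrite rmorph0.
set D := mat2 y _ _ _; set M := mat2 (iF u + s) _ _ _; set N := _ *: _.
have MN : M *m N = 1%:M.
  by rewrite -scalemxAr mul_mat2 scale_mat2 -mat2_1; congr mat2; field; rewrite s0.
suff E : map_mx iF (nonsplit_mx y) *m M = M *m D by rewrite -E -mulmxA MN mulmx1.
rewrite /M /D map_mat2 !mul_mat2 !(rmorphB, rmorphD, rmorphM, rmorphXn) /= -s2.
move: (coord1 y) (coord2 y) (coordE y) => a b yE.
have yq : y ^+ q = iF a - iF b * s.
  rewrite yE (card_frobeniusD iF p_pr cardF) exprMn sq !iF_frobenius; ring.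
by rewrite yq yE; congr mat2; ring.
Qed.

Lemma nonsplit_mx_det (y : F2) : iF (\det (nonsplit_mx y)) = y ^+ (q + 1).
Proof.
have sq := sqrt_frobenius.
rewrite det_mat2 !(rmorphB, rmorphD, rmorphM, rmorphXn) /= -s2 addn1 [y ^+ _.+1]exprSr.
move: (coord1 y) (coord2 y) (coordE y) => a b yE.
have yq : y ^+ q = iF a - iF b * s.
  rewrite yE (card_frobeniusD iF p_pr cardF) exprMn sq !iF_frobenius; ring.
by rewrite yq yE; ring.
Qed.

End NonsplitTorus.

(** * The correlation coefficient modulo p *)

(** The second symmetric power contributes nothing, because the split torus fixes
    no nonzero vector in it. *)
Lemma sym_trace_torus_sum (F F2 : finFieldType) (iF : {rmorphism F -> F2}) (p m : nat)
    (p_pr : prime p) (cardF : #|F| = (p ^ m)%N) (cardF2 : #|F2| = (#|F| ^ 2)%N)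
    (alpha u : F) (s : F2) (alpha_nsq : forall b : F, alpha != b ^+ 2)
    (s2 : s ^+ 2 = iF alpha) (r n e : nat) (eps : F2) :
  2 != 0 :> F2 -> (r.*2 <= #|F|.-1)%N ->
  (forall i, (i <= n)%N -> ~~ (#|F|.-1 %| i + e)%N) ->
  \sum_(a : F | a != 0) \sum_(y : F2 | y != 0) sym_trace F r n e eps
    (map_mx iF (mat2 a 0 0 1 *m nonsplit_mx cardF2 u alpha_nsq s2 y)) =
  (legendre_in F2 r).[iF u / s] ^+ 2.
Proof.
move=> F2_2 rq wt; have s0 : s != 0 by have := sqrt_notin_F alpha_nsq s2 0; rewrite rmorph0.
have detE (a : F) y : \det (map_mx iF (mat2 a 0 0 1 *m nonsplit_mx cardF2 u alpha_nsq s2 y)) =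
    iF a * y ^+ (#|F| + 1).
  rewrite det_map_mx det_mulmx det_mat2 mulr1 mulr0 subr0 rmorphM.
  by rewrite (nonsplit_mx_det _ p_pr cardF).
rewrite -(torus_sum_legendre iF cardF2 (iF u) rq F2_2 s0) -[RHS]addr0.
rewrite /sym_trace; under eq_bigr => a _ do rewrite big_split /=.
rewrite big_split /=; congr (_ + _).
  apply: eq_bigr => a _; apply: eq_bigr => y _.
  by rewrite detE map_mxM map_mat2 rmorph0 rmorph1 (nonsplit_mx_diag _ p_pr cardF).
rewrite exchange_big big1 // => y _; rewrite -mulr_sumr.
under eq_bigr => a _ do rewrite detE exprMn mulrAC map_mxM map_mat2 rmorph0 rmorph1.
rewrite -mulr_suml split_torus_sum big_pred0 ?oppr0 ?mul0r ?mulr0 // => i.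
by apply/negbTE/wt; rewrite -ltnS.
Qed.

Theorem theorem1p1 (p m : nat) (p_pr : prime p) (p_odd : odd p)
    (m_gt0 : (0 < m)%N)
    (* F_q and F_{q^2} *)
    (F F2 : finFieldType) (cardF : #|F| = (p ^ m)%N)
    (cardF2 : #|F2| = (#|F| ^ 2)%N) (iF : {rmorphism F -> F2})
    (* an algebraic closure L of Q_p, isomorphic to the complex numbers *)
    (L : closedFieldType) (iQ : {rmorphism padic_num p_pr -> L})
    (closL : is_padic_closure iQ)
    (R : realType) (iota : {rmorphism R[i] -> L})
    (iotaV : {rmorphism L -> R[i]})
    (iotaK : cancel iota iotaV) (iotaVK : cancel iotaV iota)
    (* the residue field k of L, containing F_{q^2} *)
    (k : closedFieldType) (red : L -> k) (redP : is_residue_map iQ red)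
    (i2 : {rmorphism F2 -> k})
    (* the unramified extension of Q_p of degree m *)
    (Km : fieldExtType (padic_num p_pr)) (dimKm : \dim {:Km} = m)
    (unramKm : unramified Km) (iK : {rmorphism Km -> L})
    (iKQ : forall a : padic_num p_pr, iK a%:A = iQ a)
    (* the Teichmuller characters *)
    (chi : F -> L)
    (chiP : is_Teichmuller iQ red (i2 \o iF : {rmorphism F -> k}) chi)
    (psi : F2 -> L) (psiP : is_Teichmuller iQ red i2 psi)
    (alpha u : F) (alpha_neq0 : alpha != 0)
    (alpha_nsq : forall b : F, alpha != b ^+ 2)
    (n : nat) (rG : mx_representation L (PGL2 F) n)
    (irrG : mx_irreducible rG)
    (fixH : has_fixed_vector rG (split_torus F))
    (fixK : has_fixed_vector rG (nonsplit_torus alpha))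
    (r : nat) (rGr : is_pi iF rG chi psi r) :
  let c := iota (correlation (map_repr iotaV rG) (split_torus F)
                   (nonsplit_torus_shift alpha u)) in
  (exists2 x : Km, padic_ext_integral x & iK x = c) /\
  (forall s : F2, s ^+ 2 = iF alpha ->
     red c = i2 ((legendre_in F2 r).[iF u / s] ^+ 2)).
Proof.
move=> c; have [rq [n' [e [eps [wt trE sumH sumK]]]]] :=
  is_pi_torus p_odd closL redP m_gt0 dimKm unramKm iKQ cardF cardF2 chiP psiP rGr.
have key s : s ^+ 2 = iF alpha ->
    reduces_to iQ red iK i2 c ((legendre_in F2 r).[iF u / s] ^+ 2).
  move=> s2; pose N := nonsplit_mx cardF2 u alpha_nsq s2.
  pose q1 := #|F|.-1; pose q2 := (#|F| ^ 2).-1.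
  have q_gt1 : (1 < #|F|)%N := finNzRing_gt1 F.
  have Nu y : y != 0 -> N y \in unitmx by apply: nonsplit_mx_unit.
  have hu (a : F) : a != 0 -> mat2 a 0 0 1 \in unitmx.
    by move=> a0; rewrite unit_mat2 mulr1 mulr0 subr0.
  (* Both tori as images of multiplicative groups of finite fields. *)
  pose h1 (a : F) := pgl (mat2 a 0 0 1); pose h2 y := pgl (N y).
  have h1M a b : a != 0 -> b != 0 -> h1 (a * b) = (h1 a * h1 b)%g.
    move=> a0 b0; rewrite /h1 -pglM ?hu //; congr pgl; rewrite mul_mat2.
    by congr mat2; ring.
  have h2M x y : x != 0 -> y != 0 -> h2 (x * y) = (h2 x * h2 y)%g.
    by move=> x0 y0; rewrite /h2 -pglM ?Nu // /N nonsplit_mxM.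
  have charC j : (j%:R == 0 :> R[i]) = (j == 0%N) by apply: pnatr_eq0.
  have q1_gt0 : (0 < q1)%N by rewrite /q1 -ltnS prednK // ltnW.
  have q2_gt0 : (0 < q2)%N by rewrite /q2 -subn1 subn_gt0 -{1}(expn0 #|F|) ltn_exp2l.
  have sumK' : \sum_(y | y != 0) \tr (rG (h2 y)) = q2%:R.
    apply: sumK => // [a|y _]; [exact: nonsplit_mx_scalar | exact: nonsplit_mx_root].
  pose rC := map_repr iotaV rG.
  have trC (E : finFieldType) (h : E -> coset_of (GL2_center F)) N0 : #|E|.-1 = N0 -> (0 < N0)%N ->
      \sum_(x | x != 0) \tr (rG (h x)) = N0%:R -> \tr (torus_projector rC h) = 1.
    move=> cE N0_gt0 sumE; rewrite /torus_projector cE linearZ /= raddf_sum /=.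
    under eq_bigr => x _ do rewrite trace_map_mx.
    by rewrite -rmorph_sum sumE rmorph_nat mulVf // charC -lt0n.
  have cE : c = (q1%:R^-1 * q2%:R^-1) * \sum_(a : F | a != 0) \sum_(y : F2 | y != 0)
      \tr (rG (pgl (mat2 a 0 0 1 *m N y))).
    have -> : c = iota (\tr (torus_projector rC h1 *m torus_projector rC h2)).
      congr (iota _); apply: correlation_trace => //.
      - by move=> a _; apply: pgl_PGL2.
      - by move=> y _; apply: pgl_PGL2.
      - move=> v; split=> [fv a a0|fv _ /imsetP[a a0 ->]]; last exact: fv.
        by apply: fv; apply/imsetP; exists a.
      - move=> v; rewrite (nonsplit_torus_shiftE cardF2 u alpha_nsq s2).
        split=> [fv y y0|fv _ /imsetP[y y0 ->]]; last exact: fv.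
        by apply: fv; apply/imsetP; exists y.
      - exact: trC sumH.
      - by apply: trC sumK'; rewrite // cardF2.
    rewrite /torus_projector -scalemxAl -scalemxAr scalerA cardF2 linearZ /= rmorphM.
    rewrite rmorphM !fmorphV !rmorph_nat; congr (_ * _).
    rewrite mulmx_suml (raddf_sum mxtrace) rmorph_sum; apply: eq_bigr => a a0.
    rewrite mulmx_sumr (raddf_sum mxtrace) rmorph_sum; apply: eq_bigr => y y0 /=.
    rewrite -map_mxM trace_map_mx iotaVK repr_pglM ?hu ?Nu //.
  (* The orders q - 1 and q ^ 2 - 1 are units in the ring of integers, with
     residue -1. *)
  have copq N0 : (0 < N0)%N -> coprime (p ^ N0).-1 p.
    move=> N0_gt0; rewrite coprime_sym -(coprime_pexpl _ _ N0_gt0).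
    by rewrite coprimenP // expn_gt0 prime_gt0.
  have pF2 : p%:R = 0 :> F2.
    have := card_finPcharP cardF p_pr; rewrite inE => /andP[_ /eqP pF].
    by rewrite -(rmorph_nat iF) pF rmorph0.
  have F2_2 : 2 != 0 :> F2.
    apply/eqP => F2_2; have /eqP[] := oner_neq0 F2.
    by rewrite -pF2 -(odd_double_half p) p_odd natrD -mul2n natrM F2_2 mul0r addr0.
  have predE N0 : (0 < N0)%N -> ((p ^ N0).-1)%:R = -1 :> F2.
    move=> N0_gt0; apply: (addIr 1); rewrite addNr natr1 prednK ?expn_gt0 ?prime_gt0 //.
    by rewrite natrX pF2 expr0n gtn_eqF.
  have -> : (legendre_in F2 r).[iF u / s] ^+ 2 =
      (q1%:R^-1 * q2%:R^-1) * \sum_(a : F | a != 0) \sum_(y : F2 | y != 0)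
        sym_trace F r n' e eps (map_mx iF (mat2 a 0 0 1 *m N y)).
    rewrite (sym_trace_torus_sum p_pr cardF cardF2 u alpha_nsq s2) //.
    rewrite /q1 /q2 cardF -expnM !predE ?muln_gt0 ?m_gt0 //.
    by rewrite invrN1 mulrNN !mul1r.
  rewrite cE; apply: (reducesM redP).
    apply: (reducesM redP); apply: (reduces_natV redP); rewrite /q1 /q2 cardF ?copq //.
    by rewrite -expnM copq // muln_gt0 m_gt0.
  apply: (reduces_sum redP) => a a0; apply: (reduces_sum redP) => y y0.
  by apply: trE; rewrite unitmx_mul hu ?Nu.
split=> [|s s2]; last by case: (key s s2).
(* The matrix with characteristic polynomial ['X^2 - alpha] yields a square root
   of alpha. *)
have [s] := eigenvalue_quadratic p_pr iF i2 cardF cardF2 (mat2 0 alpha 1 0).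
rewrite rootE char_poly_mat2 det_map_mx trace_map_mx trace_mat2 !mat2E det_mat2.
rewrite addr0 rmorph0 !mul0r subr0 sub0r mulr1 rmorphN subr_eq0 => /eqP s2.
have [[x intx xc] _] := key s s2.
by exists x; rewrite // (padic_ext_integralE iKQ).
Qed.
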